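(* Let $M\subset\mathbb{C}^2$ be a formal hypersurface such that $Q_M$ contains at least two points $(\alpha,\mu)\neq(\tilde\alpha,\tilde\mu)$ and (say) $(\alpha,\mu)$ satisfies $\alpha\neq n:=n(\alpha,\mu)$; put $\tilde n:=n(\tilde\alpha,\tilde\mu)$. Then there exists a system of normal coordinates $(z,w)$ for $M$ such that $M$ is given by $w=Q(z,\bar z,\bar w)$ and $Q$ is in its normal form. Furthermore, if $(z,w)$ are such coordinates, then for any other such system of coordinates $(z',w')$, where $z=F(z',w')$, $w=G(z',w')$, the series $F$ and $G$ are uniquely determined by $F_z(0)$, $G_w(0)$ and $\operatorname{Re}G_{w^{k+1}}(0)$ for $k\in K$, and $(F_z(0),G_w(0))$ belongs to the set $C(\alpha,n,\mu)\cap C(\tilde\alpha,\tilde n,\tilde\mu)$. Here $K$ is the set (consisting of at most one point) of integers $k\ge1$ such that $$D_k:=\det\begin{pmatrix}\alpha+n&\frac{\mu}{k+1}-1\\ \tilde\alpha+\tilde n&\frac{\tilde\mu}{k+1}-1\end{pmatrix}=0 .$$ The set $K$ is empty if and only if $n+\alpha=\tilde n+\tilde\alpha$ or $$\lambda:=\frac{(\tilde\alpha+\tilde n)\mu-(\alpha+n)\tilde\mu}{(\tilde\alpha+\tilde n)-(\alpha+n)}-1$$ is not an integer $\ge1$.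
   Context: $\mathbb{N}=\{0,1,2,\dots\}$, $\mathbb{C}^*=\mathbb{C}\setminus\{0\}$, $\mathbb{R}^*=\mathbb{R}\setminus\{0\}$. A bar over a power series means that its coefficients are conjugated. Subscripts $z$, $w$, $w^k$ on $F,G$ denote partial derivatives with respect to the first variable, the second variable, and the second variable $k$ times. Formal hypersurfaces: a formal hypersurface $M$ through $p\in\mathbb{C}^2$ is given by a formal power series $\rho(Z,\bar Z)$ in $Z-p,\overline{Z-p}$ which is real ($\rho_{I\bar J}=\overline{\rho_{J\bar I}}$), has zero constant term, and satisfies $d\rho\ne0$ at $p$. Normal coordinates: these are formal holomorphic coordinates $(z,w)$ vanishing at $p$ in which $M$ is given by $\operatorname{Im}w=\varphi(z,\bar z,\operatorname{Re}w)$, with $\varphi(z,\chi,s)=\bar\varphi(\chi,z,s)$ and $\varphi(z,0,s)\equiv\varphi(0,\chi,s)\equiv0$. Equivalently, $M$ is given by $w=Q(z,\bar z,\bar w)$ with $Q(z,0,\tau)\equiv Q(0,\chi,\tau)\equiv\tau$ and $Q(z,\chi,\bar Q(\chi,z,\tau))\equiv\tau$. Expand $\varphi(z,\chi,s)=\sum_{\alpha\ge1,\mu\ge0}\varphi_{\alpha,\mu}(\chi)z^\alpha s^\mu$ and $Q(z,\chi,\tau)=\tau+\sum_{\alpha\ge1,\mu\ge0}q_{\alpha,\mu}(\chi)z^\alpha\tau^\mu$. Invariant pairs: on $\mathbb{N}^2$ let $(\alpha,\mu)\preceq(\beta,\nu)$ iff $\alpha+\mu\le\beta+\nu$ and $\mu\le\nu$;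 let $\prec$ mean $\preceq$ and $\neq$. A pair $(\alpha_0,\mu_0)$ is an invariant pair of $M$ if $\varphi_{\alpha_0,\mu_0}\not\equiv0$ but $\varphi_{\alpha,\mu}\equiv0$ for every $(\alpha,\mu)\prec(\alpha_0,\mu_0)$. $Q_M$ is the set of invariant pairs, and $n(\alpha,\mu):=\min\{n:\frac{d^n\varphi_{\alpha,\mu}}{d\chi^n}(0)\neq0\}$ for $(\alpha,\mu)\in Q_M$. Both are independent of the choice of normal coordinates. The sets $C$: $C(\alpha,n,\mu):=\{(\gamma,r)\in\mathbb{C}^*\times\mathbb{R}^*:\gamma^\alpha\bar\gamma^{\,n}r^{\mu-1}=1\}$. The invariants $c,\varepsilon$: let $(\alpha,\mu)\neq(\tilde\alpha,\tilde\mu)$ be invariant pairs with $n=n(\alpha,\mu)\ne\alpha$, $\tilde n=n(\tilde\alpha,\tilde\mu)$. Case A is the case $\tilde\mu(\alpha+n)-\mu(\tilde\alpha+\tilde n)=(\alpha+n)-(\tilde\alpha+\tilde n)$; Case B is the opposite case. There exist normal coordinates with $q_{\alpha,\mu}(\chi)=2i\chi^n$. In Case A, $c>0$ denotes the absolute value of the coefficient of $\chi^{\tilde n}$ in $q_{\tilde\alpha,\tilde\mu}(\chi)$ in any such coordinates (it does not depend on their choice). In Case B, $c:=2$. Further, $\varepsilon\in\mathsf{U}(1)$ is the unimodular number with smallest argument in $[0,2\pi)$ among all (finitely many) unimodular numbers $\varepsilon'$ for which there are normal coordinates with $q_{\alpha,\mu}(\chi)=2i\chi^n$ and $q_{\tilde\alpha,\tilde\mu}(\chi)=ic\varepsilon'\chi^{\tilde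 n}+O(\chi^{\tilde n+1})$. Normal form: since $(\alpha,\mu)\neq(\tilde\alpha,\tilde\mu)$ are both invariant pairs, at least one of $\alpha,\tilde\alpha$ is $>1$. Let $(\alpha',\mu')$ denote a fixed choice of one of the pairs $(\alpha,\mu),(\tilde\alpha,\tilde\mu)$ with $\alpha'>1$, and let $n'=n(\alpha',\mu')$. $Q$ is said to be in its normal form if (1) $q_{\alpha,\mu}(\chi)=2i\chi^n$ and $q_{\tilde\alpha,\tilde\mu}(\chi)=ic\varepsilon\chi^{\tilde n}+O(\chi^{\tilde n+1})$; (2) $q_{\alpha,\mu+k}(\chi)$ is a polynomial of degree at most $n-1$ for all $k\ge1$; (3) $q^{(n')}_{\alpha'-1,\mu'+k}(0)=0$ for all $k\ge1$; (4) $\operatorname{Im}\big(\varepsilon^{-1}q^{(\tilde n)}_{\tilde\alpha,\tilde\mu+k}(0)\big)=0$ for all $k\ge1$ with $k\notin K$. *)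

(* Defs.v *)
From HB Require Import structures.
From mathcomp Require Import all_boot all_order all_algebra.
From mathcomp Require Import complex.
From mathcomp Require Import boolp classical_sets reals trigo.
Set Implicit Arguments.
Unset Strict Implicit.
Unset Printing Implicit Defensive.
Import Order.TTheory GRing.Theory Num.Theory.
Local Open Scope classical_set_scope.
Local Open Scope ring_scope.

(* The complex numbers are R[i] for R : realType.  The scope %C selects the   *)
(* concrete imaginary unit 'i%C = Complex 0 1 and the conjugation conjc of    *)
(* real_closed.complex, rather than the generic ones of numClosedFieldType.   *)

Definition mindex (n : nat) := n.-tuple nat.

Definition mdeg (n : nat) (m : mindex n) : nat := (\sum_(i < n) tnth m i)%N.

Definition mzero (n : nat) : mindex n := [tuple 0%N | i < n].

Definition munit (n : nat) (j : 'I_n) : mindex n := [tuple nat_of_bool (i == j) | i < n].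

Definition madd (n : nat) (k l : mindex n) : mindex n :=
  [tuple (tnth k i + tnth l i)%N | i < n].

(* The multi-indices with entries at most d form the finite type              *)
(* n.-tuple 'I_d.+1, over which finite sums are taken.                        *)
Definition mofbox (n d : nat) (k : n.-tuple 'I_d.+1) : mindex n :=
  [tuple nat_of_ord (tnth k i) | i < n].

(* f m is the coefficient of x^m. *)
Definition fps (R : realType) (n : nat) := mindex n -> R[i].

Section PowerSeries.
Variables (R : realType).
Implicit Types n q : nat.

Definition fcoef0 n (f : fps R n) : R[i] := f (mzero n).

Definition fzero {n} : fps R n := fun _ => 0.

Definition fone {n} : fps R n := fun m => (m == mzero n)%:R.

Definition fvar n (j : 'I_n) : fps R n := fun m => (m == munit j)%:R.

Definition fadd n (f g : fps R n) : fps R n := fun m => f m + g m.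

Definition fsub n (f g : fps R n) : fps R n := fun m => f m - g m.

Definition fscale n (c : R[i]) (f : fps R n) : fps R n := fun m => c * f m.

Definition fmul n (f g : fps R n) : fps R n := fun m =>
  \sum_(k : n.-tuple 'I_(mdeg m).+1)
    \sum_(l : n.-tuple 'I_(mdeg m).+1 | madd (mofbox k) (mofbox l) == m)
      f (mofbox k) * g (mofbox l).

Definition fexp n (f : fps R n) (e : nat) : fps R n := iter e (fmul f) fone.

(* Conjugation of the coefficients only. *)
Definition fconj n (f : fps R n) : fps R n := fun m => ((f m)^*)%C.

(* Substitution f(g_1,...,g_q).  It is only used for g_i with zero constant   *)
(* term: then g^k has no term of degree < |k|, so the coefficient at m only   *)
(* involves the k with all entries at most |m|.                               *)
Definition fsubst q n (f : fps R q) (g : q.-tuple (fps R n)) : fps R n := fun m =>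
  \sum_(k : q.-tuple 'I_(mdeg m).+1)
    f (mofbox k) *
    (\big[@fmul n/@fone n]_(i < q) fexp (tnth g i) (tnth k i)) m.

Definition fderiv n (j : 'I_n) (f : fps R n) : fps R n :=
  fun m => f (madd m (munit j)) *+ (tnth m j).+1.

Definition feq_upto n (N : nat) (f g : fps R n) : Prop :=
  forall m : mindex n, (mdeg m < N)%N -> f m = g m.

End PowerSeries.

Arguments fzero {R n}.
Arguments fone {R n}.
Arguments fvar {R n} j.


Notation "f +' g" := (fadd f g) (at level 50, left associativity).
Notation "f -' g" := (fsub f g) (at level 50, left associativity).
(* Variables are numbered from 0. *)
Notation "''x_' j" := (fvar (inord j)) (at level 8, j at level 2, format "''x_' j").

(* fh_rho is the expansion of rho in powers of Z - p and its conjugate, where *)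
(* p = fh_base; the four variables are ordered Z_1, Z_2, bar Z_1, bar Z_2.    *)
Record formal_hypersurface (R : realType) := FormalHypersurface {
  fh_base : R[i] * R[i];
  fh_rho : fps R 4;
  fh_real : forall a b c d : nat,
    fh_rho [tuple a; b; c; d] = ((fh_rho [tuple c; d; a; b])^*)%C;
  fh_coef0 : fcoef0 fh_rho = 0;
  fh_diff : exists j : 'I_4, fcoef0 (fderiv j fh_rho) <> 0 }.

Section Hypersurface.
Variable R : realType.
Implicit Types (M : formal_hypersurface R) (H : fps R 2 * fps R 2).
Implicit Types (phi Q : fps R 3).

(* A formal holomorphic change of coordinates fixing the origin; when read as *)
(* coordinates (z,w) vanishing at the base point p, it stands for             *)
(* Z = p + H(z,w).                                                            *)
Definition formal_coords H : Prop :=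
  [/\ fcoef0 H.1 = 0, fcoef0 H.2 = 0 &
      fcoef0 (fderiv (inord 0) H.1) * fcoef0 (fderiv (inord 1) H.2) -
      fcoef0 (fderiv (inord 1) H.1) * fcoef0 (fderiv (inord 0) H.2) <> 0].

Definition coords_comp H (FG : fps R 2 * fps R 2) : fps R 2 * fps R 2 :=
  (fsubst H.1 [tuple FG.1; FG.2], fsubst H.2 [tuple FG.1; FG.2]).

(* In the four variables z, w, bar z, bar w (in this order). *)
Definition pullback M H : fps R 4 :=
  fsubst (fh_rho M)
    [tuple fsubst H.1 [tuple 'x_0; 'x_1]; fsubst H.2 [tuple 'x_0; 'x_1];
           fsubst (fconj H.1) [tuple 'x_2; 'x_3];
           fsubst (fconj H.2) [tuple 'x_2; 'x_3]].

(* In the coordinates H, M is given by the equation f = 0: the two defining   *)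
(* series agree up to an invertible factor.                                   *)
Definition given_by M H (f : fps R 4) : Prop :=
  exists2 u : fps R 4, fcoef0 u <> 0 & pullback M H = fmul u f.

(* Im w - phi(z, bar z, Re w) *)
Definition eqn_phi phi : fps R 4 :=
  fscale (2 * 'i%C)^-1 ('x_1 -' 'x_3) -'
  fsubst phi [tuple 'x_0; 'x_2; fscale 2^-1 ('x_1 +' 'x_3)].

(* w - Q(z, bar z, bar w) *)
Definition eqn_Q Q : fps R 4 := 'x_1 -' fsubst Q [tuple 'x_0; 'x_2; 'x_3].

(* Variables z, chi, s. *)
Definition normal_phi phi : Prop :=
  [/\ phi = fsubst (fconj phi) [tuple 'x_1; 'x_0; 'x_2],
      fsubst phi [tuple 'x_0; fzero; 'x_2] = (fzero : fps R 3) &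
      fsubst phi [tuple fzero; 'x_1; 'x_2] = (fzero : fps R 3)].

(* Variables z, chi, tau. *)
Definition normal_Q Q : Prop :=
  [/\ fsubst Q [tuple 'x_0; fzero; 'x_2] = ('x_2 : fps R 3),
      fsubst Q [tuple fzero; 'x_1; 'x_2] = ('x_2 : fps R 3) &
      fsubst Q [tuple 'x_0; 'x_1; fsubst (fconj Q) [tuple 'x_1; 'x_0; 'x_2]]
        = ('x_2 : fps R 3)].

Definition normal_coords_phi M H phi : Prop :=
  [/\ formal_coords H, normal_phi phi & given_by M H (eqn_phi phi)].

Definition normal_coords_Q M H Q : Prop :=
  [/\ formal_coords H, normal_Q Q & given_by M H (eqn_Q Q)].

(* The series in chi which is the coefficient of z^alpha s^mu (resp.          *)
(* z^alpha tau^mu).  For Q it is only used with alpha >= 1, so the summand    *)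
(* tau of Q plays no role.                                                    *)
Definition coefchi (f : fps R 3) (alpha mu : nat) : fps R 1 :=
  fun k => f [tuple alpha; tnth k ord0; mu].

Definition fnderiv0 (n : nat) (f : fps R 1) : R[i] := fcoef0 (iter n (fderiv ord0) f).

Definition pair_le (p p' : nat * nat) : Prop :=
  (p.1 + p.2 <= p'.1 + p'.2)%N /\ (p.2 <= p'.2)%N.

Definition pair_lt (p p' : nat * nat) : Prop := pair_le p p' /\ p <> p'.

Definition QM M : set (nat * nat) := [set p | exists H phi,
  [/\ normal_coords_phi M H phi, coefchi phi p.1 p.2 <> fzero &
      forall p', pair_lt p' p -> coefchi phi p'.1 p'.2 = fzero]].

(* n(alpha,mu); both Q_M and n(alpha,mu) (for (alpha,mu) in Q_M) do not       *)
(* depend on the normal coordinates in which they are computed.               *)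
Definition nM M (p : nat * nat) : nat := xget 0%N [set n | exists H phi,
  [/\ normal_coords_phi M H phi, fnderiv0 n (coefchi phi p.1 p.2) <> 0 &
      forall j, (j < n)%N -> fnderiv0 j (coefchi phi p.1 p.2) = 0]].

(* The second component is in R^*, seen inside R[i]. *)
Definition Cset (alpha n mu : nat) : set (R[i] * R[i]) := [set x |
  [/\ x.1 <> 0, x.2 <> 0, complex.Im x.2 = 0 &
      x.1 ^+ alpha * (x.1^*)%C ^+ n * x.2 ^ (mu%:Z - 1) = 1]].

(* In the next definitions p, pt are the pairs (alpha,mu), (tilde alpha,      *)
(* tilde mu).                                                                 *)

Definition caseA M (p pt : nat * nat) : bool :=
  pt.2%:Z * (p.1%:Z + (nM M p)%:Z) - p.2%:Z * (pt.1%:Z + (nM M pt)%:Z) ==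
  (p.1%:Z + (nM M p)%:Z) - (pt.1%:Z + (nM M pt)%:Z).

(* q_{alpha,mu}(chi) = 2 i chi^n *)
Definition lead_normalized M (p : nat * nat) Q : Prop :=
  coefchi Q p.1 p.2 = fscale (2 * 'i%C) (fexp 'x_0 (nM M p)).

(* In case A the set below is a singleton. *)
Definition cM M (p pt : nat * nat) : R[i] :=
  if caseA M p pt then
    xget 0 [set c | exists H Q,
      [/\ normal_coords_Q M H Q, lead_normalized M p Q &
          c = `|coefchi Q pt.1 pt.2 [tuple nM M pt]|]]
  else 2.

(* q_{tilde alpha,tilde mu}(chi) = i c e chi^{tilde n} + O(chi^{tilde n + 1}) *)
Definition second_normalized M (p pt : nat * nat) (e : R[i]) Q : Prop :=
  feq_upto (nM M pt).+1 (coefchi Q pt.1 pt.2)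
    (fscale ('i%C * cM M p pt * e) (fexp 'x_0 (nM M pt))).

Definition epsilon_candidates M (p pt : nat * nat) : set R[i] := [set e |
  `|e| = 1 /\ exists H Q, [/\ normal_coords_Q M H Q, lead_normalized M p Q &
                              second_normalized M p pt e Q]].

(* The argument in [0, 2 pi) of a unimodular e. *)
Definition uarg (e : R[i]) : R :=
  xget 0 [set t | 0 <= t < 2 * pi /\ e = Complex (cos t) (sin t)].

Definition epsilonM M (p pt : nat * nat) : R[i] :=
  xget 0 [set e | epsilon_candidates M p pt e /\
    forall e', epsilon_candidates M p pt e' -> uarg e <= uarg e'].

Definition detD M (p pt : nat * nat) (k : nat) : R :=
  \det (\matrix_(i < 2, j < 2)
    nth 0 (nth [::]
      [:: [:: (p.1 + nM M p)%N%:R;   p.2%:R / k.+1%:R - 1];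
          [:: (pt.1 + nM M pt)%N%:R; pt.2%:R / k.+1%:R - 1]] i) j).

Definition Kset M (p pt : nat * nat) : set nat :=
  [set k | (1 <= k)%N /\ detD M p pt k = 0].

Definition lambdaM M (p pt : nat * nat) : R :=
  ((pt.1 + nM M pt)%N%:R * p.2%:R - (p.1 + nM M p)%N%:R * pt.2%:R) /
  ((pt.1 + nM M pt)%N%:R - (p.1 + nM M p)%N%:R) - 1.

(* p' is the pair (alpha',mu') chosen among p, pt. *)
Definition normal_form M (p pt p' : nat * nat) Q : Prop :=
  [/\ lead_normalized M p Q /\ second_normalized M p pt (epsilonM M p pt) Q,
      forall k, (1 <= k)%N -> forall m : mindex 1, (nM M p <= mdeg m)%N ->
        coefchi Q p.1 (p.2 + k)%N m = 0,
      forall k, (1 <= k)%N ->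
        fnderiv0 (nM M p') (coefchi Q (p'.1 - 1)%N (p'.2 + k)%N) = 0 &
      forall k, (1 <= k)%N -> ~ Kset M p pt k ->
        complex.Im ((epsilonM M p pt)^-1 *
          fnderiv0 (nM M pt) (coefchi Q pt.1 (pt.2 + k)%N)) = 0].

Definition normal_form_coords M (p pt p' : nat * nat) H : Prop :=
  exists2 Q, normal_coords_Q M H Q & normal_form M p pt p' Q.

End Hypersurface.

(* Main.v *)
Require Import Defs.
From HB Require Import structures.
From mathcomp Require Import all_boot all_order all_algebra.
From mathcomp Require Import complex.
From mathcomp Require Import boolp classical_sets reals trigo.
From mathcomp Require Import ring zify.

(** The idea is to compare the defining series [Q] and [Q'] of [M] in two systems
    of normal coordinates. If they are related by [z = F (z', w')],
    [w = G (z', w')], then (dropping primes on variables)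

      [G (z, Q') = Q (F (z, Q'), conj F (chi, tau), conj G (chi, tau))]

    ([trans]). Putting [chi = 0] shows that [G] is determined by [F] and by
    [G (0, w)], and that the curve [z = 0] is mapped to a real curve on [M];
    conversely any such data give new normal coordinates ([normal_coords_of]).
    So a transition consists of [F] and of a real parametrization of a curve.

    At an invariant pair [(al, mu)] the series [Q - tau] has a nonzero term
    [z^al tau^mu q (chi)], and no monomials strictly below the pair. Keeping only
    the monomials below or equal to the pair in the transition equation leaves

      [r * q' (chi) = ga^al r^mu * q (conj F (chi, 0))],

    where [ga = F_z (0)] and [r = G_w (0)] is real ([lead_coef_trans]). Hence the
    pair and the order [n] of [q] are invariants, and the coefficient of [chi^n]
    is multiplied by [ga^al (conj ga)^n r^(mu - 1)], which is [1] once this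
    coefficient is normalized. Since [al <> n], the modulus and the phase of this
    factor can be prescribed, so that a choice of [F (z, 0)] makes [q] equal to
    [2 i chi^n], and real scalings then adjust the modulus of the coefficient at
    the second pair ([start_coords]). Between coordinates normalized in this way,
    [F (z, 0) = z] as soon as [ga = r = 1] ([near_id_start]).

    The rest of [F] and [G] is treated by powers of [w]. A transition that is
    the identity below level [k] has, at level [k], the following free data: the
    coefficient [a] of [w^k] in [F (0, w)], then the coefficient
    [f (z) = f_1 z + f_2 z^2 + ...] of [w^k] in [F], and the real coefficient [g]
    of [w^(k+1)] in [G (0, w)]. They act linearly on the coefficients of level
    [k] of [Q]. The number [a] moves [q_{al' - 1, mu' + k}] by
    [al' a q_{al', mu'}] ([level_curve]) and is determined by the condition on
    that series. With [a = 0], the series [q_{al, mu + k}] moves by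
    [(al f_1 + (mu - k - 1) g) q + (dq / dchi) conj f (chi)] with
    [q = 2 i chi^n] ([level_fixed]): here [f_j] with [j >= 2] is determined by the coefficient of
    [chi^(n + j - 1)], and the coefficient of [chi^n] gives

      [(al - n) Im f_1]   and   [(al + n) Re f_1 + (mu - k - 1) g].

    At the second pair the real combination in the normal form only sees
    [(al~ + n~) Re f_1 + (mu~ - k - 1) g]. The two real equations for [Re f_1]
    and [g] have determinant [(k + 1) D_k]; if [k] is in [K], the second
    equation is absent and [g] is a free real parameter.

    Solving these equations level by level produces a sequence of coordinates
    that stabilizes degree by degree, and its limit is in normal form
    ([nf_step], [coords_limit]). Applied to a transition between two normal
    forms with the same parameters, the same equations are homogeneous and force
    the transition to be the identity ([transition_rigid]). *)

Set Implicit Arguments.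
Unset Strict Implicit.
Unset Printing Implicit Defensive.
Import Order.TTheory GRing.Theory Num.Theory.
Local Open Scope classical_set_scope.
Local Open Scope ring_scope.

(** * Multi-indices and sums over boxes *)
Section MultiIndex.
Variable n : nat.
Implicit Types k l m : mindex n.

Lemma tnth_madd k l i : tnth (madd k l) i = (tnth k i + tnth l i)%N.
Proof. by rewrite tnth_mktuple. Qed.

Lemma tnth_mzero i : tnth (mzero n) i = 0%N.
Proof. by rewrite tnth_mktuple. Qed.

Lemma tnth_munit (j i : 'I_n) : tnth (munit j) i = (i == j) :> nat.
Proof. by rewrite tnth_mktuple. Qed.

Lemma mindexP k l : (forall i, tnth k i = tnth l i) -> k = l.
Proof. exact: eq_from_tnth. Qed.

Lemma maddC k l : madd k l = madd l k.
Proof. by apply: mindexP => i; rewrite !tnth_madd addnC. Qed.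

Lemma maddA k l m : madd k (madd l m) = madd (madd k l) m.
Proof. by apply: mindexP => i; rewrite !tnth_madd addnA. Qed.

Lemma madd0 k : madd (mzero n) k = k.
Proof. by apply: mindexP => i; rewrite !tnth_madd tnth_mzero. Qed.

Lemma maddI k l m : madd k l = madd k m -> l = m.
Proof.
move=> e; apply: mindexP => i.
by have := congr1 (fun t => tnth t i) e; rewrite !tnth_madd => /addnI.
Qed.

Lemma mdegD k l : mdeg (madd k l) = (mdeg k + mdeg l)%N.
Proof. by rewrite /mdeg -big_split; apply: eq_bigr => i _; rewrite tnth_madd. Qed.

Lemma mdeg0 : mdeg (mzero n) = 0%N.
Proof. by rewrite /mdeg big1 // => i _; rewrite tnth_mzero. Qed.

Lemma mdeg_munit j : mdeg (munit j : mindex n) = 1%N.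
Proof.
rewrite /mdeg (bigD1 j) //= tnth_munit eqxx big1 // => i /negbTE h.
by rewrite tnth_munit h.
Qed.

Lemma leq_mdeg k i : (tnth k i <= mdeg k)%N.
Proof. by rewrite /mdeg (bigD1 i) //= leq_addr. Qed.

Lemma mdeg_eq0 k : mdeg k = 0%N -> k = mzero n.
Proof.
move=> e; apply: mindexP => i; rewrite tnth_mzero; apply/eqP.
by rewrite -leqn0 -e leq_mdeg.
Qed.

(** All multi-indices with entries at most [N], as a list; sums over growing
    boxes are compared by comparing such lists. *)
Definition mbox (N : nat) : seq (mindex n) :=
  map (@mofbox n N) (enum {: n.-tuple 'I_N.+1}).

Lemma mofbox_inj N : injective (@mofbox n N).
Proof.
move=> k l e; apply: eq_from_tnth => i; apply: val_inj => /=.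
by have := congr1 (fun t => tnth t i) e; rewrite !tnth_mktuple.
Qed.

Lemma mbox_uniq N : uniq (mbox N).
Proof. by rewrite map_inj_uniq ?enum_uniq //; exact: mofbox_inj. Qed.

Lemma mem_mbox N k : (k \in mbox N) = [forall i, tnth k i <= N]%N.
Proof.
apply/mapP/forallP => [[l _ ->] i|h].
  by rewrite tnth_mktuple -ltnS.
exists [tuple inord (tnth k i) | i < n]; first by rewrite mem_enum.
apply: mindexP => i; rewrite !tnth_mktuple inordK // ltnS; exact: h.
Qed.

Lemma mbox_deg N k : (mdeg k <= N)%N -> k \in mbox N.
Proof. by move=> h; rewrite mem_mbox; apply/forallP => i; apply: leq_trans h; apply: leq_mdeg. Qed.

Lemma mboxPn N k : k \notin mbox N -> (N < mdeg k)%N.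
Proof. by apply: contraNT; rewrite -leqNgt; exact: mbox_deg. Qed.

Lemma sum_mbox (V : zmodType) N (F : mindex n -> V) :
  \sum_(k : n.-tuple 'I_N.+1) F (mofbox k) = \sum_(k <- mbox N) F k.
Proof. by rewrite big_map big_enum. Qed.

Lemma sum_mbox_cond (V : zmodType) N (P : pred (mindex n)) (F : mindex n -> V) :
  \sum_(k : n.-tuple 'I_N.+1 | P (mofbox k)) F (mofbox k) = \sum_(k <- mbox N | P k) F k.
Proof. by rewrite big_map big_enum_cond. Qed.

Lemma sum_mbox_ext (V : zmodType) N N' (F : mindex n -> V) : (N <= N')%N ->
  (forall k, (N < mdeg k)%N -> F k = 0) ->
  \sum_(k <- mbox N') F k = \sum_(k <- mbox N) F k.
Proof.
move=> leN h.
rewrite (bigID (fun k => k \in mbox N)) /= addrC big1_seq ?add0r; last first.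
  by move=> k /andP[/mboxPn/h].
rewrite -big_filter; apply: perm_big; apply: uniq_perm; rewrite ?filter_uniq ?mbox_uniq //.
move=> k; rewrite mem_filter andb_idr // !mem_mbox => /forallP g.
by apply/forallP => i; apply: leq_trans leN.
Qed.

Lemma sum_mbox1 (V : zmodType) N (F : mindex n -> V) k : k \in mbox N ->
  (forall l, l != k -> F l = 0) -> \sum_(l <- mbox N) F l = F k.
Proof. by move=> kN h; rewrite (bigD1_seq k) ?mbox_uniq //= big1 ?addr0. Qed.

End MultiIndex.

(** * The ring of formal power series *)
Section Ring.
Variables (R : realType) (n : nat).
Local Notation C := R[i].
Local Notation A := (fps R n).
Implicit Types f g h : A.

Lemma fpsP f g : (forall m, f m = g m) -> f = g.
Proof. by move=> e; apply: funext. Qed.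

Lemma fmulE N f g m : (mdeg m <= N)%N ->
  fmul f g m = \sum_(k <- mbox n N) \sum_(l <- mbox n N) (madd k l == m)%:R * (f k * g l).
Proof.
move=> leN; rewrite /fmul (sum_mbox _ (fun k => \sum_(l : n.-tuple 'I_(mdeg m).+1 | madd k (mofbox l) == m) f k * g (mofbox l))).
transitivity (\sum_(k <- mbox n N) \sum_(l : n.-tuple 'I_(mdeg m).+1 | madd k (mofbox l) == m) f k * g (mofbox l)).
  symmetry; apply: sum_mbox_ext => // k hk; rewrite big1 // => l /eqP e.
  by have := congr1 (@mdeg n) e; rewrite mdegD => e'; move: hk; rewrite ltnNge -[X in (_ <= X)%N]e' leq_addr.
apply: eq_bigr => k _.
rewrite (sum_mbox_cond _ (fun l => madd k l == m) (fun l => f k * g l)).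
rewrite big_mkcond /=.
rewrite -(@sum_mbox_ext n _ _ N) //; last first.
  move=> l hl; case: eqP => // e; move: hl.
  by rewrite -e mdegD ltnNge leq_addl.
by apply: eq_bigr => l _; case: eqP => _; rewrite ?mul1r ?mul0r.
Qed.

Lemma fmulC : commutative (@fmul R n).
Proof.
move=> f g; apply: fpsP => m; rewrite !(fmulE _ _ (leqnn _)) exchange_big /=.
by apply: eq_bigr => k _; apply: eq_bigr => l _; rewrite maddC [f _ * _]mulrC.
Qed.

Lemma fmul3E f g h m : fmul f (fmul g h) m =
  \sum_(k <- mbox n (mdeg m)) \sum_(l <- mbox n (mdeg m)) \sum_(j <- mbox n (mdeg m))
    (madd k (madd l j) == m)%:R * (f k * (g l * h j)).
Proof.
set N := mdeg m.
rewrite (fmulE _ _ (leqnn _)); apply: eq_bigr => k _.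
transitivity (\sum_(a <- mbox n N) \sum_(l <- mbox n N) \sum_(j <- mbox n N)
   (madd k a == m)%:R * (madd l j == a)%:R * (f k * (g l * h j))).
  apply: eq_bigr => a _; have [e|ne] := eqVneq (madd k a) m; last first.
    by rewrite mul0r big1 // => l _; rewrite big1 // => j _; rewrite !mul0r.
  have le : (mdeg a <= N)%N by rewrite /N -e mdegD leq_addl.
  rewrite (fmulE _ _ le) mul1r mulr_sumr; apply: eq_bigr => l _.
  rewrite mulr_sumr; apply: eq_bigr => j _; rewrite mul1r; ring.
rewrite exchange_big; apply: eq_bigr => l _.
rewrite exchange_big; apply: eq_bigr => j _ /=.
rewrite -mulr_suml; congr (_ * _).
have [e|ne] := eqVneq (madd k (madd l j)) m.
  rewrite (@sum_mbox1 n _ _ _ (madd l j)).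
  - by rewrite e !eqxx mulr1.
  - by apply: mbox_deg; rewrite /N -e (mdegD k) leq_addl.
  - by move=> b; rewrite eq_sym => /negbTE ->; rewrite mulr0.
rewrite big1 // => b _; have [e|ne'] := eqVneq (madd l j) b; last by rewrite mulr0.
by rewrite -e (negbTE ne) mul0r.
Qed.

Lemma fmulA : associative (@fmul R n).
Proof.
move=> f g h; rewrite [RHS]fmulC; apply: fpsP => m; rewrite !fmul3E.
rewrite [RHS]exchange_big /=; apply: eq_bigr => k _.
rewrite [RHS]exchange_big /=; apply: eq_bigr => l _; apply: eq_bigr => j _.
have -> : madd j (madd k l) = madd k (madd l j) by rewrite maddC maddA.
congr (_ * _); ring.
Qed.

Lemma fmul1 : left_id fone (@fmul R n).
Proof.
move=> f; apply: fpsP => m; rewrite (fmulE _ _ (leqnn _)).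
rewrite (@sum_mbox1 n _ _ _ (mzero n)).
- rewrite (@sum_mbox1 n _ _ _ m) ?madd0 ?eqxx ?mbox_deg // ?mul1r //.
    by rewrite /fone eqxx mul1r.
  by move=> l /negbTE ne; rewrite madd0 ne mul0r.
- by apply: mbox_deg; rewrite mdeg0.
- move=> l /negbTE ne; apply: big1 => j _; by rewrite /fone ne mul0r mulr0.
Qed.

Lemma fmulDl : left_distributive (@fmul R n) (@fadd R n).
Proof.
move=> f g h; apply: fpsP => m; rewrite /fadd !(fmulE _ _ (leqnn _)) -big_split.
apply: eq_bigr => k _; rewrite -big_split; apply: eq_bigr => l _ /=; ring.
Qed.

Lemma fone_neq0 : (fone : A) <> fzero.
Proof.
move=> /(congr1 (fun f : A => f (mzero n))); rewrite /fone /fzero eqxx => /eqP.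
by rewrite oner_eq0.
Qed.

Definition fopp f : A := fun m => - f m.

Lemma faddA : associative (@fadd R n).
Proof. by move=> f g h; apply: fpsP => m; rewrite /fadd addrA. Qed.
Lemma faddC : commutative (@fadd R n).
Proof. by move=> f g; apply: fpsP => m; rewrite /fadd addrC. Qed.
Lemma fadd0 : left_id fzero (@fadd R n).
Proof. by move=> f; apply: fpsP => m; rewrite /fadd add0r. Qed.
Lemma faddN : left_inverse fzero fopp (@fadd R n).
Proof. by move=> f; apply: fpsP => m; rewrite /fadd /fopp addNr. Qed.

End Ring.

HB.instance Definition _ (R : realType) n := gen_eqMixin (fps R n).
HB.instance Definition _ (R : realType) n := gen_choiceMixin (fps R n).
HB.instance Definition _ (R : realType) n := GRing.isZmodule.Build (fps R n)
  (@faddA R n) (@faddC R n) (@fadd0 R n) (@faddN R n).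
Lemma fone_neq0b (R : realType) n : (fone : fps R n) != fzero.
Proof. by apply/eqP; exact: fone_neq0. Qed.
HB.instance Definition _ (R : realType) n := GRing.Zmodule_isComNzRing.Build (fps R n)
  (@fmulA R n) (@fmulC R n) (@fmul1 R n) (@fmulDl R n) (@fone_neq0b R n).

(** * Coefficients, order of vanishing, infinite sums *)
Section Coef.
Variables (R : realType) (n : nat).
Local Notation C := R[i].
Local Notation A := (fps R n).
Implicit Types (f g h : A) (m k l : mindex n) (c : C).

Definition mon k : A := fun m => (m == k)%:R.
Definition fC c : A := fun m => if m == mzero n then c else 0.
Definition zc f := fcoef0 f = 0.
Definition ford N f := forall m, (mdeg m < N)%N -> f m = 0.

Lemma fcfD f g m : (f + g) m = f m + g m. Proof. by []. Qed.
Lemma fcfN f m : (- f) m = - f m. Proof. by []. Qed.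
Lemma fcfB f g m : (f - g) m = f m - g m. Proof. by []. Qed.
Lemma fcf_0 m : (0 : A) m = 0. Proof. by []. Qed.
Lemma fcf_1 m : (1 : A) m = (m == mzero n)%:R. Proof. by []. Qed.

Lemma fcf_sum I (r : seq I) (P : pred I) (F : I -> A) m :
  (\sum_(i <- r | P i) F i) m = \sum_(i <- r | P i) F i m.
Proof. by elim/big_rec2 : _ => // i x y _ <-. Qed.

Lemma fcfMn f m j : (f *+ j) m = f m *+ j.
Proof. by elim: j => // j IH; rewrite !mulrS fcfD IH. Qed.

Lemma fcfM N f g m : (mdeg m <= N)%N -> (f * g) m =
  \sum_(k <- mbox n N) \sum_(l <- mbox n N) (madd k l == m)%:R * (f k * g l).
Proof. exact: fmulE. Qed.

Lemma fcfM_eq0 f g m : (forall k l, madd k l = m -> f k = 0 \/ g l = 0) -> (f * g) m = 0.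
Proof.
move=> h; rewrite (fcfM _ _ (leqnn _)) big1 // => k _; rewrite big1 // => l _.
by case: eqP => [/h [] ->|_]; rewrite ?mul0r ?mulr0 ?mul0r.
Qed.

Lemma fcf_monM k l f : (mon k * f) (madd k l) = f l.
Proof.
rewrite (fcfM _ _ (leqnn _)) (@sum_mbox1 n _ _ _ k).
- rewrite (@sum_mbox1 n _ _ _ l) ?/mon ?eqxx ?mul1r //.
    by apply: mbox_deg; rewrite mdegD leq_addl.
  move=> j /eqP ne; case: eqP => [/maddI //|_]; by rewrite mul0r.
- by apply: mbox_deg; rewrite mdegD leq_addr.
by move=> j ne; rewrite big1 // => i _; rewrite /mon (negbTE ne) mul0r mulr0.
Qed.

Lemma fcf_monM0 k f m : (forall l, madd k l <> m) -> (mon k * f) m = 0.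
Proof.
move=> h; apply: fcfM_eq0 => j l e; left; rewrite /mon; case: eqP => // e'.
by case: (h l); rewrite -e e'.
Qed.

Lemma monD k l : mon (madd k l) = mon k * mon l.
Proof.
apply: fpsP => m; have [[j e]|h] := pselect (exists j, madd k j = m).
  rewrite -e fcf_monM /mon (_ : (madd k j == madd k l) = (j == l)) //.
  by apply/eqP/eqP => [/maddI //|-> //].
rewrite fcf_monM0 => [|j e]; last by apply: h; exists j.
by rewrite /mon; case: eqP => // e; case: h; exists l.
Qed.

Lemma mon0 : mon (mzero n) = 1. Proof. by []. Qed.
Lemma fvarE j : fvar j = mon (munit j) :> A. Proof. by []. Qed.

Lemma fcf_CM c f m : (fC c * f) m = c * f m.
Proof.
rewrite (fcfM _ _ (leqnn _)) (@sum_mbox1 n _ _ _ (mzero n)).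
- rewrite (@sum_mbox1 n _ _ _ m) ?madd0 ?/fC ?eqxx ?mul1r //; first exact: mbox_deg.
  by move=> j ne; rewrite madd0 (negbTE ne) mul0r.
- by apply: mbox_deg; rewrite mdeg0.
by move=> j ne; rewrite big1 // => i _; rewrite /fC (negbTE ne) mul0r mulr0.
Qed.

Lemma fscaleE c f : fscale c f = fC c * f.
Proof. by apply: fpsP => m; rewrite fcf_CM. Qed.

Lemma fC_is_additive : additive fC.
Proof. by move=> a b; apply: fpsP => m; rewrite /fC fcfB; case: eqP; rewrite ?subr0. Qed.
Lemma fC_is_multiplicative : multiplicative fC.
Proof.
by split=> [a b|]; apply: fpsP => m; rewrite ?fcf_CM /fC ?fcf_1; case: eqP; rewrite ?mulr0.
Qed.
HB.instance Definition _ := GRing.isAdditive.Build C A fC fC_is_additive.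
HB.instance Definition _ := GRing.isMultiplicative.Build C A fC fC_is_multiplicative.

Lemma fCD a b : fC (a + b) = fC a + fC b. Proof. exact: rmorphD. Qed.
Lemma fCN a : fC (- a) = - fC a. Proof. exact: rmorphN. Qed.
Lemma fCM a b : fC (a * b) = fC a * fC b. Proof. exact: rmorphM. Qed.
Lemma fCX a e : fC (a ^+ e) = fC a ^+ e. Proof. exact: rmorphXn. Qed.
Lemma fC1 : fC 1 = 1. Proof. exact: rmorph1. Qed.
Lemma fCnat e : fC e%:R = e%:R. Proof. exact: rmorph_nat. Qed.

Lemma fcoef0D f g : fcoef0 (f + g) = fcoef0 f + fcoef0 g. Proof. by []. Qed.
Lemma fcoef0N f : fcoef0 (- f) = - fcoef0 f. Proof. by []. Qed.
Lemma fcoef0C c : fcoef0 (fC c) = c. Proof. by rewrite /fcoef0 /fC eqxx. Qed.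
Lemma fcoef01 : fcoef0 (1 : A) = 1. Proof. by rewrite /fcoef0 fcf_1 eqxx. Qed.
Lemma fcoef0M f g : fcoef0 (f * g) = fcoef0 f * fcoef0 g.
Proof.
rewrite /fcoef0 (fcfM _ _ (leqnn _)) (@sum_mbox1 n _ _ _ (mzero n)) ?mbox_deg ?mdeg0 //.
  rewrite (@sum_mbox1 n _ _ _ (mzero n)) ?mbox_deg ?mdeg0 // ?madd0 ?eqxx ?mul1r //.
  by move=> l ne; rewrite madd0 (negbTE ne) mul0r.
move=> k ne; rewrite big1 // => l _; case: eqP => [e|_]; last by rewrite mul0r.
case/eqP: ne; apply: mdeg_eq0; apply/eqP.
by have := congr1 (@mdeg n) e; rewrite mdegD mdeg0 => /eqP; rewrite addn_eq0 => /andP[].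
Qed.
Lemma fcoef0X f e : fcoef0 (f ^+ e) = fcoef0 f ^+ e.
Proof. by elim: e => [|e IH]; rewrite ?fcoef01 // !exprS fcoef0M IH. Qed.

Lemma zcD f g : zc f -> zc g -> zc (f + g).
Proof. by rewrite /zc fcoef0D => -> ->; rewrite addr0. Qed.
Lemma zcN f : zc f -> zc (- f).
Proof. by rewrite /zc fcoef0N => ->; rewrite oppr0. Qed.
Lemma zcMl f g : zc f -> zc (f * g).
Proof. by rewrite /zc fcoef0M => ->; rewrite mul0r. Qed.
Lemma zcMr f g : zc g -> zc (f * g).
Proof. by rewrite /zc fcoef0M => ->; rewrite mulr0. Qed.
Lemma zcX f e : zc f -> (0 < e)%N -> zc (f ^+ e).
Proof. by rewrite /zc fcoef0X => -> ; case: e => // e _; rewrite expr0n. Qed.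
Lemma zc0 : zc 0. Proof. by []. Qed.
Lemma zcvar j : zc (fvar j).
Proof.
rewrite /zc /fcoef0 /fvar; case: eqP => // e.
by have := congr1 (@mdeg n) e; rewrite mdeg0 mdeg_munit.
Qed.

Lemma fordD N f g : ford N f -> ford N g -> ford N (f + g).
Proof. by move=> hf hg m hm; rewrite fcfD hf ?hg ?addr0. Qed.
Lemma fordN N f : ford N f -> ford N (- f).
Proof. by move=> hf m hm; rewrite fcfN hf ?oppr0. Qed.
Lemma fordB N f g : ford N f -> ford N g -> ford N (f - g).
Proof. by move=> hf hg; apply: fordD => //; apply: fordN. Qed.
Lemma fordW N N' f : (N <= N')%N -> ford N' f -> ford N f.
Proof. by move=> le h m hm; apply: h; apply: leq_trans le. Qed.
Lemma fordM N N' f g : ford N f -> ford N' g -> ford (N + N') (f * g).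
Proof.
move=> hf hg m hm; apply: fcfM_eq0 => k l e.
have [h|h] := ltnP (mdeg k) N; first by left; apply: hf.
right; apply: hg; move: hm; rewrite -e mdegD; lia.
Qed.
Lemma ford_0 f : ford 0 f. Proof. by []. Qed.
Lemma fordMl N f g : ford N f -> ford N (f * g).
Proof. by move=> hf; have := fordM hf (@ford_0 g); rewrite addn0. Qed.
Lemma fordMr N f g : ford N g -> ford N (f * g).
Proof. by move=> hf; rewrite mulrC; apply: fordMl. Qed.
Lemma ford1 f : zc f -> ford 1 f.
Proof. by move=> h m; rewrite ltnS leqn0 => /eqP /mdeg_eq0 ->. Qed.
Lemma ford_zc N f : ford N.+1 f -> zc f.
Proof. by move=> h; apply: h; rewrite mdeg0. Qed.
Lemma fordX e f : zc f -> ford e (f ^+ e).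
Proof. by move=> h; elim: e => // e IH; rewrite exprS -add1n; apply: fordM => //; apply: ford1. Qed.
Lemma ford_eq0 f : (forall N, ford N f) -> f = 0.
Proof. by move=> h; apply: fpsP => m; apply: (h (mdeg m).+1). Qed.
Lemma ford_sum N I (r : seq I) (P : pred I) (F : I -> A) :
  (forall i, P i -> ford N (F i)) -> ford N (\sum_(i <- r | P i) F i).
Proof. by move=> h; elim/big_rec : _ => // i x Pi hx; apply: fordD => //; apply: h. Qed.

(** A series with nonzero constant term is not a zero divisor: compare lowest
    order terms. *)
Lemma fmul_unit_eq0 f g : fcoef0 f <> 0 -> f * g = 0 -> g = 0.
Proof.
move=> f0 e; apply: ford_eq0; elim=> // N IH.
have hN : ford N.+1 (fC (fcoef0 f) * g).
  have -> : fC (fcoef0 f) * g = - ((f - fC (fcoef0 f)) * g) by rewrite mulrBl e sub0r opprK.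
  apply: fordN; rewrite -add1n; apply: fordM => //; apply: ford1.
  by rewrite /zc fcoef0D fcoef0N fcoef0C subrr.
move=> m /hN; rewrite fcf_CM => /eqP; rewrite mulf_eq0 => /orP[/eqP //|/eqP //].
Qed.

Lemma ford_unit N f g : fcoef0 f <> 0 -> ford N (f * g) -> ford N g.
Proof.
move=> f0; elim: N => // N IH e.
have gN : ford N g by apply: IH; apply: fordW e.
have hN : ford N.+1 (fC (fcoef0 f) * g).
  have -> : fC (fcoef0 f) * g = f * g - ((f - fC (fcoef0 f)) * g) by rewrite mulrBl opprB addrC subrK.
  apply: fordB => //; rewrite -add1n; apply: fordM => //; apply: ford1.
  by rewrite /zc fcoef0D fcoef0N fcoef0C subrr.
move=> m /hN; rewrite fcf_CM => /eqP; rewrite mulf_eq0 => /orP[/eqP //|/eqP //].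
Qed.

(** In a summable family only the terms of degree at most [mdeg m + 1] contribute
    to the coefficient at [m]. One order is given away because derivatives of
    power series are such families too. *)
Definition fsum q (W : mindex q -> A) : A :=
  fun m => \sum_(k <- mbox q (mdeg m).+1) W k m.

Definition summable q (W : mindex q -> A) := forall k : mindex q, ford (mdeg k).-1 (W k).

Lemma fsumE q (W : mindex q -> A) N m : summable W -> (mdeg m < N)%N ->
  fsum W m = \sum_(k <- mbox q N) W k m.
Proof.
move=> hW hm; rewrite /fsum; symmetry; apply: sum_mbox_ext => // k hk.
by apply: hW; lia.
Qed.

Lemma fsumM q (W : mindex q -> A) x : summable W ->
  x * fsum W = fsum (fun k : mindex q => x * W k).
Proof.
move=> hW; apply: fpsP => m; rewrite (fcfM _ _ (leqnn _)) {2}/fsum.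
under [RHS]eq_bigr => k _ do rewrite (fcfM _ _ (leqnn _)).
rewrite [RHS]exchange_big; apply: eq_bigr => a _ /=.
rewrite [RHS]exchange_big; apply: eq_bigr => b _ /=.
case: eqP => [e|_]; last by rewrite mul0r big1 // => k _; rewrite mul0r.
rewrite mul1r (@fsumE _ _ (mdeg m).+1) //; last by rewrite ltnS -e mdegD leq_addl.
by rewrite mulr_sumr; apply: eq_bigr => k _; rewrite mul1r.
Qed.

Lemma fsumB q (W W' : mindex q -> A) : fsum W - fsum W' = fsum (fun k : mindex q => W k - W' k).
Proof. by apply: fpsP => m; rewrite fcfB /fsum -sumrB; apply: eq_bigr. Qed.

Lemma eq_fsum q (W W' : mindex q -> A) : (forall k : mindex q, W k = W' k) -> fsum W = fsum W'.
Proof. by move=> h; congr fsum; apply: funext. Qed.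

End Coef.

(** * Substitution and conjugation *)
Section Subst.
Variables (R : realType).
Local Notation C := R[i].

Definition gmon q n (g : q.-tuple (fps R n)) (k : mindex q) : fps R n :=
  \prod_(i < q) tnth g i ^+ tnth k i.

(** Substitution is only meaningful for series without constant term. *)
Definition zct q n (g : q.-tuple (fps R n)) := forall i, zc (tnth g i).

Lemma gmonD q n (g : q.-tuple (fps R n)) k l : gmon g (madd k l) = gmon g k * gmon g l.
Proof. by rewrite /gmon -big_split; apply: eq_bigr => i _; rewrite tnth_madd exprD. Qed.

Lemma gmon0 q n (g : q.-tuple (fps R n)) : gmon g (mzero q) = 1.
Proof. by rewrite /gmon big1 // => i _; rewrite tnth_mzero expr0. Qed.

Lemma gmon_unit q n (g : q.-tuple (fps R n)) j : gmon g (munit j) = tnth g j.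
Proof.
rewrite /gmon (bigD1 j) //= tnth_munit eqxx expr1 big1 ?mulr1 // => i /negbTE h.
by rewrite tnth_munit h expr0.
Qed.

Lemma gmon_ord q n (g : q.-tuple (fps R n)) k : zct g -> ford (mdeg k) (gmon g k).
Proof.
move=> hg; rewrite /gmon /mdeg.
elim/big_rec2 : _ => [|i x y _ IH]; first by [].
by rewrite addnC mulrC; apply: fordM => //; apply: fordX; apply: hg.
Qed.

Lemma fexpE n (f : fps R n) e : fexp f e = f ^+ e.
Proof. by elim: e => // e IH; rewrite exprS -IH. Qed.

(** Multi-indices with entries at most the degree suffice by definition of the
    substitution; larger boxes give the same value when the arguments have no
    constant term. *)
Lemma fsubstE0 q n (f : fps R q) (g : q.-tuple (fps R n)) m :
  fsubst f g m = \sum_(k <- mbox q (mdeg m)) f k * gmon g k m.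
Proof.
rewrite -(sum_mbox _ (fun k => f k * gmon g k m)); apply: eq_bigr => k _.
congr (_ * _); rewrite /gmon.
rewrite (eq_bigr (fun i => tnth g i ^+ tnth k i)) => [|i _]; last exact: fexpE.
congr ((_ : fps R n) m); apply: eq_bigr => i _; by rewrite tnth_mktuple.
Qed.

Lemma fsubst_fsum q n (f : fps R q) (g : q.-tuple (fps R n)) : zct g ->
  summable (fun k => fC (f k) * gmon g k) /\
  fsubst f g = fsum (fun k => fC (f k) * gmon g k).
Proof.
move=> hg; have hs : summable (fun k => fC (f k) * gmon g k).
  by move=> k; apply: fordMr; apply: fordW (gmon_ord hg); rewrite leq_pred.
split=> //; apply: fpsP => m; rewrite fsubstE0 /fsum.
under [RHS]eq_bigr => k _ do rewrite fcf_CM.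
symmetry; apply: sum_mbox_ext => // k hk; by rewrite (gmon_ord hg hk) mulr0.
Qed.

Lemma fsubstE q n (f : fps R q) (g : q.-tuple (fps R n)) N m : zct g -> (mdeg m <= N)%N ->
  fsubst f g m = \sum_(k <- mbox q N) f k * gmon g k m.
Proof.
move=> hg hm; rewrite fsubstE0; symmetry; apply: sum_mbox_ext => // k hk.
by rewrite (gmon_ord hg hk) mulr0.
Qed.

Lemma fsubstD q n (f f' : fps R q) (g : q.-tuple (fps R n)) :
  fsubst (f + f') g = fsubst f g + fsubst f' g.
Proof.
apply: fpsP => m; rewrite fcfD !fsubstE0 -big_split; apply: eq_bigr => k _.
by rewrite fcfD mulrDl.
Qed.

Lemma fsubstN q n (f : fps R q) (g : q.-tuple (fps R n)) : fsubst (- f) g = - fsubst f g.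
Proof.
apply: fpsP => m; rewrite fcfN !fsubstE0 -sumrN; apply: eq_bigr => k _.
by rewrite fcfN mulNr.
Qed.

Lemma fsubstB q n (f f' : fps R q) (g : q.-tuple (fps R n)) :
  fsubst (f - f') g = fsubst f g - fsubst f' g.
Proof. by rewrite fsubstD fsubstN. Qed.

Lemma fsubst_mon q n k (g : q.-tuple (fps R n)) : zct g -> fsubst (mon R k) g = gmon g k.
Proof.
move=> hg; apply: fpsP => m; have [h|h] := leqP (mdeg k) (mdeg m).
  rewrite (fsubstE _ hg (leqnn _)) (@sum_mbox1 _ _ _ _ k) ?mbox_deg //.
    by rewrite /mon eqxx mul1r.
  by move=> l ne; rewrite /mon (negbTE ne) mul0r.
rewrite (gmon_ord hg h) (fsubstE _ hg (leqnn _)) big1 // => l _.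
rewrite /mon; case: eqP => [->|_]; last by rewrite mul0r.
by rewrite (gmon_ord hg h) mulr0.
Qed.

Lemma fsubst_var q n j (g : q.-tuple (fps R n)) : zct g -> fsubst (fvar j) g = tnth g j.
Proof. by move=> hg; rewrite fvarE fsubst_mon // gmon_unit. Qed.

Lemma fsubstM q n (f f' : fps R q) (g : q.-tuple (fps R n)) : zct g ->
  fsubst (f * f') g = fsubst f g * fsubst f' g.
Proof.
move=> hg; apply: fpsP => m; set N := mdeg m.
rewrite (fsubstE _ hg (leqnn N)) (fcfM _ _ (leqnn N)).
transitivity (\sum_(a <- mbox q N) \sum_(b <- mbox q N) f a * f' b * gmon g (madd a b) m).
  transitivity (\sum_(k <- mbox q N) \sum_(a <- mbox q N) \sum_(b <- mbox q N)
     (if madd a b == k then f a * f' b * gmon g (madd a b) m else 0)).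
    apply: eq_bigr => k _; have [h|h] := leqP (mdeg k) N.
      rewrite (fcfM _ _ h) mulr_suml; apply: eq_bigr => a _.
      rewrite mulr_suml; apply: eq_bigr => b _.
      by case: eqP => [->|_]; rewrite ?mul1r ?mul0r.
    rewrite (gmon_ord hg h) mulr0 big1 // => a _; rewrite big1 // => b _.
    by case: eqP => // e; rewrite e (gmon_ord hg h) mulr0.
  rewrite exchange_big; apply: eq_bigr => a _ /=.
  rewrite exchange_big; apply: eq_bigr => b _ /=.
  have [h|h] := leqP (mdeg (madd a b)) N.
    rewrite (@sum_mbox1 _ _ _ _ (madd a b)) ?eqxx ?mbox_deg // => l.
    by rewrite eq_sym => /negbTE ->.
  rewrite (gmon_ord hg h) mulr0 big1 // => l _; by case: eqP.
transitivity (\sum_(a <- mbox q N) \sum_(b <- mbox q N) \sum_(k <- mbox n N) \sum_(l <- mbox n N)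
   (madd k l == m)%:R * (f a * gmon g a k * (f' b * gmon g b l))).
  apply: eq_bigr => a _; apply: eq_bigr => b _.
  rewrite gmonD (fcfM _ _ (leqnn N)) mulr_sumr; apply: eq_bigr => k _.
  rewrite mulr_sumr; apply: eq_bigr => l _; ring.
transitivity (\sum_(k <- mbox n N) \sum_(l <- mbox n N) \sum_(a <- mbox q N) \sum_(b <- mbox q N)
   (madd k l == m)%:R * (f a * gmon g a k * (f' b * gmon g b l))).
  under eq_bigr => a _ do rewrite exchange_big.
  rewrite exchange_big; apply: eq_bigr => k _ /=.
  under eq_bigr => a _ do rewrite exchange_big.
  by rewrite exchange_big.
apply: eq_bigr => k _; apply: eq_bigr => l _.
case: (madd k l =P m) => [e|_]; last first.
  by rewrite mul0r big1 // => a _; rewrite big1 // => b _; rewrite mul0r.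
have hk : (mdeg k <= N)%N by rewrite /N -e mdegD leq_addr.
have hl : (mdeg l <= N)%N by rewrite /N -e mdegD leq_addl.
rewrite mul1r (fsubstE f hg hk) (fsubstE f' hg hl) mulr_suml; apply: eq_bigr => a _.
by rewrite mulr_sumr; apply: eq_bigr => b _; rewrite mul1r.
Qed.

Lemma fsubstC q n c (g : q.-tuple (fps R n)) : zct g -> fsubst (fC c : fps R q) g = fC c.
Proof.
move=> hg; apply: fpsP => m; rewrite (fsubstE _ hg (leqnn _)).
rewrite (@sum_mbox1 _ _ _ _ (mzero q)) ?mbox_deg ?mdeg0 //.
  by rewrite gmon0 /fC fcf_1 eqxx; case: eqP; rewrite ?mulr1 ?mulr0.
by move=> l /negbTE ne; rewrite /fC ne mul0r.
Qed.

Lemma fsubst1 q n (g : q.-tuple (fps R n)) : zct g -> fsubst 1 g = 1.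
Proof. by move=> hg; rewrite -(rmorph1 (@fC R q)) fsubstC // rmorph1. Qed.

Lemma fsubst0 q n (g : q.-tuple (fps R n)) : fsubst 0 g = 0.
Proof. by apply: fpsP => m; rewrite fsubstE0 big1 // => k _; rewrite mul0r. Qed.

Lemma fsubstX q n (f : fps R q) e (g : q.-tuple (fps R n)) : zct g ->
  fsubst (f ^+ e) g = fsubst f g ^+ e.
Proof. by move=> hg; elim: e => [|e IH]; rewrite ?fsubst1 // !exprS fsubstM // IH. Qed.

Lemma fsubst_prod q n I (r : seq I) (F : I -> fps R q) (g : q.-tuple (fps R n)) : zct g ->
  fsubst (\prod_(i <- r) F i) g = \prod_(i <- r) fsubst (F i) g.
Proof.
by move=> hg; elim: r => [|i r IH]; rewrite ?big_nil ?fsubst1 // !big_cons fsubstM // IH.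
Qed.

Lemma fcoef0_subst q n (f : fps R q) (g : q.-tuple (fps R n)) : zct g ->
  fcoef0 (fsubst f g) = fcoef0 f.
Proof.
move=> hg; rewrite /fcoef0 (fsubstE _ hg (leqnn _)).
rewrite (@sum_mbox1 _ _ _ _ (mzero q)) ?mbox_deg ?mdeg0 //.
  by rewrite gmon0 fcf_1 eqxx mulr1.
move=> l ne; rewrite (gmon_ord hg) ?mulr0 // mdeg0 lt0n.
by apply: contraNneq ne => /mdeg_eq0 ->.
Qed.

Lemma zc_subst q n (f : fps R q) (g : q.-tuple (fps R n)) : zct g -> zc f -> zc (fsubst f g).
Proof. by move=> hg; rewrite /zc fcoef0_subst. Qed.

Lemma ford_subst q n N (f : fps R q) (g : q.-tuple (fps R n)) : zct g -> ford N f ->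
  ford N (fsubst f g).
Proof.
move=> hg hf m hm; rewrite (fsubstE _ hg (leqnn _)) big1 // => k _.
have [h|h] := ltnP (mdeg k) N; first by rewrite hf ?mul0r.
by rewrite (gmon_ord hg) ?mulr0 //; apply: leq_trans h.
Qed.

Definition tcomp q r n (g : q.-tuple (fps R r)) (h : r.-tuple (fps R n)) : q.-tuple (fps R n) :=
  [tuple fsubst (tnth g i) h | i < q].

Lemma zct_tcomp q r n (g : q.-tuple (fps R r)) (h : r.-tuple (fps R n)) :
  zct g -> zct h -> zct (tcomp g h).
Proof. by move=> hg hh i; rewrite tnth_mktuple; apply: zc_subst. Qed.

Lemma gmon_subst q r n (g : q.-tuple (fps R r)) (h : r.-tuple (fps R n)) k : zct h ->
  fsubst (gmon g k) h = gmon (tcomp g h) k.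
Proof.
move=> hh; rewrite /gmon fsubst_prod //; apply: eq_bigr => i _.
by rewrite fsubstX // tnth_mktuple.
Qed.

Lemma fsubstA q r n (f : fps R q) (g : q.-tuple (fps R r)) (h : r.-tuple (fps R n)) :
  zct g -> zct h -> fsubst (fsubst f g) h = fsubst f (tcomp g h).
Proof.
move=> hg hh; apply: fpsP => m; set N := mdeg m.
have hgh := zct_tcomp hg hh.
rewrite (fsubstE _ hh (leqnn N)) (fsubstE _ hgh (leqnn N)).
transitivity (\sum_(j <- mbox r N) \sum_(k <- mbox q N) f k * (gmon g k j * gmon h j m)).
  apply: eq_bigr => j _; have [le|lt] := leqP (mdeg j) N.
    by rewrite (fsubstE _ hg le) mulr_suml; apply: eq_bigr => k _; rewrite mulrA.
  by rewrite (gmon_ord hh lt) mulr0 big1 // => k _; rewrite !mulr0.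
rewrite exchange_big; apply: eq_bigr => k _ /=.
by rewrite -mulr_sumr -gmon_subst // (fsubstE _ hh (leqnn N)).
Qed.

(** Induction on the degree, splitting off one variable. *)
Lemma gmon_vars n k : gmon [tuple fvar i | i < n] k = mon R k.
Proof.
have [N] := ubnP (mdeg k); elim: N k => // N IH k hk.
have [/eqP/mdeg_eq0 ->|] := boolP (mdeg k == 0%N); first by rewrite gmon0 mon0.
rewrite -lt0n => h.
have [j hj] : exists j, (0 < tnth k j)%N.
  apply: contrapT => hn; suff e : mdeg k = 0%N by rewrite e in h.
  rewrite /mdeg big1 // => j _; apply/eqP; rewrite -leqn0 leqNgt.
  by apply/negP => hj; apply: hn; exists j.
pose l : mindex n := [tuple (tnth k i - (i == j))%N | i < n].
have e : k = madd (munit j) l.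
  apply: mindexP => i; rewrite tnth_madd tnth_munit tnth_mktuple.
  by case: (i =P j) => [->|_] /=; rewrite ?subnKC // add0n subn0.
rewrite e gmonD monD gmon_unit tnth_mktuple fvarE IH //.
by have := mdegD (munit j) l; rewrite -e mdeg_munit; lia.
Qed.

Lemma zct_vars n : zct [tuple fvar i | i < n].
Proof. by move=> i; rewrite tnth_mktuple; apply: zcvar. Qed.

Lemma fsubst_id n (f : fps R n) : fsubst f [tuple fvar i | i < n] = f.
Proof.
apply: fpsP => m; rewrite (fsubstE _ (@zct_vars n) (leqnn _)).
rewrite (@sum_mbox1 _ _ _ _ m) ?mbox_deg //; first by rewrite gmon_vars /mon eqxx mulr1.
by move=> l; rewrite gmon_vars /mon eq_sym => /negbTE ->; rewrite mulr0.
Qed.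

(** Telescoping the product reduces to changing a single factor. *)
Lemma gmon_cong q n N (g g' : q.-tuple (fps R n)) k :
  (forall i, ford N (tnth g i - tnth g' i)) -> ford N (gmon g k - gmon g' k).
Proof.
move=> h; rewrite /gmon; elim/big_rec2 : _ => [|i x y _ IH]; first by rewrite subrr.
set a := tnth g i; set b := tnth g' i.
rewrite (_ : _ - _ = (a ^+ tnth k i - b ^+ tnth k i) * y + b ^+ tnth k i * (y - x)); last by ring.
apply: fordD; last exact: fordMr.
by apply: fordMl; rewrite subrXX; apply: fordMl; apply: h.
Qed.

Lemma fsubst_cong q n N (f : fps R q) (g g' : q.-tuple (fps R n)) :
  (forall i, ford N (tnth g i - tnth g' i)) -> ford N (fsubst f g - fsubst f g').
Proof.
move=> h m hm; rewrite fcfB !fsubstE0 -sumrB big1 // => k _.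
by rewrite -mulrBr -fcfB (gmon_cong k h) ?mulr0.
Qed.

(** Changing one argument from [u] to [v] changes the value by a multiple of
    [u - v], with cofactor the partial derivative at lowest order. *)
Lemma fsubst_mean q n (f : fps R q) (g g' : q.-tuple (fps R n)) j :
  zct g -> zct g' -> (forall i, i != j -> tnth g i = tnth g' i) ->
  exists2 V, fsubst f g - fsubst f g' = (tnth g j - tnth g' j) * V &
    fcoef0 V = f (munit j).
Proof.
move=> hg hg' hj.
pose P (k : mindex q) := \prod_(i < q | i != j) tnth g i ^+ tnth k i.
pose T (k : mindex q) := \sum_(i < tnth k j) tnth g j ^+ (tnth k j - i.+1) * tnth g' j ^+ i.
pose W (k : mindex q) := fC (f k) * (P k * T k).
have Tord k : ford (tnth k j).-1 (T k).
  apply: ford_sum => i _; have -> : ((tnth k j).-1 = (tnth k j - i.+1) + i)%N.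
    by case: i => i /=; lia.
  by apply: fordM; apply: fordX.
have Pord k : ford (\sum_(i < q | i != j) tnth k i) (P k).
  rewrite /P; elim/big_rec2 : _ => [|i x y _ IH]; first by [].
  by rewrite addnC mulrC; apply: fordM => //; apply: fordX; apply: hg.
have hW : summable W.
  move=> k; apply: fordMr; have := fordM (Pord k) (Tord k); apply: fordW.
  have -> : mdeg k = (tnth k j + \sum_(i < q | i != j) tnth k i)%N by rewrite /mdeg (bigD1 j).
  by move: (\sum_(i < q | _) _)%N (tnth k j) => a b; lia.
exists (fsum W).
  have [_ ->] := fsubst_fsum f hg; have [_ ->] := fsubst_fsum f hg'.
  rewrite fsumB fsumM //; apply: eq_fsum => k; rewrite -mulrBr /W mulrCA; congr (_ * _).
  rewrite /gmon (bigD1 j) //= [X in _ - X](bigD1 j) //= -/(P k).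
  rewrite (_ : \prod_(i < q | i != j) tnth g' i ^+ tnth k i = P k); last first.
    by apply: eq_bigr => i ne; rewrite hj.
  rewrite -mulrBl subrXX /T -mulrA; congr (_ * _); rewrite mulrC; congr (_ * _).
  by apply: eq_bigr => i _; rewrite subnS -subn1 subnAC subn1.
rewrite /fcoef0 (@fsumE _ _ _ _ 2) ?mdeg0 // (@sum_mbox1 _ _ _ _ (munit j)); last first.
- move=> l ne; have [h|h] := ltnP (mdeg l).-1 1; last by apply: hW; rewrite mdeg0.
  have [e|/eqP h0] := eqVneq (tnth l j) 0%N.
    by rewrite /W /T e big_ord0 !mulr0.
  case/eqP: ne; apply: mindexP => i; rewrite tnth_munit.
  have := leq_mdeg l i; have : (mdeg l <= 1)%N by lia.
  case: eqP => [->|/eqP ne]; first by have := leq_mdeg l j; lia.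
  by rewrite /mdeg (bigD1 j) //= (bigD1 i) //=; lia.
- by apply: mbox_deg; rewrite mdeg_munit.
rewrite /W fcf_CM /T tnth_munit eqxx big_ord1 !expr0 mulr1 mulr1.
rewrite /P big1 ?fcf_1 ?eqxx ?mulr1 // => i /negbTE ne.
by rewrite tnth_munit ne expr0.
Qed.

Definition tconj q n (g : q.-tuple (fps R n)) : q.-tuple (fps R n) :=
  [tuple fconj (tnth g i) | i < q].

Lemma fconjK n (f : fps R n) : fconj (fconj f) = f.
Proof. by apply: fpsP => m; rewrite /fconj conjcK. Qed.

Lemma fconj_is_additive n : additive (@fconj R n).
Proof. by move=> a b; apply: fpsP => m; rewrite /fconj fcfB rmorphB. Qed.
Lemma fconj_is_multiplicative n : multiplicative (@fconj R n).
Proof.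
split=> [a b|]; apply: fpsP => m; last by rewrite /fconj fcf_1 rmorph_nat.
rewrite /fconj !(fcfM _ _ (leqnn _)) rmorph_sum; apply: eq_bigr => k _.
rewrite rmorph_sum; apply: eq_bigr => l _; by rewrite !rmorphM rmorph_nat.
Qed.
HB.instance Definition _ n := GRing.isAdditive.Build (fps R n) (fps R n) (@fconj R n) (@fconj_is_additive n).
HB.instance Definition _ n := GRing.isMultiplicative.Build (fps R n) (fps R n) (@fconj R n) (@fconj_is_multiplicative n).

Lemma fconjC n c : fconj (fC c : fps R n) = fC (c^*)%C.
Proof. by apply: fpsP => m; rewrite /fconj /fC; case: eqP => // _; rewrite conjc0. Qed.

Lemma fconj_var n j : fconj (fvar j) = fvar j :> fps R n.
Proof. by apply: fpsP => m; rewrite /fconj /fvar rmorph_nat. Qed.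

Lemma fconj_subst q n (f : fps R q) (g : q.-tuple (fps R n)) :
  fconj (fsubst f g) = fsubst (fconj f) (tconj g).
Proof.
apply: fpsP => m; rewrite /fconj !fsubstE0 rmorph_sum; apply: eq_bigr => k _.
rewrite rmorphM; congr (_ * _); rewrite -[LHS]/(fconj (gmon g k) m).
by rewrite /gmon rmorph_prod; congr ((_ : fps R n) m); apply: eq_bigr => i _;
  rewrite rmorphXn tnth_mktuple.
Qed.

Lemma fconjD n (f g : fps R n) : fconj (f + g) = fconj f + fconj g.
Proof. exact: rmorphD. Qed.
Lemma fconjN n (f : fps R n) : fconj (- f) = - fconj f.
Proof. exact: rmorphN. Qed.
Lemma fconjM n (f g : fps R n) : fconj (f * g) = fconj f * fconj g.
Proof. exact: rmorphM. Qed.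
Lemma fconjX n (f : fps R n) e : fconj (f ^+ e) = fconj f ^+ e.
Proof. exact: rmorphXn. Qed.
Lemma fconj0 n : fconj (0 : fps R n) = 0.
Proof. exact: rmorph0. Qed.

Lemma fcoef0_conj n (f : fps R n) : fcoef0 (fconj f) = ((fcoef0 f)^*)%C.
Proof. by []. Qed.

Lemma zc_conj n (f : fps R n) : zc f -> zc (fconj f).
Proof. by rewrite /zc fcoef0_conj => ->; rewrite conjc0. Qed.

Lemma ford_conj n N (f : fps R n) : ford N f -> ford N (fconj f).
Proof. by move=> h m hm; rewrite /fconj h // conjc0. Qed.

End Subst.

(** * Series in at most four variables *)
Section Small.
Variables (R : realType).
Local Notation C := R[i].

Lemma tuple2P T (m : 2.-tuple T) : exists a b, m = [tuple a; b].
Proof. by case: m => -[|a [|b []]] //= p; exists a, b; apply: val_inj. Qed.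
Lemma tuple3P T (m : 3.-tuple T) : exists a b c, m = [tuple a; b; c].
Proof. by case: m => -[|a [|b [|c []]]] //= p; exists a, b, c; apply: val_inj. Qed.
Lemma tuple1P T (m : 1.-tuple T) : exists a, m = [tuple a].
Proof. by case: m => -[|a []] //= p; exists a; apply: val_inj. Qed.

Lemma tnth1 T (a : T) : tnth [tuple a] (inord 0) = a.
Proof. by rewrite (tnth_nth a) inordK. Qed.
Lemma tnth2_0 T (a b : T) : tnth [tuple a; b] (inord 0) = a.
Proof. by rewrite (tnth_nth a) inordK. Qed.
Lemma tnth2_1 T (a b : T) : tnth [tuple a; b] (inord 1) = b.
Proof. by rewrite (tnth_nth a) inordK. Qed.
Lemma tnth3_0 T (a b c : T) : tnth [tuple a; b; c] (inord 0) = a.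
Proof. by rewrite (tnth_nth a) inordK. Qed.
Lemma tnth3_1 T (a b c : T) : tnth [tuple a; b; c] (inord 1) = b.
Proof. by rewrite (tnth_nth a) inordK. Qed.
Lemma tnth3_2 T (a b c : T) : tnth [tuple a; b; c] (inord 2) = c.
Proof. by rewrite (tnth_nth a) inordK. Qed.
Lemma tnth4_0 T (a b c d : T) : tnth [tuple a; b; c; d] (inord 0) = a.
Proof. by rewrite (tnth_nth a) inordK. Qed.
Lemma tnth4_1 T (a b c d : T) : tnth [tuple a; b; c; d] (inord 1) = b.
Proof. by rewrite (tnth_nth a) inordK. Qed.
Lemma tnth4_2 T (a b c d : T) : tnth [tuple a; b; c; d] (inord 2) = c.
Proof. by rewrite (tnth_nth a) inordK. Qed.
Lemma tnth4_3 T (a b c d : T) : tnth [tuple a; b; c; d] (inord 3) = d.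
Proof. by rewrite (tnth_nth a) inordK. Qed.

Lemma forall_ord1 (P : 'I_1 -> Prop) : P (inord 0) -> forall i, P i.
Proof. by move=> h0 -[[|//] p]; [move: h0; congr P; apply: val_inj; rewrite /= inordK]. Qed.
Lemma forall_ord2 (P : 'I_2 -> Prop) : P (inord 0) -> P (inord 1) -> forall i, P i.
Proof.
by move=> h0 h1 -[[|[|//]] p]; [move: h0|move: h1]; congr P; apply: val_inj; rewrite /= inordK.
Qed.
Lemma forall_ord3 (P : 'I_3 -> Prop) : P (inord 0) -> P (inord 1) -> P (inord 2) -> forall i, P i.
Proof.
by move=> h0 h1 h2 -[[|[|[|//]]] p]; [move: h0|move: h1|move: h2]; congr P; apply: val_inj;
  rewrite /= inordK.
Qed.
Lemma forall_ord4 (P : 'I_4 -> Prop) : P (inord 0) -> P (inord 1) -> P (inord 2) -> P (inord 3) ->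
  forall i, P i.
Proof.
by move=> h0 h1 h2 h3 -[[|[|[|[|//]]]] p]; [move: h0|move: h1|move: h2|move: h3]; congr P;
  apply: val_inj; rewrite /= inordK.
Qed.

Definition tnthE := (tnth1, (tnth2_0, tnth2_1), (tnth3_0, tnth3_1, tnth3_2),
  (tnth4_0, tnth4_1, tnth4_2, tnth4_3)).

Lemma zct1 n (a : fps R n) : zc a -> zct [tuple a].
Proof. by move=> ha; apply: forall_ord1; rewrite tnthE. Qed.
Lemma zct2 n (a b : fps R n) : zc a -> zc b -> zct [tuple a; b].
Proof. by move=> ha hb; apply: forall_ord2; rewrite tnthE. Qed.
Lemma zct3 n (a b c : fps R n) : zc a -> zc b -> zc c -> zct [tuple a; b; c].
Proof. by move=> ha hb hc; apply: forall_ord3; rewrite tnthE. Qed.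
Lemma zct4 n (a b c d : fps R n) : zc a -> zc b -> zc c -> zc d -> zct [tuple a; b; c; d].
Proof. by move=> ha hb hc hd; apply: forall_ord4; rewrite tnthE. Qed.

Section TComp.
Variables (r n : nat) (h : r.-tuple (fps R n)).
Lemma tcomp1 a : tcomp [tuple a] h = [tuple fsubst a h].
Proof. by apply: eq_from_tnth; apply: forall_ord1; rewrite tnth_mktuple !tnthE. Qed.
Lemma tcomp2 a b : tcomp [tuple a; b] h = [tuple fsubst a h; fsubst b h].
Proof. by apply: eq_from_tnth; apply: forall_ord2; rewrite tnth_mktuple !tnthE. Qed.
Lemma tcomp3 a b c : tcomp [tuple a; b; c] h = [tuple fsubst a h; fsubst b h; fsubst c h].
Proof. by apply: eq_from_tnth; apply: forall_ord3; rewrite tnth_mktuple !tnthE. Qed.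
Lemma tcomp4 a b c d : tcomp [tuple a; b; c; d] h =
  [tuple fsubst a h; fsubst b h; fsubst c h; fsubst d h].
Proof. by apply: eq_from_tnth; apply: forall_ord4; rewrite tnth_mktuple !tnthE. Qed.
End TComp.
Definition tcompE := (tcomp1, tcomp2, tcomp3, tcomp4).

Section TConj.
Variables (n : nat).
Implicit Types a b c d : fps R n.
Lemma tconj1 a : tconj [tuple a] = [tuple fconj a].
Proof. by apply: eq_from_tnth; apply: forall_ord1; rewrite tnth_mktuple !tnthE. Qed.
Lemma tconj2 a b : tconj [tuple a; b] = [tuple fconj a; fconj b].
Proof. by apply: eq_from_tnth; apply: forall_ord2; rewrite tnth_mktuple !tnthE. Qed.
Lemma tconj3 a b c : tconj [tuple a; b; c] = [tuple fconj a; fconj b; fconj c].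
Proof. by apply: eq_from_tnth; apply: forall_ord3; rewrite tnth_mktuple !tnthE. Qed.
Lemma tconj4 a b c d : tconj [tuple a; b; c; d] = [tuple fconj a; fconj b; fconj c; fconj d].
Proof. by apply: eq_from_tnth; apply: forall_ord4; rewrite tnth_mktuple !tnthE. Qed.
End TConj.
Definition tconjE := (tconj1, tconj2, tconj3, tconj4).

Lemma vars1 : [tuple fvar i | i < 1] = [tuple 'x_0] :> 1.-tuple (fps R 1).
Proof. by apply: eq_from_tnth; apply: forall_ord1; rewrite tnth_mktuple !tnthE. Qed.
Lemma vars2 : [tuple fvar i | i < 2] = [tuple 'x_0; 'x_1] :> 2.-tuple (fps R 2).
Proof. by apply: eq_from_tnth; apply: forall_ord2; rewrite tnth_mktuple !tnthE. Qed.
Lemma vars3 : [tuple fvar i | i < 3] = [tuple 'x_0; 'x_1; 'x_2] :> 3.-tuple (fps R 3).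
Proof. by apply: eq_from_tnth; apply: forall_ord3; rewrite tnth_mktuple !tnthE. Qed.
Lemma vars4 : [tuple fvar i | i < 4] = [tuple 'x_0; 'x_1; 'x_2; 'x_3] :> 4.-tuple (fps R 4).
Proof. by apply: eq_from_tnth; apply: forall_ord4; rewrite tnth_mktuple !tnthE. Qed.

Lemma fsubst_id1 (f : fps R 1) : fsubst f [tuple 'x_0] = f.
Proof. by rewrite -vars1 fsubst_id. Qed.
Lemma fsubst_id2 (f : fps R 2) : fsubst f [tuple 'x_0; 'x_1] = f.
Proof. by rewrite -vars2 fsubst_id. Qed.
Lemma fsubst_id3 (f : fps R 3) : fsubst f [tuple 'x_0; 'x_1; 'x_2] = f.
Proof. by rewrite -vars3 fsubst_id. Qed.
Lemma fsubst_id4 (f : fps R 4) : fsubst f [tuple 'x_0; 'x_1; 'x_2; 'x_3] = f.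
Proof. by rewrite -vars4 fsubst_id. Qed.

(** Terms of order two of [f] do not contribute to linear coefficients. *)
Lemma coef_munit_subst q n (f : fps R q) (g : q.-tuple (fps R n)) j : zct g ->
  fsubst f g (munit j) = \sum_i f (munit i) * tnth g i (munit j).
Proof.
move=> hg.
pose L : fps R q := fC (fcoef0 f) + \sum_i fC (f (munit i)) * fvar i.
have coefL i : L (munit i) = f (munit i).
  rewrite /L fcfD /fC (_ : (munit i == mzero q) = false) ?add0r; last first.
    by apply/eqP => /(congr1 (@mdeg q)); rewrite mdeg0 mdeg_munit.
  rewrite fcf_sum (bigD1 i) //= fcf_CM big1 ?addr0.
    by rewrite /fvar eqxx mulr1.
  move=> l ne; rewrite fcf_CM /fvar; case: eqP => [e|_]; last by rewrite mulr0.
  case/eqP: ne; apply/eqP; have := congr1 (fun t => tnth t i) e; rewrite !tnth_munit eqxx.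
  by rewrite eq_sym; case: eqP.
have hL : ford 2 (f - L).
  move=> m; rewrite fcfB ltnS leq_eqVlt ltnS leqn0 => /orP[/eqP h|/eqP/mdeg_eq0 ->]; last first.
    rewrite /L fcfD {1}/fC eqxx fcf_sum big1 ?addr0 ?subrr // => l _.
    rewrite fcf_CM /fvar; case: eqP => [/(congr1 (@mdeg q))|_]; last by rewrite mulr0.
    by rewrite mdeg0 mdeg_munit.
  suff [i ->] : exists i, m = munit i by rewrite coefL subrr.
  have [i hi] : exists i, (0 < tnth m i)%N.
    apply: contrapT => hn; suff e : mdeg m = 0%N by rewrite e in h.
    rewrite /mdeg big1 // => i _; apply/eqP; rewrite -leqn0 leqNgt.
    by apply/negP => hi; apply: hn; exists i.
  exists i; apply: mindexP => l; rewrite tnth_munit.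
  case: eqP => [->|/eqP ne]; first by have := leq_mdeg m i; lia.
  by move: h; rewrite /mdeg (bigD1 i) //= (bigD1 l) //=; lia.
have h2 := ford_subst hg hL.
have -> : fsubst f g (munit j) = fsubst L g (munit j).
  apply/eqP; rewrite -subr_eq0 -fcfB -fsubstB h2 // mdeg_munit //.
rewrite /L fsubstD fcfD fsubstC // {1}/fC (_ : (munit j == mzero n) = false); last first.
  by apply/eqP => /(congr1 (@mdeg n)); rewrite mdeg0 mdeg_munit.
rewrite add0r; have -> : fsubst (\sum_i fC (f (munit i)) * fvar i) g =
    \sum_i fC (f (munit i)) * tnth g i.
  elim/big_rec2 : _ => [|i x y _ <-]; first by rewrite fsubst0.
  by rewrite fsubstD fsubstM // fsubstC // fsubst_var.
by rewrite fcf_sum; apply: eq_bigr => i _; rewrite fcf_CM.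
Qed.

Lemma fderiv0 n (f : fps R n) j : fcoef0 (fderiv j f) = f (munit j).
Proof. by rewrite /fcoef0 /fderiv tnth_mzero mulr1n madd0. Qed.

End Small.

(** Proves that a series has no constant term, following its construction. *)
Ltac zc_tac := lazymatch goal with
  | |- zct _ => first [assumption | apply: zct3; zc_tac | apply: zct2; zc_tac
      | apply: zct4; zc_tac | apply: zct1; zc_tac]
  | |- zc _ => first
    [ assumption | exact: zc0 | exact: zcvar
    | apply: zcD; zc_tac | apply: zcN; zc_tac | apply: zc_conj; zc_tac
    | apply: zc_subst; zc_tac
    | apply: zcX; [zc_tac | solve [done | lia]]
    | solve [apply: zcMl; zc_tac] | solve [apply: zcMr; zc_tac] ]
  | |- _ => assumption
  end.

(** * Implicit functions *)
Section Contraction.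

(** Maps that gain one order of agreement have a fixed point: iterate, and
    read the value at [x] off the [d x]-th iterate. *)
Lemma contraction_fixpoint (D V : Type) (d : D -> nat) (Phi : (D -> V) -> D -> V) (y0 : D -> V)
    (agree := fun N (u v : D -> V) => forall x, (d x < N)%N -> u x = v x) :
  (forall u, agree 1 u y0 -> agree 1 (Phi u) y0) ->
  (forall N u v, (0 < N)%N -> agree 1 u y0 -> agree 1 v y0 -> agree N u v ->
     agree N.+1 (Phi u) (Phi v)) ->
  exists y, agree 1 y y0 /\ forall x, Phi y x = y x.
Proof.
move=> h0 hc; pose it j := iter j Phi y0.
have it0 j : agree 1 (it j) y0 by elim: j => // j IH; apply: h0.
have it1 j : agree j.+1 (it j) (it j.+1).
  elim: j => [x hx|j IH]; first by rewrite (it0 0%N) ?(it0 1%N).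
  exact: (hc j.+1 (it j) (it j.+1)).
have it2 j e : agree j.+1 (it j) (it (j + e)%N).
  elim: e => [|e IH] x hx; first by rewrite addn0.
  by rewrite IH // addnS it1 //; apply: leq_trans hx _; rewrite ltnS leq_addr.
exists (fun x => it (d x) x); split=> [x hx|x]; first by rewrite it0.
have ay j : agree j.+1 (fun x => it (d x) x) (it j).
  move=> {}x hx; have -> : j = (d x + (j - d x))%N by rewrite subnKC.
  by rewrite -it2.
transitivity (it (d x).+1 x); last by rewrite -it1.
apply: (hc (d x).+1 _ (it (d x))) => //.
by move=> {}x hx; rewrite it0.
Qed.

End Contraction.

Section IFT.
Variables (R : realType).
Local Notation C := R[i].
Implicit Types P : fps R 4.

Lemma ift_mean P n (a w w' b c : fps R n) : zc a -> zc w -> zc w' -> zc b -> zc c ->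
  exists2 V, fsubst P [tuple a; w; b; c] - fsubst P [tuple a; w'; b; c] = (w - w') * V &
    fcoef0 V = P (munit (inord 1)).
Proof.
move=> ha hw hw' hb hc.
have [|||V e hV] := @fsubst_mean R 4 n P [tuple a; w; b; c] [tuple a; w'; b; c] (inord 1).
- by zc_tac.
- by zc_tac.
- by apply: forall_ord4 => /eqP h; rewrite !tnthE // ; case: h.
by exists V; rewrite // e !tnthE.
Qed.

(** The cofactor of the mean value formula is a unit. *)
Lemma ift_cont P n N (a w w' b c : fps R n) : zc a -> zc w -> zc w' -> zc b -> zc c ->
  P (munit (inord 1)) <> 0 ->
  ford N (fsubst P [tuple a; w; b; c] - fsubst P [tuple a; w'; b; c]) -> ford N (w - w').
Proof.
move=> ha hw hw' hb hc hP; have [V -> hV] := ift_mean P ha hw hw' hb hc.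
by rewrite mulrC; apply: ford_unit; rewrite hV.
Qed.

Lemma ift_uniq P n (a w w' b c : fps R n) : zc a -> zc w -> zc w' -> zc b -> zc c ->
  P (munit (inord 1)) <> 0 ->
  fsubst P [tuple a; w; b; c] = fsubst P [tuple a; w'; b; c] -> w = w'.
Proof.
move=> ha hw hw' hb hc hP e; apply/eqP; rewrite -subr_eq0; apply/eqP; apply: ford_eq0 => N.
by apply: (ift_cont ha hw hw' hb hc hP); rewrite e subrr.
Qed.

(** The formal implicit function theorem: with [p = P_w (0)], the map
    [Q |-> Q - p^-1 P (z, Q, chi, tau)] gains one order of agreement. *)
Lemma ift P : zc P -> P (munit (inord 1)) <> 0 ->
  exists2 Q : fps R 3, zc Q & fsubst P [tuple 'x_0; Q; 'x_1; 'x_2] = 0.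
Proof.
move=> P0 P1; set p := P (munit (inord 1)) in P1.
pose E (Q : fps R 3) := fsubst P [tuple 'x_0; Q; 'x_1; 'x_2].
pose Phi (Q : fps R 3) : fps R 3 := Q - fC p^-1 * E Q.
have zc1 (u : fps R 3) : (forall x, (mdeg x < 1)%N -> u x = (0 : fps R 3) x) -> zc u.
  by move=> h; rewrite /zc /fcoef0 h // mdeg0.
have [||y [y0 yE]] := @contraction_fixpoint (mindex 3) C (@mdeg 3) Phi (0 : fps R 3).
- refine (fun u : fps R 3 => _) => /zc1 hu; apply: ford1; rewrite /Phi /E; zc_tac.
- move=> N; refine (fun u v : fps R 3 => _) => N0 /zc1 hu /zc1 hv huv m hm.
  have h : ford N (u - v) by move=> x hx; rewrite fcfB huv // subrr.
  apply/eqP; rewrite -subr_eq0 -fcfB; apply/eqP; move: m hm; rewrite -/(ford N.+1 _).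
  have [V e hV] := ift_mean P (@zcvar R 3 (inord 0)) hu hv (@zcvar R 3 (inord 1)) (@zcvar R 3 (inord 2)).
  rewrite (_ : _ - _ = (u - v) * (1 - fC p^-1 * V)).
    rewrite -[N.+1]addn1; apply: fordM => //; apply: ford1; rewrite /zc fcoef0D fcoef0N fcoef0M.
    by rewrite fcoef0C hV -/p mulVf ?subrr ?fcoef01 ?subrr //; apply/eqP.
  rewrite /Phi (_ : _ - _ = (u - v) - fC p^-1 * (E u - E v)); last by ring.
  rewrite e; ring.
move: y y0 yE; refine (fun y : fps R 3 => _) => y0 yE.
exists y; first exact: zc1.
have h : Phi y = y by apply: fpsP.
have h' : fC p^-1 * E y = 0.
  have -> : fC p^-1 * E y = y - Phi y by rewrite /Phi; ring.
  by rewrite h subrr.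
by apply: fmul_unit_eq0 h'; rewrite fcoef0C; apply/eqP; rewrite invr_neq0 //; apply/eqP.
Qed.

(** [P] vanishes on the graph of [Q], so the mean value formula factors it. *)
Lemma ift_factor P (Q : fps R 3) : zc Q -> fsubst P [tuple 'x_0; Q; 'x_1; 'x_2] = 0 ->
  exists2 u, fcoef0 u = P (munit (inord 1)) &
    P = u * ('x_1 - fsubst Q [tuple 'x_0; 'x_2; 'x_3]).
Proof.
move=> hQ e.
have z0 := @zcvar R 4 (inord 0). have z1 := @zcvar R 4 (inord 1).
have z2 := @zcvar R 4 (inord 2). have z3 := @zcvar R 4 (inord 3).
have hs : zc (fsubst Q [tuple 'x_0; 'x_2; 'x_3] : fps R 4) by zc_tac.
have [V eV hV] := ift_mean P z0 z1 hs z2 z3.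
exists V => //; move: eV; rewrite fsubst_id4.
have -> : fsubst P [tuple 'x_0; fsubst Q [tuple 'x_0; 'x_2; 'x_3]; 'x_2; 'x_3] = 0 :> fps R 4.
  have zx : zct ([tuple 'x_0; 'x_2; 'x_3] : 3.-tuple (fps R 4)) by zc_tac.
  have zq : zct ([tuple 'x_0; Q; 'x_1; 'x_2] : 4.-tuple (fps R 3)) by zc_tac.
  have := congr1 (fun f => fsubst f ([tuple 'x_0; 'x_2; 'x_3] : 3.-tuple (fps R 4))) e.
  by rewrite fsubst0 fsubstA // tcompE !fsubst_var // !tnthE.
by rewrite subr0 mulrC.
Qed.

End IFT.

(** * Formal changes of coordinates *)

(** Pushes substitutions down to the variables. *)
Ltac fs1 := first
  [ rewrite fsubst_var; [rewrite ?tnthE|zc_tac]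
  | rewrite fsubstA; [rewrite ?tcompE|zc_tac|zc_tac]
  | rewrite fsubstD | rewrite fsubstN | rewrite fsubst0
  | rewrite fsubstM; [|zc_tac]
  | rewrite fsubstC; [|zc_tac]
  | rewrite fsubst1; [|zc_tac]
  | rewrite fsubstX; [|zc_tac]
  | rewrite fconj_subst ?tconjE | rewrite fconj_var | rewrite fconjC | rewrite fconjK
  | rewrite fconjD | rewrite fconjN | rewrite fconjM | rewrite fconjX | rewrite fconj0 ].
Ltac fs := repeat fs1.

Section Coords.
Variables (R : realType).
Local Notation C := R[i].
Implicit Types (H T S FG : fps R 2 * fps R 2).

Lemma formal_coordsE H : formal_coords H <->
  [/\ zc H.1, zc H.2 & H.1 (munit (inord 0)) * H.2 (munit (inord 1)) -
                       H.1 (munit (inord 1)) * H.2 (munit (inord 0)) <> 0].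
Proof. by rewrite /formal_coords !fderiv0; split. Qed.

Lemma coef_comp2 (n : nat) (f : fps R 2) (a b : fps R n) j : zc a -> zc b ->
  fsubst f [tuple a; b] (munit j) =
    f (munit (inord 0)) * a (munit j) + f (munit (inord 1)) * b (munit j).
Proof.
move=> ha hb; rewrite coef_munit_subst; last by zc_tac.
rewrite big_ord_recl big_ord1; congr (_ * _ + _ * _).
- by congr (f (munit _)); apply: val_inj; rewrite /= inordK.
- by congr (f (munit _)); apply: val_inj; rewrite /= inordK.
Qed.

Lemma coords_comp_formal H T : formal_coords H -> formal_coords T ->
  formal_coords (coords_comp H T).
Proof.
move=> /formal_coordsE[h1 h2 h3] /formal_coordsE[t1 t2 t3]; apply/formal_coordsE; split => /=.
- by zc_tac.
- by zc_tac.
rewrite !coef_comp2 //.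
move: h3 t3; move: (H.1 _) (H.1 _) (H.2 _) (H.2 _) => a b c d.
move: (T.1 _) (T.1 _) (T.2 _) (T.2 _) => a' b' c' d' /eqP h /eqP h'; apply/eqP.
rewrite (_ : _ - _ = (b * d - a * c) * (b' * d' - a' * c')); last by ring.
by rewrite mulf_neq0.
Qed.

Lemma coords_compA H T S : formal_coords H -> formal_coords T -> formal_coords S ->
  coords_comp (coords_comp H T) S = coords_comp H (coords_comp T S).
Proof.
move=> /formal_coordsE[h1 h2 _] /formal_coordsE[t1 t2 _] /formal_coordsE[s1 s2 _].
rewrite /coords_comp /=; congr pair; fs; by [].
Qed.

Definition idcoords : fps R 2 * fps R 2 := ('x_0, 'x_1).

Lemma coords_comp1 H : coords_comp H idcoords = H.
Proof. by case: H => a b; rewrite /coords_comp /= !fsubst_id2. Qed.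

Lemma coords_comp_id T : formal_coords T -> coords_comp idcoords T = T.
Proof.
by case: T => a b /formal_coordsE[/= t1 t2 _]; rewrite /coords_comp /=; fs.
Qed.

Lemma munit_eq n (i j : 'I_n) : (munit i == munit j) = (i == j).
Proof.
apply/eqP/eqP => [e|-> //]; have := congr1 (fun t => tnth t i) e.
by rewrite !tnth_munit eqxx; case: eqP.
Qed.

Lemma inord_neq n (i j : nat) : (i < n.+1)%N -> (j < n.+1)%N -> i <> j ->
  (inord i == inord j :> 'I_n.+1) = false.
Proof. by move=> hi hj ne; apply/eqP => /(congr1 val); rewrite /= !inordK. Qed.

Lemma formal_idcoords : formal_coords idcoords.
Proof.
apply/formal_coordsE; split; [exact: zcvar|exact: zcvar|].
rewrite /idcoords /fvar /= !eqxx !munit_eq !inord_neq // mulr1 mul0r subr0.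
by apply/eqP; rewrite oner_neq0.
Qed.

(** The formal inverse function theorem in dimension two, by Newton iteration
    with the Jacobian frozen at the origin. *)
Lemma coords_right_inv T : formal_coords T ->
  exists2 S, formal_coords S & coords_comp T S = idcoords.
Proof.
move=> fT; have /formal_coordsE[t1 t2 t3] := fT.
case: T t1 t2 t3 fT => F G /= t1 t2; set a := F _; set d := G _; set b := F _; set c := G _ => D0 fT.
set D := a * d - b * c in D0.
pose r1 (S : fps R 2 * fps R 2) := fsubst F [tuple S.1; S.2] - 'x_0.
pose r2 (S : fps R 2 * fps R 2) := fsubst G [tuple S.1; S.2] - 'x_1.
pose Phi1 S : fps R 2 := S.1 - fC D^-1 * (fC d * r1 S - fC b * r2 S).
pose Phi2 S : fps R 2 := S.2 - fC D^-1 * (fC a * r2 S - fC c * r1 S).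
pose pr (u : bool * mindex 2 -> C) : fps R 2 * fps R 2 :=
  ((fun m => u (true, m)), (fun m => u (false, m))).
pose Phi (u : bool * mindex 2 -> C) (x : bool * mindex 2) : C :=
  if x.1 then Phi1 (pr u) x.2 else Phi2 (pr u) x.2.
have zc1 (u : fps R 2) : (forall x, (mdeg x < 1)%N -> u x = (0 : fps R 2) x) -> zc u.
  by move=> h; rewrite /zc /fcoef0 h // mdeg0.
pose y0 (x : bool * mindex 2) : C := 0.
have zcp u : (forall x : bool * mindex 2, (mdeg x.2 < 1)%N -> u x = y0 x) ->
    zc (pr u).1 /\ zc (pr u).2.
  by move=> h; split; apply: zc1 => x hx /=; rewrite h.
have z0 := @zcvar R 2 (inord 0). have z1 := @zcvar R 2 (inord 1).
have [||y [yz yE]] := @contraction_fixpoint _ C (fun x : bool * mindex 2 => mdeg x.2) Phi y0.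
- move=> u /zcp [h1 h2] [[] m] hm; rewrite /Phi /y0 /=.
    by rewrite -[RHS](fcf_0 R m); apply: (ford1 (f := Phi1 (pr u))) hm; rewrite /Phi1 /r1 /r2; zc_tac.
  by rewrite -[RHS](fcf_0 R m); apply: (ford1 (f := Phi2 (pr u))) hm; rewrite /Phi2 /r1 /r2; zc_tac.
- move=> N u v N0 /zcp [u1 u2] /zcp [v1 v2] huv.
  have h1 : ford N ((pr u).1 - (pr v).1) by move=> x hx; rewrite fcfB /= huv // subrr.
  have h2 : ford N ((pr u).2 - (pr v).2) by move=> x hx; rewrite fcfB /= huv // subrr.
  suff [k1 k2] : ford N.+1 (Phi1 (pr u) - Phi1 (pr v)) /\ ford N.+1 (Phi2 (pr u) - Phi2 (pr v)).
    move=> [[] m] /= hm; apply/eqP; rewrite /Phi /= -subr_eq0 -fcfB; apply/eqP.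
      exact: k1.
    exact: k2.
  move: (pr u) (pr v) u1 u2 v1 v2 h1 h2 => U V u1 u2 v1 v2 h1 h2.
  have mv (f : fps R 2) : exists V1 V2, fsubst f [tuple U.1; U.2] - fsubst f [tuple V.1; V.2] =
      (U.1 - V.1) * V1 + (U.2 - V.2) * V2 /\
      fcoef0 V1 = f (munit (inord 0)) /\ fcoef0 V2 = f (munit (inord 1)).
    have [|||V1 e1 hV1] := @fsubst_mean R 2 2 f [tuple U.1; U.2] [tuple V.1; U.2] (inord 0).
    - by zc_tac.
    - by zc_tac.
    - by apply: forall_ord2 => /eqP h; rewrite !tnthE //; case: h.
    have [|||V2 e2 hV2] := @fsubst_mean R 2 2 f [tuple V.1; U.2] [tuple V.1; V.2] (inord 1).
    - by zc_tac.
    - by zc_tac.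
    - by apply: forall_ord2 => /eqP h; rewrite !tnthE //; case: h.
    exists V1, V2; split=> //; move: e1 e2; rewrite !tnthE => <- <-; ring.
  have [A [B [eF [hA hB]]]] := mv F; have [E [I [eG [hE hI]]]] := mv G.
  have key x y A' B' : ford N x -> ford N y -> zc A' -> zc B' ->
      ford N.+1 (x * A' + y * B' : fps R 2).
    by move=> hx hy hA' hB'; rewrite -[N.+1]addn1; apply: fordD; apply: fordM => //; apply: ford1.
  have DV : D^-1 * D = 1 by rewrite mulVf //; apply/eqP.
  split.
  + rewrite /Phi1 /r1 /r2.
    rewrite (_ : _ - _ = (U.1 - V.1) - fC D^-1 *
      (fC d * (fsubst F [tuple U.1; U.2] - fsubst F [tuple V.1; V.2]) -
       fC b * (fsubst G [tuple U.1; U.2] - fsubst G [tuple V.1; V.2]))); last by ring.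
    rewrite eF eG (_ : _ - _ = (U.1 - V.1) * (1 - fC D^-1 * (fC d * A - fC b * E)) +
      (U.2 - V.2) * (- (fC D^-1 * (fC d * B - fC b * I)))); last by ring.
    apply: key => //; rewrite /zc !(fcoef0D, fcoef0N, fcoef0M, fcoef0C, fcoef01) hA hE || rewrite /zc !(fcoef0D, fcoef0N, fcoef0M, fcoef0C, fcoef01) hB hI.
    - rewrite -/a -/c (_ : d * a - b * c = D) ?DV ?subrr // /D; ring.
    - rewrite -/b -/d; ring.
  + rewrite /Phi2 /r1 /r2.
    rewrite (_ : _ - _ = (U.2 - V.2) - fC D^-1 *
      (fC a * (fsubst G [tuple U.1; U.2] - fsubst G [tuple V.1; V.2]) -
       fC c * (fsubst F [tuple U.1; U.2] - fsubst F [tuple V.1; V.2]))); last by ring.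
    rewrite eF eG (_ : _ - _ = (U.1 - V.1) * (- (fC D^-1 * (fC a * E - fC c * A))) +
      (U.2 - V.2) * (1 - fC D^-1 * (fC a * I - fC c * B))); last by ring.
    apply: key => //; rewrite /zc !(fcoef0D, fcoef0N, fcoef0M, fcoef0C, fcoef01) hA hE || rewrite /zc !(fcoef0D, fcoef0N, fcoef0M, fcoef0C, fcoef01) hB hI.
    - rewrite -/a -/c; ring.
    - rewrite -/b -/d (_ : a * d - c * b = D) ?DV ?subrr // /D; ring.
have [s1 s2] := zcp _ yz; set S := pr y in s1 s2.
have e1 : Phi1 S = S.1 by apply: fpsP => m; exact: (yE (true, m)).
have e2 : Phi2 S = S.2 by apply: fpsP => m; exact: (yE (false, m)).
clearbody S.
have DD : fC D * fC D^-1 = 1 :> fps R 2 by rewrite -rmorphM mulfV ?rmorph1 //; apply/eqP.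
have f1 : fC d * r1 S - fC b * r2 S = 0.
  rewrite -[LHS]mul1r -DD -mulrA (_ : fC D^-1 * _ = S.1 - Phi1 S); last by rewrite /Phi1; ring.
  by rewrite e1 subrr mulr0.
have f2 : fC a * r2 S - fC c * r1 S = 0.
  rewrite -[LHS]mul1r -DD -mulrA (_ : fC D^-1 * _ = S.2 - Phi2 S); last by rewrite /Phi2; ring.
  by rewrite e2 subrr mulr0.
have fD : fC D = fC a * fC d - fC b * fC c :> fps R 2 by rewrite /D rmorphB !rmorphM.
have D0' : fcoef0 (fC D : fps R 2) <> 0 by rewrite fcoef0C.
have g1 : r1 S = 0.
  apply: fmul_unit_eq0 D0' _; rewrite fD.
  rewrite (_ : _ * _ = fC a * (fC d * r1 S - fC b * r2 S) + fC b * (fC a * r2 S - fC c * r1 S)); last by ring.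
  by rewrite f1 f2 !mulr0 addr0.
have g2 : r2 S = 0.
  apply: fmul_unit_eq0 D0' _; rewrite fD.
  rewrite (_ : _ * _ = fC c * (fC d * r1 S - fC b * r2 S) + fC d * (fC a * r2 S - fC c * r1 S)); last by ring.
  by rewrite f1 f2 !mulr0 addr0.
have eS : coords_comp (F, G) S = idcoords.
  by rewrite /coords_comp /idcoords /=; congr pair; apply/eqP; rewrite -subr_eq0; apply/eqP.
exists S => //; apply/formal_coordsE; split => //.
have := formal_idcoords; rewrite -eS => /formal_coordsE[_ _] /=.
rewrite !coef_comp2 // -/a -/b -/c -/d => h h'; apply: h.
rewrite (_ : _ - _ = (a * d - b * c) * (S.1 (munit (inord 0)) * S.2 (munit (inord 1)) -
        S.1 (munit (inord 1)) * S.2 (munit (inord 0)))); last by ring.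
by rewrite h' mulr0.
Qed.

(** A right inverse has a right inverse, hence is a two-sided inverse. *)
Lemma coords_inv T : formal_coords T ->
  exists S, [/\ formal_coords S, coords_comp T S = idcoords & coords_comp S T = idcoords].
Proof.
move=> fT; have [S fS e] := coords_right_inv fT; exists S; split=> //.
have [U fU e'] := coords_right_inv fS.
suff -> : T = U by [].
by rewrite -(coords_comp1 T) -e' -coords_compA // e coords_comp_id.
Qed.

End Coords.

(** * The transition equation *)
Section Normal.
Variables (R : realType).
Local Notation C := R[i].
Implicit Types (M : formal_hypersurface R) (H T S FG : fps R 2 * fps R 2) (Q : fps R 3).

Lemma normalQ_zc Q : normal_Q Q -> zc Q.
Proof.
case=> h _ _; have := congr1 (@fcoef0 R 3) h; rewrite fcoef0_subst; last by zc_tac.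
by move=> e; rewrite /zc e; apply: zcvar.
Qed.

Lemma normalQ1 Q n (a c : fps R n) : normal_Q Q -> zc a -> zc c ->
  fsubst Q [tuple a; 0; c] = c.
Proof.
move=> hQ ha hc; have zQ := normalQ_zc hQ; case: hQ => h _ _.
have := congr1 (fun f => fsubst f [tuple a; 0; c]) h; rewrite /=; fs.
by [].
Qed.

Lemma normalQ2 Q n (b c : fps R n) : normal_Q Q -> zc b -> zc c ->
  fsubst Q [tuple 0; b; c] = c.
Proof.
move=> hQ ha hc; have zQ := normalQ_zc hQ; case: hQ => _ h _.
have := congr1 (fun f => fsubst f [tuple 0; b; c]) h; rewrite /=; fs.
by [].
Qed.

Lemma normalQ3 Q n (a b c : fps R n) : normal_Q Q -> zc a -> zc b -> zc c ->
  fsubst Q [tuple a; b; fsubst (fconj Q) [tuple b; a; c]] = c.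
Proof.
move=> hQ ha hb hc; have zQ := normalQ_zc hQ; case: hQ => _ _ h.
have := congr1 (fun f => fsubst f [tuple a; b; c]) h; rewrite /=; fs.
by [].
Qed.

Lemma fconj_inj n : injective (@fconj R n).
Proof. by move=> f g /(congr1 (@fconj R n)); rewrite !fconjK. Qed.

Lemma coef_kill1 (f : fps R 3) b c : fsubst f [tuple 'x_0; 0; 'x_2] [tuple b; 0%N; c] = f [tuple b; 0%N; c] :> C.
Proof.
have z0 := @zcvar R 3 (inord 0). have z1 := @zcvar R 3 (inord 1). have z2 := @zcvar R 3 (inord 2).
have [|||V e _] := @fsubst_mean R 3 3 f [tuple 'x_0; 'x_1; 'x_2] [tuple 'x_0; 0; 'x_2] (inord 1).
- by zc_tac.
- by zc_tac.
- by apply: forall_ord3 => /eqP h; rewrite !tnthE //; case: h.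
move: e; rewrite fsubst_id3 !tnthE subr0 => e.
apply/eqP; rewrite eq_sym -subr_eq0 -fcfB e; apply/eqP; apply: fcf_monM0 => l /(congr1 (fun t => tnth t (inord 1))).
by rewrite tnth_madd tnth_munit eqxx tnthE.
Qed.

Lemma coef_kill0 (f : fps R 3) b c : fsubst f [tuple 0; 'x_1; 'x_2] [tuple 0%N; b; c] = f [tuple 0%N; b; c] :> C.
Proof.
have z0 := @zcvar R 3 (inord 0). have z1 := @zcvar R 3 (inord 1). have z2 := @zcvar R 3 (inord 2).
have [|||V e _] := @fsubst_mean R 3 3 f [tuple 'x_0; 'x_1; 'x_2] [tuple 0; 'x_1; 'x_2] (inord 0).
- by zc_tac.
- by zc_tac.
- by apply: forall_ord3 => /eqP h; rewrite !tnthE //; case: h.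
move: e; rewrite fsubst_id3 !tnthE subr0 => e.
apply/eqP; rewrite eq_sym -subr_eq0 -fcfB e; apply/eqP; apply: fcf_monM0 => l /(congr1 (fun t => tnth t (inord 0))).
by rewrite tnth_madd tnth_munit eqxx tnthE.
Qed.

(** This is why every term of [Q - tau] carries a factor [z] and a factor
    [chi]. *)
Lemma normalQ_coef Q a b c : normal_Q Q -> (a = 0 \/ b = 0)%N ->
  (Q - 'x_2) [tuple a; b; c] = 0.
Proof.
case=> h1 h2 _ [->|->].
  by rewrite fcfB -(coef_kill0 Q) -[(0 : fps R 3)]/fzero h2 subrr.
by rewrite fcfB -(coef_kill1 Q) -[(0 : fps R 3)]/fzero h1 subrr.
Qed.

Lemma munit3E (j : nat) : (j < 3)%N -> munit (inord j) =
  [tuple (j == 0)%:R; (j == 1)%:R; (j == 2)%:R]%N :> mindex 3.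
Proof.
move=> hj; apply: eq_from_tnth; apply: forall_ord3; rewrite tnth_munit tnthE;
by case: j hj => [|[|[|]]] // _; rewrite ?eqxx ?inord_neq.
Qed.

Lemma normalQ_lin Q j : (j < 3)%N -> normal_Q Q -> Q (munit (inord j)) = (j == 2)%:R.
Proof.
move=> hj hQ; have h : Q (munit (inord j)) - ('x_2 : fps R 3) (munit (inord j)) = 0.
  rewrite -fcfB munit3E //.
  by case: j hj => [|[|[|]]] // _; apply: normalQ_coef => //; [right|left|left].
move/eqP: h; rewrite subr_eq0 => /eqP ->; rewrite /fvar munit_eq.
by case: j hj => [|[|[|]]] // _; rewrite ?eqxx ?inord_neq.
Qed.

(** The equation relating [Q] and [Q'] when [(z, w) = T (z', w')], on the graph
    of [Q']. *)
Definition trans T Q Q' : Prop :=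
  fsubst T.2 [tuple 'x_0; Q'] =
  fsubst Q [tuple fsubst T.1 [tuple 'x_0; Q']; fsubst (fconj T.1) [tuple 'x_1; 'x_2];
                  fsubst (fconj T.2) [tuple 'x_1; 'x_2]].

Lemma pullback_comp M H T : formal_coords H -> formal_coords T ->
  pullback M (coords_comp H T) = fsubst (pullback M H)
    [tuple fsubst T.1 [tuple 'x_0; 'x_1]; fsubst T.2 [tuple 'x_0; 'x_1];
      fsubst (fconj T.1) [tuple 'x_2; 'x_3]; fsubst (fconj T.2) [tuple 'x_2; 'x_3]].
Proof.
move=> /formal_coordsE[h1 h2 _] /formal_coordsE[t1 t2 _].
by rewrite /pullback /=; fs.
Qed.

Lemma eqn_QE Q : eqn_Q Q = 'x_1 - fsubst Q [tuple 'x_0; 'x_2; 'x_3].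
Proof. by []. Qed.

Lemma given_by_root M H Q : zc Q -> given_by M H (eqn_Q Q) ->
  fsubst (pullback M H) [tuple 'x_0; Q; 'x_1; 'x_2] = 0.
Proof.
move=> zQ [u _ ->]; rewrite -[fmul _ _]/(u * _) eqn_QE; fs.
by rewrite fsubst_id3 subrr mulr0.
Qed.

(** The pulled back equation vanishes on the graph of [Q'], and differs from the
    equation of [Q] by a unit. *)
Lemma trans_of M H T Q Q' : normal_coords_Q M H Q -> formal_coords T ->
  normal_coords_Q M (coords_comp H T) Q' -> trans T Q Q'.
Proof.
move=> [fH hQ [u u0 eu]] fT [_ hQ' g'].
have zQ := normalQ_zc hQ; have zQ' := normalQ_zc hQ'.
have /formal_coordsE[t1 t2 _] := fT.
have := given_by_root zQ' g'; rewrite pullback_comp // eu -[fmul _ _]/(u * _) eqn_QE.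
rewrite fsubstA; [rewrite tcompE|zc_tac|zc_tac].
rewrite fsubstM; last by zc_tac.
move=> h; have : fsubst ('x_1 - fsubst Q [tuple 'x_0; 'x_2; 'x_3])
  [tuple fsubst (fsubst T.1 [tuple 'x_0; 'x_1]) [tuple 'x_0; Q'; 'x_1; 'x_2];
   fsubst (fsubst T.2 [tuple 'x_0; 'x_1]) [tuple 'x_0; Q'; 'x_1; 'x_2];
   fsubst (fsubst (fconj T.1) [tuple 'x_2; 'x_3]) [tuple 'x_0; Q'; 'x_1; 'x_2];
   fsubst (fsubst (fconj T.2) [tuple 'x_2; 'x_3]) [tuple 'x_0; Q'; 'x_1; 'x_2]] = 0.
  apply: fmul_unit_eq0 h; rewrite fcoef0_subst //; zc_tac.
by fs => /eqP; rewrite subr_eq0 => /eqP.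
Qed.

(** The equation whose implicit solution for [w] is [Q']. *)
Definition trans_eqn T Q : fps R 4 :=
  fsubst T.2 [tuple 'x_0; 'x_1] - fsubst Q [tuple fsubst T.1 [tuple 'x_0; 'x_1];
     fsubst (fconj T.1) [tuple 'x_2; 'x_3]; fsubst (fconj T.2) [tuple 'x_2; 'x_3]].

Lemma trans_eqn_lin T Q : zc T.1 -> zc T.2 -> normal_Q Q ->
  trans_eqn T Q (munit (inord 1)) = T.2 (munit (inord 1)).
Proof.
move=> t1 t2 hQ; rewrite /trans_eqn fcfB coef_comp2; [|zc_tac|zc_tac].
rewrite coef_munit_subst; last by zc_tac.
rewrite !big_ord_recl big_ord0.
have -> : ord0 = inord 0 :> 'I_3 by apply: val_inj; rewrite /= inordK.
have -> : lift (inord 0) ord0 = inord 1 :> 'I_3 by apply: val_inj; rewrite /= !inordK.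
have -> : lift (inord 0) (lift ord0 ord0) = inord 2 :> 'I_3 by apply: val_inj; rewrite /= !inordK.
rewrite !normalQ_lin // !mul0r !add0r mul1r tnthE addr0 coef_comp2; [|zc_tac|zc_tac].
by rewrite /fvar !munit_eq !eqxx !inord_neq // !mulr0 addr0 mulr1 add0r subr0.
Qed.

(** The transition equation at [chi = 0], where [Q' = tau]: the points
    [(z, w)] and [(chi, tau) = (0, w)] satisfy the complexified equation of [M]
    in any normal coordinates. At [z = 0] it says that [w |-> T (0, w)] is a real
    curve on [M]. *)
Definition base T Q : Prop :=
  T.2 = fsubst Q [tuple T.1; fsubst (fconj T.1) [tuple 0; 'x_1]; fsubst (fconj T.2) [tuple 0; 'x_1]].

Lemma trans_base T Q Q' : zc T.1 -> zc T.2 -> normal_Q Q -> normal_Q Q' -> trans T Q Q' ->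
  base T Q.
Proof.
move=> t1 t2 hQ hQ' h; have zQ := normalQ_zc hQ; have zQ' := normalQ_zc hQ'.
have := congr1 (fun f => fsubst f ([tuple 'x_0; 0; 'x_1] : 3.-tuple (fps R 2))) h.
rewrite /=; fs; rewrite (normalQ1 hQ'); [|zc_tac|zc_tac].
by rewrite !fsubst_id2.
Qed.

End Normal.

(** * Normal coordinates with a prescribed base curve *)
Section Exist.
Variables (R : realType).
Local Notation C := R[i].
Implicit Types (M : formal_hypersurface R) (H T S FG : fps R 2 * fps R 2) (Q : fps R 3).

Lemma big_ord3 (F : 'I_3 -> C) : \sum_i F i = F (inord 0) + F (inord 1) + F (inord 2).
Proof.
rewrite !big_ord_recl big_ord0 addr0 addrA; congr (F _ + F _ + F _); apply: val_inj;
by rewrite /= inordK.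
Qed.

Lemma normalQ_munit Q n (a b c : fps R n) j : normal_Q Q -> zc a -> zc b -> zc c ->
  fsubst Q [tuple a; b; c] (munit j) = c (munit j).
Proof.
move=> hQ ha hb hc; rewrite coef_munit_subst; last by zc_tac.
by rewrite big_ord3 !normalQ_lin // !mul0r !add0r mul1r tnthE.
Qed.

Lemma base_Gz T Q : zc T.1 -> zc T.2 -> normal_Q Q -> base T Q -> T.2 (munit (inord 0)) = 0.
Proof.
move=> t1 t2 hQ ->; rewrite normalQ_munit //; [|zc_tac|zc_tac].
rewrite coef_comp2; [|zc_tac|zc_tac].
by rewrite /fvar munit_eq inord_neq // !mulr0 addr0.
Qed.

Lemma base_det T Q : formal_coords T -> normal_Q Q -> base T Q ->
  T.1 (munit (inord 0)) <> 0 /\ T.2 (munit (inord 1)) <> 0.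
Proof.
move=> /formal_coordsE[t1 t2]; move=> h hQ /(base_Gz t1 t2 hQ) e; move: h.
rewrite e mulr0 subr0 => /eqP; rewrite mulf_eq0 negb_or => /andP[/eqP ? /eqP ?]; by split.
Qed.

(** Every change of coordinates compatible with the base curve yields normal
    coordinates; the new [Q'] comes from the implicit function theorem, and its
    normality from uniqueness of implicit solutions. *)
Lemma base_trans T Q : formal_coords T -> normal_Q Q -> base T Q ->
  exists Q', [/\ normal_Q Q', trans T Q Q' &
    exists2 V, fcoef0 V <> 0 & trans_eqn T Q = V * eqn_Q Q'].
Proof.
move=> fT hQ hb; have [_ r0] := base_det fT hQ hb.
have zQ := normalQ_zc hQ; have /formal_coordsE[t1 t2 _] := fT.
set P := trans_eqn T Q.
have P1 : P (munit (inord 1)) <> 0 by rewrite /P trans_eqn_lin.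
have zP : zc P by rewrite /P /trans_eqn; zc_tac.
have [Q' zQ' eQ'] := ift zP P1.
have z0 := @zcvar R 3 (inord 0). have z1 := @zcvar R 3 (inord 1). have z2 := @zcvar R 3 (inord 2).
have root (a b c : fps R 3) : zc a -> zc b -> zc c ->
    fsubst P [tuple a; fsubst Q' [tuple a; b; c]; b; c] = 0.
  move=> ha hb' hc; have := congr1 (fun f => fsubst f [tuple a; b; c]) eQ'.
  by rewrite /=; fs.
have PE (a w b c : fps R 3) : zc a -> zc w -> zc b -> zc c ->
    fsubst P [tuple a; w; b; c] = fsubst T.2 [tuple a; w] -
      fsubst Q [tuple fsubst T.1 [tuple a; w]; fsubst (fconj T.1) [tuple b; c];
                      fsubst (fconj T.2) [tuple b; c]].
  by move=> ha hw hb' hc; rewrite /P /trans_eqn; fs.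
have baseE (a c : fps R 3) : zc a -> zc c -> fsubst T.2 [tuple a; c] =
    fsubst Q [tuple fsubst T.1 [tuple a; c]; fsubst (fconj T.1) [tuple 0; c];
                    fsubst (fconj T.2) [tuple 0; c]].
  move=> ha hc; have := congr1 (fun f => fsubst f [tuple a; c]) hb.
  by rewrite /=; fs.
have baseEc (a c : fps R 3) : zc a -> zc c -> fsubst (fconj T.2) [tuple a; c] =
    fsubst (fconj Q) [tuple fsubst (fconj T.1) [tuple a; c]; fsubst T.1 [tuple 0; c];
                    fsubst T.2 [tuple 0; c]].
  move=> ha hc; apply: fconj_inj; fs; rewrite baseE; [|zc_tac|zc_tac]; fs; by [].
have htr : trans T Q Q'.
  have := root _ _ _ z0 z1 z2; rewrite PE //; [|zc_tac]; rewrite fsubst_id3 => /eqP.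
  by rewrite subr_eq0 => /eqP.
have transE (a b c : fps R 3) (w := fsubst Q' [tuple a; b; c]) : zc a -> zc b -> zc c ->
    fsubst T.2 [tuple a; w] = fsubst Q [tuple fsubst T.1 [tuple a; w];
       fsubst (fconj T.1) [tuple b; c]; fsubst (fconj T.2) [tuple b; c]].
  move=> ha hb' hc; have := congr1 (fun f => fsubst f [tuple a; b; c]) htr.
  by rewrite /=; fs.
exists Q'; split=> //; last first.
  by have [V V0 eV] := ift_factor zQ' eQ'; exists V; rewrite // V0.
split.
- apply: (ift_uniq (P := P) (a := 'x_0) (b := 0) (c := 'x_2)) => //; [zc_tac|].
  rewrite root // PE // baseE // subrr //.
- apply: (ift_uniq (P := P) (a := 0) (b := 'x_1) (c := 'x_2)) => //; [zc_tac|].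
  rewrite root // PE //; symmetry; rewrite (baseEc 'x_1) //.
  rewrite (normalQ3 hQ); [by rewrite subrr|zc_tac..].
- set w := fsubst (fconj Q') _.
  have zw : zc w by rewrite /w; zc_tac.
  apply: (ift_uniq (P := P) (a := 'x_0) (b := 'x_1) (c := w)) => //; [zc_tac|].
  rewrite root // PE //.
  suff -> : fsubst (fconj T.2) [tuple 'x_1; w] = fsubst (fconj Q)
    [tuple fsubst (fconj T.1) [tuple 'x_1; w]; fsubst T.1 [tuple 'x_0; 'x_2];
           fsubst T.2 [tuple 'x_0; 'x_2]].
    rewrite (normalQ3 hQ); [by rewrite subrr|zc_tac..].
  apply: fconj_inj; fs.
  by rewrite transE //; fs.
Qed.

Lemma normal_coords_of M H T Q : normal_coords_Q M H Q -> formal_coords T -> base T Q ->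
  exists2 Q', normal_coords_Q M (coords_comp H T) Q' & trans T Q Q'.
Proof.
move=> [fH hQ [u u0 eu]] fT hb; have [Q' [hQ' ht [V V0 eV]]] := base_trans fT hQ hb.
exists Q' => //; split=> //; first exact: coords_comp_formal.
have /formal_coordsE[t1 t2 _] := fT; have zQ := normalQ_zc hQ.
pose h4 : 4.-tuple (fps R 4) := [tuple fsubst T.1 [tuple 'x_0; 'x_1]; fsubst T.2 [tuple 'x_0; 'x_1];
      fsubst (fconj T.1) [tuple 'x_2; 'x_3]; fsubst (fconj T.2) [tuple 'x_2; 'x_3]].
have z4 : zct h4 by rewrite /h4; zc_tac.
exists (fsubst u h4 * V).
  by rewrite fcoef0M fcoef0_subst //; apply/eqP; rewrite mulf_neq0 //; apply/eqP.
rewrite pullback_comp // eu -[fmul _ _]/(u * _) -/h4 fsubstM // -[RHS]/(fsubst u h4 * V * eqn_Q Q') -mulrA -eV.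
by rewrite eqn_QE /h4 /trans_eqn; fs.
Qed.

(** ** From the real to the complex form of the defining equation *)

Implicit Types phi : fps R 3.

Lemma normal_phi1 phi n (a c : fps R n) : normal_phi phi -> zc a -> zc c ->
  fsubst phi [tuple a; 0; c] = 0.
Proof.
case=> _ h _ ha hc; have := congr1 (fun f => fsubst f [tuple a; 0; c]) h; rewrite /=; fs.
by move=> ->.
Qed.

Lemma normal_phi2 phi n (b c : fps R n) : normal_phi phi -> zc b -> zc c ->
  fsubst phi [tuple 0; b; c] = 0.
Proof.
case=> _ _ h ha hc; have := congr1 (fun f => fsubst f [tuple 0; b; c]) h; rewrite /=; fs.
by move=> ->.
Qed.

Lemma normal_phi3 phi n (a b c : fps R n) : normal_phi phi -> zc a -> zc b -> zc c ->
  fsubst (fconj phi) [tuple b; a; c] = fsubst phi [tuple a; b; c].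
Proof.
case=> h _ _ ha hb hc; rewrite {2}h; fs; by [].
Qed.

Lemma normal_phi_coef phi a b c : normal_phi phi -> (a = 0 \/ b = 0)%N ->
  phi [tuple a; b; c] = 0.
Proof.
by case=> _ h1 h2 [->|->]; rewrite -(coef_kill0, coef_kill1) -[(0 : fps R 3)]/fzero ?h1 ?h2 //;
   rewrite -coef_kill1 -[(0 : fps R 3)]/fzero h1.
Qed.

Lemma normal_phi_zc phi : normal_phi phi -> zc phi.
Proof.
move=> h; rewrite /zc /fcoef0; have -> : mzero 3 = [tuple 0%N; 0%N; 0%N].
  by apply: eq_from_tnth; apply: forall_ord3; rewrite tnth_mzero tnthE.
by apply: normal_phi_coef => //; left.
Qed.

Lemma two_neq0 : (2 : C) != 0. Proof. by rewrite pnatr_eq0. Qed.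
Lemma im_neq0 : ('i%C : C) != 0. Proof. by rewrite eq_complex /= oner_eq0 andbF. Qed.

Lemma conj_2i : ((2 * 'i%C : C)^*)%C = - (2 * 'i%C).
Proof.
transitivity (((2 : C)^*)%C * (('i%C : C)^*)%C); first exact: (rmorphM (@conjc R)).
rewrite (conjc_nat R 2) -mulrN; congr (_ * _).
by apply/eqP; rewrite eq_complex /= oppr0 !eqxx.
Qed.

Lemma eqn_phiE phi : eqn_phi phi = fC (2 * 'i%C)^-1 * ('x_1 - 'x_3) -
   fsubst phi [tuple 'x_0; 'x_2; fC 2^-1 * ('x_1 + 'x_3)].
Proof. by rewrite /eqn_phi !fscaleE. Qed.

(** [Q] is the implicit solution for [w] of the real equation; the two formulas
    evaluate [phi] at [s = (w + tau) / 2] and [Q] at [tau = s - i phi]. *)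
Lemma normal_phi_Q M H phi : normal_coords_phi M H phi ->
  exists Q, [/\ normal_coords_Q M H Q,
    Q - 'x_2 = fC (2 * 'i%C) * fsubst phi [tuple 'x_0; 'x_1; 'x_2 + fC 2^-1 * (Q - 'x_2)] &
    phi = fC (2 * 'i%C)^-1 * fsubst (Q - 'x_2) [tuple 'x_0; 'x_1; 'x_2 - fC 'i%C * phi]].
Proof.
move=> [fH hphi [u u0 eu]]; have zphi := normal_phi_zc hphi.
set P := eqn_phi phi in eu.
have z40 := @zcvar R 4 (inord 0). have z41 := @zcvar R 4 (inord 1).
have z42 := @zcvar R 4 (inord 2). have z43 := @zcvar R 4 (inord 3).
have z0 := @zcvar R 3 (inord 0). have z1 := @zcvar R 3 (inord 1). have z2 := @zcvar R 3 (inord 2).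
have t0 := two_neq0; have i0 := im_neq0.
have P1 : P (munit (inord 1)) = (2 * 'i%C)^-1.
  rewrite /P eqn_phiE fcfB fcf_CM fcfB /fvar !munit_eq eqxx inord_neq // subr0 mulr1.
  rewrite coef_munit_subst; last by zc_tac.
  rewrite big_ord3 !munit3E // !(normal_phi_coef _ hphi) ?mul0r ?addr0 ?subr0 //; first [by left|by right].
have P1' : P (munit (inord 1)) <> 0.
  by rewrite P1; apply/eqP; rewrite invr_neq0 // mulf_neq0.
have zP : zc P by rewrite /P eqn_phiE; zc_tac.
have [Q zQ eQ] := ift zP P1'.
have PE n (a w b c : fps R n) : zc a -> zc w -> zc b -> zc c ->
    fsubst P [tuple a; w; b; c] = fC (2 * 'i%C)^-1 * (w - c) -
      fsubst phi [tuple a; b; fC 2^-1 * (w + c)].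
  by move=> ha hw hb hc; rewrite /P eqn_phiE; fs.
have root (a b c : fps R 3) : zc a -> zc b -> zc c ->
    fsubst P [tuple a; fsubst Q [tuple a; b; c]; b; c] = 0.
  move=> ha hb' hc; have := congr1 (fun f => fsubst f [tuple a; b; c]) eQ.
  by rewrite /=; fs.
have c2i : fC (2 * 'i%C) * fC (2 * 'i%C)^-1 = 1 :> fps R 3.
  by rewrite -fCM mulfV ?fC1 // mulf_neq0.
have hQ : normal_Q Q.
  split.
  - apply: (ift_uniq (P := P) (a := 'x_0) (b := 0) (c := 'x_2)) => //; [zc_tac|].
    by rewrite root // PE // subrr mulr0 (normal_phi1 hphi); [rewrite subr0|zc_tac..].
  - apply: (ift_uniq (P := P) (a := 0) (b := 'x_1) (c := 'x_2)) => //; [zc_tac|].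
    by rewrite root // PE // subrr mulr0 (normal_phi2 hphi); [rewrite subr0|zc_tac..].
  - set w := fsubst (fconj Q) _.
    have zw : zc w by rewrite /w; zc_tac.
    apply: (ift_uniq (P := P) (a := 'x_0) (b := 'x_1) (c := w)) => //; [zc_tac|].
    rewrite root // PE //; apply: fconj_inj; fs.
    have := root _ _ _ z1 z0 z2; rewrite PE; [|zc_tac..].
    set W := fsubst Q _; have zW : zc W by rewrite /W; zc_tac.
    rewrite (normal_phi3 (a := 'x_1)) //; last by zc_tac.
    rewrite !conjc_inv conj_2i conjc_nat [_ + W]addrC invrN fCN => <-; move: (fC (2 * 'i%C)^-1) => q; ring.
have e1 : Q - 'x_2 = fC (2 * 'i%C) * fsubst phi [tuple 'x_0; 'x_1; 'x_2 + fC 2^-1 * (Q - 'x_2)].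
  have := root _ _ _ z0 z1 z2; rewrite fsubst_id3 PE // => /eqP; rewrite subr_eq0 => /eqP e.
  have -> : 'x_2 + fC 2^-1 * (Q - 'x_2) = fC 2^-1 * (Q + 'x_2).
    have hh : fC 2^-1 + fC 2^-1 = 1 :> fps R 3.
      by rewrite -fCD -mulr2n -[_ *+ 2](mulr_natl (2^-1 : C)) mulfV ?fC1.
    transitivity ((fC 2^-1 + fC 2^-1) * 'x_2 + fC 2^-1 * (Q - 'x_2)); last by ring.
    by rewrite hh mul1r.
  by rewrite -e mulrA c2i mul1r.
exists Q; split=> //.
- split=> //; exists (u * (sval (cid2 (ift_factor zQ eQ)))).
    case: cid2 => V /= V0 _; rewrite fcoef0M V0 P1; apply/eqP.
    by rewrite mulf_neq0 ?invr_neq0 ?mulf_neq0 //; apply/eqP.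
  by case: cid2 => V /= V0 eV; rewrite eu -[fmul _ _]/(u * P) {1}eV -[RHS]/(u * V * eqn_Q Q) mulrA.
- set s := 'x_2 - fC 'i%C * phi; set w := 'x_2 + fC 'i%C * phi.
  have zs : zc s by rewrite /s; zc_tac.
  have zw : zc w by rewrite /w; zc_tac.
  have e : fsubst Q [tuple 'x_0; 'x_1; s] = w.
    apply: (ift_uniq (P := P) (a := 'x_0) (b := 'x_1) (c := s)) => //; [zc_tac|].
    rewrite root // PE //.
    have -> : w - s = fC (2 * 'i%C) * phi by rewrite /w /s fCM fCnat; ring.
    have -> : fC 2^-1 * (w + s) = 'x_2 :> fps R 3.
      have -> : w + s = fC 2 * 'x_2 by rewrite /w /s fCnat; ring.
      by rewrite mulrA -fCM mulVf // fC1 mul1r.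
    by rewrite mulrA [_ * fC (2 * _)]mulrC c2i mul1r fsubst_id3 subrr.
  fs; rewrite e.
  have -> : w - s = fC (2 * 'i%C) * phi by rewrite /w /s fCM fCnat; ring.
  by rewrite mulrA [_ * fC (2 * _)]mulrC c2i mul1r.
Qed.

End Exist.

(** * Supports in the exponents of z and tau *)
Section Supp.
Variables (R : realType).
Local Notation C := R[i].
Local Notation A := (fps R 3).
Implicit Types (f g h : A) (S : nat -> nat -> Prop).

(** The exponents of [chi] are left out: the order on pairs only sees those of
    [z] and [tau]. *)
Definition supp S f := forall b i c, f [tuple b; i; c] <> 0 -> S b c.

Lemma madd3 b i c b' i' c' : madd [tuple b; i; c] [tuple b'; i'; c'] =
  [tuple b + b'; i + i'; c + c']%N :> mindex 3.
Proof. by apply: eq_from_tnth; apply: forall_ord3; rewrite tnth_madd !tnthE. Qed.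

Lemma supp_sub S S' f : supp S f -> (forall b c, S b c -> S' b c) -> supp S' f.
Proof. by move=> h hS b i c /h /hS. Qed.
Lemma suppD S f g : supp S f -> supp S g -> supp S (f + g).
Proof.
move=> hf hg b i c; rewrite fcfD.
have [->|/eqP/hf //] := eqVneq (f [tuple b; i; c]) 0.
by rewrite add0r => /hg.
Qed.
Lemma suppN S f : supp S f -> supp S (- f).
Proof. by move=> hf b i c; rewrite fcfN => h; apply: (hf b i c) => e; apply: h; rewrite e oppr0. Qed.
Lemma suppB S f g : supp S f -> supp S g -> supp S (f - g).
Proof. by move=> hf hg; apply: suppD => //; apply: suppN. Qed.
Lemma suppM S S' S'' f g : supp S f -> supp S' g ->
  (forall b c b' c', S b c -> S' b' c' -> S'' (b + b')%N (c + c')%N) -> supp S'' (f * g).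
Proof.
move=> hf hg hS b i c h; apply: contrapT => hn; apply: h; apply: fcfM_eq0 => k l.
have [b1 [i1 [c1 ->]]] := tuple3P k; have [b2 [i2 [c2 ->]]] := tuple3P l.
rewrite madd3 => -[e1 _ e2].
have [->|/eqP/hf h1] := eqVneq (f [tuple b1; i1; c1]) 0; first by left.
have [->|/eqP/hg h2] := eqVneq (g [tuple b2; i2; c2]) 0; first by right.
by case: hn; rewrite -e1 -e2; apply: hS.
Qed.
Lemma suppC S c f : supp S f -> supp S (fC c * f).
Proof. by move=> hf b i d; rewrite fcf_CM => h; apply: (hf b i d) => e; apply: h; rewrite e mulr0. Qed.
Lemma suppMn S f e : supp S f -> supp S (f *+ e).
Proof. by move=> hf; elim: e => [|e IH]; rewrite ?mulr0n // mulrS; apply: suppD. Qed.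
Lemma supp1 S : S 0%N 0%N -> supp S 1.
Proof.
move=> h b i c; rewrite fcf_1; case: eqP => // e _.
have := congr1 (fun t => tnth t (inord 0)) e; have := congr1 (fun t => tnth t (inord 2)) e.
by rewrite !tnth_mzero !tnthE => -> ->.
Qed.
Lemma suppX (S : nat -> nat -> nat -> Prop) S1 f : supp S1 f -> S 0%N 0%N 0%N ->
  (forall e b c b' c', S1 b c -> S e b' c' -> S e.+1 (b + b')%N (c + c')%N) ->
  forall e, supp (S e) (f ^+ e).
Proof.
move=> hf h0 hS; elim=> [|e IH]; first exact: supp1.
by rewrite exprS; apply: suppM hf IH _; apply: hS.
Qed.

Lemma supp_sum I (r : seq I) (F : I -> A) S : (forall i, supp S (F i)) ->
  supp S (\sum_(i <- r) F i).
Proof. by move=> h; elim/big_rec : _ => // i x _ hx; apply: suppD. Qed.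

Lemma supp_fsum q (W : mindex q -> A) S : (forall k, supp S (W k)) -> supp S (fsum W).
Proof.
move=> h b i c; rewrite /fsum => hn; apply: contrapT => hS; apply: hn.
by rewrite big1 // => k _; apply: contrapT => /h.
Qed.

Lemma gmon3 n (x y t : fps R n) b i c : gmon [tuple x; y; t] [tuple b; i; c] = x ^+ b * y ^+ i * t ^+ c.
Proof.
rewrite /gmon !big_ord_recl big_ord0 mulr1 mulrA; congr (_ * _ * _).
Qed.
Lemma gmon2 n (x t : fps R n) b c : gmon [tuple x; t] [tuple b; c] = x ^+ b * t ^+ c.
Proof. by rewrite /gmon !big_ord_recl big_ord0 mulr1. Qed.
Lemma gmon1 n (x : fps R n) b : gmon [tuple x] [tuple b] = x ^+ b.
Proof. by rewrite /gmon !big_ord_recl big_ord0 mulr1. Qed.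

Lemma supp_subst_gmon q (f : fps R q) (g : q.-tuple A) S :
  (forall k, f k <> 0 -> supp S (gmon g k)) -> supp S (fsubst f g).
Proof.
move=> h b i c hn; apply: contrapT => hS; apply: hn; rewrite fsubstE0 big1 // => k _.
have [->|/eqP/h hk] := eqVneq (f k) 0; first by rewrite mul0r.
have [->|/eqP/hk //] := eqVneq (gmon g k [tuple b; i; c]) 0; by rewrite mulr0.
Qed.

Lemma supp_subst3 (f x y t : A) S :
  (forall b i c, f [tuple b; i; c] <> 0 -> supp S (x ^+ b * y ^+ i * t ^+ c)) ->
  supp S (fsubst f [tuple x; y; t]).
Proof.
move=> h; apply: supp_subst_gmon => k; have [b [i [c ->]]] := tuple3P k.
by rewrite gmon3; apply: h.
Qed.
Lemma supp_subst2 (f : fps R 2) (x t : A) S :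
  (forall b c, f [tuple b; c] <> 0 -> supp S (x ^+ b * t ^+ c)) ->
  supp S (fsubst f [tuple x; t]).
Proof.
move=> h; apply: supp_subst_gmon => k; have [b [c ->]] := tuple2P k.
by rewrite gmon2; apply: h.
Qed.
Lemma supp_subst1 (f : fps R 1) (x : A) S :
  (forall b, f [tuple b] <> 0 -> supp S (x ^+ b)) -> supp S (fsubst f [tuple x]).
Proof.
move=> h; apply: supp_subst_gmon => k; have [b ->] := tuple1P k.
by rewrite gmon1; apply: h.
Qed.
Lemma supp_subst3B (f x y t x' y' t' : A) S :
  (forall b i c, f [tuple b; i; c] <> 0 ->
     supp S (x ^+ b * y ^+ i * t ^+ c - x' ^+ b * y' ^+ i * t' ^+ c)) ->
  supp S (fsubst f [tuple x; y; t] - fsubst f [tuple x'; y'; t']).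
Proof.
move=> h b i c hn; apply: contrapT => hS; apply: hn; rewrite fcfB !fsubstE0 -sumrB big1 // => k _.
have [b1 [i1 [c1 ->]]] := tuple3P k; rewrite !gmon3 -mulrBr -fcfB.
have [->|/eqP/h hk] := eqVneq (f [tuple b1; i1; c1]) 0; first by rewrite mul0r.
set X := (_ - _); have [->|/eqP/hk //] := eqVneq (X [tuple b; i; c]) 0; by rewrite mulr0.
Qed.
Lemma supp_subst2B (f : fps R 2) (x t x' t' : A) S :
  (forall b c, f [tuple b; c] <> 0 -> supp S (x ^+ b * t ^+ c - x' ^+ b * t' ^+ c)) ->
  supp S (fsubst f [tuple x; t] - fsubst f [tuple x'; t']).
Proof.
move=> h b i c hn; apply: contrapT => hS; apply: hn; rewrite fcfB !fsubstE0 -sumrB big1 // => k _.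
have [b1 [c1 ->]] := tuple2P k; rewrite !gmon2 -mulrBr -fcfB.
have [->|/eqP/h hk] := eqVneq (f [tuple b1; c1]) 0; first by rewrite mul0r.
set X := (_ - _); have [->|/eqP/hk //] := eqVneq (X [tuple b; i; c]) 0; by rewrite mulr0.
Qed.
Lemma supp_subst1B (f : fps R 1) (x x' : A) S :
  (forall b, f [tuple b] <> 0 -> supp S (x ^+ b - x' ^+ b)) ->
  supp S (fsubst f [tuple x] - fsubst f [tuple x']).
Proof.
move=> h b i c hn; apply: contrapT => hS; apply: hn; rewrite fcfB !fsubstE0 -sumrB big1 // => k _.
have [b1 ->] := tuple1P k; rewrite !gmon1 -mulrBr -fcfB.
have [->|/eqP/h hk] := eqVneq (f [tuple b1]) 0; first by rewrite mul0r.
set X := (_ - _); have [->|/eqP/hk //] := eqVneq (X [tuple b; i; c]) 0; by rewrite mulr0.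
Qed.

Lemma mon3 b i c : 'x_0 ^+ b * 'x_1 ^+ i * 'x_2 ^+ c = mon R ([tuple b; i; c] : mindex 3).
Proof. by rewrite -gmon3 -vars3 gmon_vars. Qed.

Lemma supp_mon b i c S : S b c -> supp S (mon R ([tuple b; i; c] : mindex 3)).
Proof. by move=> h b' i' c'; rewrite /mon; case: eqP => // -[-> _ ->]. Qed.

Lemma supp_x0 : supp (fun b c => b = 1 /\ c = 0)%N 'x_0.
Proof. by rewrite fvarE munit3E //; apply: supp_mon. Qed.
Lemma supp_x1 : supp (fun b c => b = 0 /\ c = 0)%N 'x_1.
Proof. by rewrite fvarE munit3E //; apply: supp_mon. Qed.
Lemma supp_x2 : supp (fun b c => b = 0 /\ c = 1)%N 'x_2.
Proof. by rewrite fvarE munit3E //; apply: supp_mon. Qed.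
Lemma supp_x0X e : supp (fun b c => b = e /\ c = 0)%N ('x_0 ^+ e).
Proof. by apply: (@suppX (fun e b c => b = e /\ c = 0)%N _ _ supp_x0) => //; lia. Qed.
Lemma supp_x1X e : supp (fun b c => b = 0 /\ c = 0)%N ('x_1 ^+ e).
Proof. by apply: (@suppX (fun e b c => b = 0 /\ c = 0)%N _ _ supp_x1) => //; lia. Qed.
Lemma supp_x2X e : supp (fun b c => b = 0 /\ c = e)%N ('x_2 ^+ e).
Proof. by apply: (@suppX (fun e b c => b = 0 /\ c = e)%N _ _ supp_x2) => //; lia. Qed.

(** Substituting distinct variables renames them; [iota] is the effect on
    exponents. *)
Lemma coef_emb q n (f : fps R q) (g : q.-tuple (fps R n)) (iota : mindex q -> mindex n) k :
  zct g -> (forall l, gmon g l = mon R (iota l)) -> injective iota -> fsubst f g (iota k) = f k.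
Proof.
move=> zg hg hi; have hk : (mdeg k <= mdeg (iota k))%N.
  rewrite leqNgt; apply/negP => h; have := gmon_ord zg h.
  by rewrite hg /mon eqxx => /eqP; rewrite oner_eq0.
rewrite (fsubstE _ zg (leqnn _)) (@sum_mbox1 _ _ _ _ k) ?mbox_deg //.
  by rewrite hg /mon eqxx mulr1.
move=> l ne; rewrite hg /mon; case: eqP => [/hi e|_]; last by rewrite mulr0.
by rewrite e eqxx in ne.
Qed.
Lemma coef_emb0 q n (f : fps R q) (g : q.-tuple (fps R n)) (iota : mindex q -> mindex n) m :
  zct g -> (forall l, gmon g l = mon R (iota l)) -> (forall l, m <> iota l) -> fsubst f g m = 0.
Proof.
move=> zg hg hm; rewrite fsubstE0 big1 // => k _.
by rewrite hg /mon; case: eqP => [/hm|_] //; rewrite mulr0.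
Qed.

Lemma coef_x0x2 (f : fps R 2) b i c : fsubst f [tuple 'x_0; 'x_2] [tuple b; i; c] =
  if i == 0%N then f [tuple b; c] else 0.
Proof.
have z0 := @zcvar R 3 (inord 0). have z2 := @zcvar R 3 (inord 2).
pose iota (k : mindex 2) : mindex 3 := [tuple tnth k (inord 0); 0%N; tnth k (inord 1)].
have hg l : gmon [tuple 'x_0; 'x_2] l = mon R (iota l).
  have [b' [c' ->]] := tuple2P l; rewrite gmon2 /iota !tnthE -mon3 expr0 mulr1 //.
have hi : injective iota.
  move=> k l; have [b1 [c1 ->]] := tuple2P k; have [b2 [c2 ->]] := tuple2P l.
  by rewrite /iota !tnthE => -[-> ->].
have [->|/eqP ne] := eqVneq i 0%N.
  have -> : [tuple b; 0%N; c] = iota [tuple b; c] by rewrite /iota !tnthE.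
  by apply: (@coef_emb _ _ f _ iota) => //; zc_tac.
apply: (@coef_emb0 _ _ f _ iota) => //; first by zc_tac.
by move=> l; rewrite /iota => -[_ e _].
Qed.

Lemma coef_x1x2 (f : fps R 2) b i c : fsubst f [tuple 'x_1; 'x_2] [tuple b; i; c] =
  if b == 0%N then f [tuple i; c] else 0.
Proof.
have z0 := @zcvar R 3 (inord 1). have z2 := @zcvar R 3 (inord 2).
pose iota (k : mindex 2) : mindex 3 := [tuple 0%N; tnth k (inord 0); tnth k (inord 1)].
have hg l : gmon [tuple 'x_1; 'x_2] l = mon R (iota l).
  have [b' [c' ->]] := tuple2P l; rewrite gmon2 /iota !tnthE -mon3 expr0 mul1r //.
have hi : injective iota.
  move=> k l; have [b1 [c1 ->]] := tuple2P k; have [b2 [c2 ->]] := tuple2P l.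
  by rewrite /iota !tnthE => -[-> ->].
have [->|/eqP ne] := eqVneq b 0%N.
  have -> : [tuple 0%N; i; c] = iota [tuple i; c] by rewrite /iota !tnthE.
  by apply: (@coef_emb _ _ f _ iota) => //; zc_tac.
apply: (@coef_emb0 _ _ f _ iota) => //; first by zc_tac.
by move=> l; rewrite /iota => -[e _ _].
Qed.

Lemma coef_x1 (f : fps R 1) b i c : fsubst f [tuple 'x_1] [tuple b; i; c] =
  if (b == 0%N) && (c == 0%N) then f [tuple i] else 0.
Proof.
have z0 := @zcvar R 3 (inord 1).
pose iota (k : mindex 1) : mindex 3 := [tuple 0%N; tnth k (inord 0); 0%N].
have hg l : gmon [tuple 'x_1] l = mon R (iota l).
  have [b' ->] := tuple1P l; rewrite gmon1 /iota !tnthE -mon3 !expr0 mul1r mulr1 //.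
have hi : injective iota.
  move=> k l; have [b1 ->] := tuple1P k; have [b2 ->] := tuple1P l.
  by rewrite /iota !tnthE => -[->].
have [->|/eqP ne] /= := eqVneq b 0%N; last first.
  apply: (@coef_emb0 _ _ f _ iota) => //; first by zc_tac.
  by move=> l; rewrite /iota => -[e _ _].
have [->|/eqP ne] /= := eqVneq c 0%N; last first.
  apply: (@coef_emb0 _ _ f _ iota) => //; first by zc_tac.
  by move=> l; rewrite /iota => -[_ e].
have -> : [tuple 0%N; i; 0%N] = iota [tuple i] by rewrite /iota !tnthE.
by apply: (@coef_emb _ _ f _ iota) => //; zc_tac.
Qed.

Lemma coef_shift (f : A) b i c b' c' : ('x_0 ^+ b' * 'x_2 ^+ c' * f) [tuple b' + b; i; c' + c]%N = f [tuple b; i; c].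
Proof.
rewrite -[_ * _]/('x_0 ^+ b' * 'x_2 ^+ c' * f) (_ : 'x_0 ^+ b' * 'x_2 ^+ c' = mon R [tuple b'; 0%N; c']).
  by rewrite (_ : [tuple (b' + b)%N; i; (c' + c)%N] = madd [tuple b'; 0%N; c'] [tuple b; i; c]) ?fcf_monM // madd3.
by rewrite -mon3 expr0 mulr1.
Qed.

End Supp.
Arguments supp_x0 R [b i c].
Arguments supp_x1 R [b i c].
Arguments supp_x2 R [b i c].
Arguments supp_x0X R e [b i c].
Arguments supp_x1X R e [b i c].
Arguments supp_x2X R e [b i c].

(** * Invariance of the support *)

(** The regions of exponents [(b, c)] of [z^b tau^c] in which error terms live.
    [not_below al mu j]: [b >= 1] and [(b, c)] is not strictly below
    [(al, mu + j - 1)] for the order on pairs; [Q - tau] is supported there with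
    [j = 1], and [(tau + q)^j - tau^j] for general [j]. [not_below_w al mu k] is
    the same with [(al, mu + k)] and [c >= k], for the second component of a
    transition. [not_le a m]: [(b, c)] is neither below nor equal to [(a, m)].
    There is no subtraction, so that inclusions are decided by linear
    arithmetic. *)
Definition not_below (al mu j b c : nat) : Prop := (1 <= b)%N /\
  ~ ((b + c + 1 <= al + mu + j)%N /\ (c + 1 <= mu + j)%N /\ ~ (b = al /\ c + 1 = mu + j)%N).
Definition not_below_w (al mu k b c : nat) : Prop := (k <= c)%N /\
  ~ ((b + c <= al + mu + k)%N /\ (c <= mu + k)%N /\ ~ (b = al /\ c = mu + k)%N).
Definition not_le (a m b c : nat) : Prop := ~ ((b + c <= a + m)%N /\ (c <= m)%N).
Ltac slia := intros; cbv beta delta [not_below not_below_w not_le] in *; lia.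

Section Inv.
Variables (R : realType).
Local Notation C := R[i].
Local Notation A := (fps R 3).

Lemma supp_geX (f : A) e : supp (fun b c => 1 <= b + c)%N f -> supp (fun b c => e <= b + c)%N (f ^+ e).
Proof. by move=> h; apply: (@suppX _ (fun e b c => e <= b + c)%N _ _ h) => //; slia. Qed.

Lemma supp_tauX (f : A) e : supp (fun b c => b = 0 /\ 1 <= c)%N f -> supp (fun b c => b = 0 /\ e <= c)%N (f ^+ e).
Proof. by move=> h; apply: (@suppX _ (fun e b c => b = 0 /\ e <= c)%N _ _ h) => //; slia. Qed.

Lemma supp_chiX (f : A) e : supp (fun b c => b = 0)%N f -> supp (fun b c => b = 0)%N (f ^+ e).
Proof. by move=> h; apply: (@suppX _ (fun e b c => b = 0)%N _ _ h) => //; slia. Qed.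

Arguments supp_geX {f} e _ [b i c].
Arguments supp_tauX {f} e _ [b i c].
Arguments supp_chiX {f} e _ [b i c].

Lemma supp_wX (f : A) k e : (0 < e)%N -> (0 < k)%N -> supp (fun b c => b = 0 /\ k <= c)%N f ->
  supp (fun b c => b = 0 /\ k + e <= c + 1)%N (f ^+ e).
Proof.
case: e => // e _ hk h; rewrite exprS.
have h1 : supp (fun b c => b = 0 /\ 1 <= c)%N f by apply: supp_sub h _; slia.
by apply: suppM h (supp_tauX e h1) _; slia.
Qed.

Lemma munit00 : mzero 2 = [tuple 0%N; 0%N].
Proof. by apply: eq_from_tnth; apply: forall_ord2; rewrite tnth_mzero tnthE. Qed.

Lemma supp_zc2 (f : fps R 2) (x t : A) : zc f -> supp (fun b c => 1 <= b + c)%N x ->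
  supp (fun b c => 1 <= b + c)%N t -> supp (fun b c => 1 <= b + c)%N (fsubst f [tuple x; t]).
Proof.
move=> zf hx ht; apply: supp_subst2 => b c hbc.
have h : (1 <= b + c)%N.
  by case: b c hbc => [|b] [|c] //; rewrite -munit00 -[f _]/(fcoef0 f) zf.
by apply: suppM (supp_geX b hx) (supp_geX c ht) _; slia.
Qed.

Lemma supp_at0 (f : fps R 2) k : (forall c, (c < k)%N -> f [tuple 0%N; c] = 0) ->
  supp (fun b c => b = 0 /\ k <= c)%N (fsubst f [tuple 0; 'x_2] : A).
Proof.
move=> h; apply: supp_subst2 => -[|b] c hbc; last by rewrite expr0n mul0r.
rewrite expr0 mul1r; apply: supp_sub (supp_x2X R c) _ => b' c' [-> ->]; split=> //.
by rewrite leqNgt; apply/negP => /h.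
Qed.

Lemma supp_chi (f : fps R 2) : supp (fun b c => b = 0)%N (fsubst f [tuple 'x_1; 'x_2] : A).
Proof. by move=> b i c; rewrite coef_x1x2; case: (b =P 0%N). Qed.

(** Every term of the difference has a factor [q]. *)
Lemma supp_Qpow al mu (q : A) j : (2 <= al + mu)%N -> (1 <= al)%N -> supp (not_below al mu 1) q ->
  supp (not_below al mu j) (('x_2 + q) ^+ j - 'x_2 ^+ j).
Proof.
move=> N2 al1 hq; elim: j => [|j IH]; first by rewrite subrr.
have -> : ('x_2 + q) ^+ j.+1 - 'x_2 ^+ j.+1 =
  'x_2 * (('x_2 + q) ^+ j - 'x_2 ^+ j) + q * (('x_2 + q) ^+ j - 'x_2 ^+ j) + q * 'x_2 ^+ j.
  by rewrite !exprS; ring.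
apply: suppD; first apply: suppD.
- by apply: suppM (supp_x2 R) IH _; slia.
- by apply: suppM hq IH _; slia.
- by apply: suppM hq (supp_x2X R j) _; slia.
Qed.

Arguments supp_Qpow [al mu q] j _ _ _ [b i c].

Section Base.
Variables (T : fps R 2 * fps R 2) (Q : A) (al mu k : nat).
Hypotheses (t1 : zc T.1) (t2 : zc T.2) (nQ : normal_Q Q) (bQ : base T Q).
Hypotheses (al1 : (1 <= al)%N) (N2 : (2 <= al + mu)%N) (k1 : (1 <= k)%N).
Hypothesis hQ : supp (not_below al mu 1) (Q - 'x_2).
Hypothesis hF0 : forall c, (c < k)%N -> T.1 [tuple 0%N; c] = 0.

Let zQ := normalQ_zc nQ.
Let z0 := @zcvar R 3 (inord 0).
Let z1 := @zcvar R 3 (inord 1).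
Let z2 := @zcvar R 3 (inord 2).

Let F0c := fsubst (fconj T.1) [tuple 0; 'x_2] : A.
Let G0c := fsubst (fconj T.2) [tuple 0; 'x_2] : A.
Let gB := fsubst (fconj T.2) [tuple 'x_1; 'x_2] : A.
Let fB := fsubst (fconj T.1) [tuple 'x_1; 'x_2] : A.

Lemma Q_split (x y t : A) : zct [tuple x; y; t] ->
  fsubst Q [tuple x; y; t] = t + fsubst (Q - 'x_2) [tuple x; y; t].
Proof. by move=> z; rewrite fsubstB fsubst_var // tnthE addrC subrK. Qed.

Lemma Q_chi b i c : (Q - 'x_2) [tuple b; i; c] <> 0 -> (1 <= i)%N /\ not_below al mu 1 b c.
Proof.
move=> h; split; last exact: hQ h.
by case: i h => // h; case: h; apply: normalQ_coef => //; right.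
Qed.

Lemma supp_F0c : supp (fun b c => b = 0 /\ k <= c)%N F0c.
Proof. by apply: supp_at0 => c /hF0 h; rewrite /fconj h conjc0. Qed.

Lemma supp_G0c : supp (fun b c => b = 0 /\ 1 <= c)%N G0c.
Proof.
by apply: supp_at0 => -[|//] _; rewrite /fconj -munit00 -[T.2 _]/(fcoef0 T.2) t2 conjc0.
Qed.

(** By [base] the difference is [Q - tau] at arguments of which the second is
    [O (tau^k)]. *)
Lemma supp_GA : supp (not_below_w al mu k) (fsubst T.2 [tuple 'x_0; 'x_2] - G0c).
Proof.
have e : fsubst T.2 [tuple 'x_0; 'x_2] = fsubst Q [tuple fsubst T.1 [tuple 'x_0; 'x_2]; F0c; G0c] :> A.
  by have := congr1 (fun f => fsubst f ([tuple 'x_0; 'x_2] : 2.-tuple A)) bQ; rewrite /=; fs.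
rewrite e Q_split; last by rewrite /F0c /G0c; zc_tac.
rewrite addrAC subrr add0r; apply: supp_subst3 => b i c /Q_chi [hi hU].
case: i hi => // i _; rewrite exprS.
have hx : supp (fun b c => 1 <= b + c)%N (fsubst T.1 [tuple 'x_0; 'x_2] : A).
  by apply: supp_zc2 => //; [apply: supp_sub (supp_x0 R) _|apply: supp_sub (supp_x2 R) _]; slia.
have h0 := supp_F0c.
have h1 : supp (fun b c => b = 0 /\ k <= c)%N (F0c * F0c ^+ i).
  have h0' : supp (fun b c => b = 0)%N F0c by apply: supp_sub h0 _; slia.
  by apply: suppM h0 (supp_chiX i h0') _; slia.
have h2 : supp (fun b' c' => (b + k <= b' + c')%N /\ (k <= c')%N)
    (fsubst T.1 [tuple 'x_0; 'x_2] ^+ b * (F0c * F0c ^+ i)).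
  by apply: suppM (supp_geX b hx) h1 _; slia.
by apply: suppM h2 (supp_tauX c supp_G0c) _; slia.
Qed.

Lemma coef_GA b c : (1 <= b)%N -> T.2 [tuple b; c] <> 0 -> not_below_w al mu k b c.
Proof.
move=> b1 h; apply: (supp_GA (b := b) (i := 0) (c := c)); rewrite fcfB coef_x0x2 eqxx.
have -> : G0c [tuple b; 0%N; c] = 0; last by rewrite subr0.
by apply: contrapT => /supp_G0c [e _]; rewrite e in b1.
Qed.

Lemma coef_G_tau b c : T.2 [tuple b; c] <> 0 -> (1 <= c)%N.
Proof.
case: b => [|b]; last by move=> /coef_GA h; have := h isT; slia.
by case: c => // h; case: h; rewrite -munit00 -[T.2 _]/(fcoef0 T.2) t2.
Qed.

Lemma supp_gB : supp (fun b c => b = 0 /\ 1 <= c)%N gB.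
Proof.
move=> b i c; rewrite /gB coef_x1x2; case: (b =P 0%N) => // -> h; split=> //.
by apply: (@coef_G_tau i) => e; apply: h; rewrite /fconj e conjc0.
Qed.

(** The conjugate of [base], solved by the reality of [Q]: the transition
    equation at [z = 0], identically in [chi]. *)
Lemma base_at0 : fsubst T.2 [tuple 0; 'x_2] = fsubst Q [tuple fsubst T.1 [tuple 0; 'x_2]; fB; gB] :> A.
Proof.
have e : gB = fsubst (fconj Q) [tuple fB; fsubst T.1 [tuple 0; 'x_2]; fsubst T.2 [tuple 0; 'x_2]].
  apply: fconj_inj; rewrite /gB /fB; fs.
  by have := congr1 (fun f => fsubst f ([tuple 'x_1; 'x_2] : 2.-tuple A)) bQ; rewrite /=; fs.
rewrite -[LHS](normalQ3 nQ (a := fsubst T.1 [tuple 0; 'x_2]) (b := fB)) ?e //;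
  by rewrite /fB; zc_tac.
Qed.

Lemma supp_GB : supp (fun b c => b = 0 /\ k + 1 <= c)%N (fsubst T.2 [tuple 0; 'x_2] - gB).
Proof.
rewrite base_at0 Q_split; last by rewrite /fB /gB; zc_tac.
rewrite addrAC subrr add0r; apply: supp_subst3 => b i c /Q_chi [hi hU].
have hb : (0 < b)%N by move: hU; slia.
have hf := supp_wX hb k1 (supp_at0 hF0).
have h2 := suppM hf (supp_chiX i (@supp_chi (fconj T.1))) (S'' := fun b' c' => b' = 0 /\ k + b <= c' + 1)%N.
apply: suppM (h2 _) (supp_tauX c supp_gB) _; slia.
Qed.

(** The second component is real along [z = 0] for as long as the first one
    vanishes there. *)
Lemma coef_real c : (c <= k)%N -> (T.2 [tuple 0%N; c])^*%C = T.2 [tuple 0%N; c].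
Proof.
move=> hc; have : (fsubst T.2 [tuple 0; 'x_2] - gB) [tuple 0%N; 0%N; c] = 0.
  by apply: contrapT => /supp_GB; slia.
rewrite fcfB /gB coef_x1x2 eqxx /fconj => /eqP; rewrite subr_eq0 => /eqP <-.
have [|||V e _] := @fsubst_mean R 2 3 T.2 [tuple 'x_0; 'x_2] [tuple 0; 'x_2] (inord 0).
- by zc_tac.
- by zc_tac.
- by apply: forall_ord2 => /eqP h; rewrite !tnthE //; case: h.
rewrite !tnthE subr0 in e.
have : (fsubst T.2 [tuple 'x_0; 'x_2] - fsubst T.2 [tuple 0; 'x_2] : A) [tuple 0%N; 0%N; c] = 0.
  rewrite e; apply: fcf_monM0 => l /(congr1 (fun t => tnth t (inord 0))).
  by rewrite tnth_madd tnth_munit eqxx tnthE.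
by rewrite fcfB coef_x0x2 eqxx => /eqP; rewrite subr_eq0 => /eqP <-.
Qed.

(** This estimate and the next two are for truncations [tau + q] of [Q']. *)
Lemma supp_Fq (q : A) : zc q -> supp (not_below al mu 1) q ->
  supp (fun b c => 1 <= b + c)%N (fsubst T.1 [tuple 'x_0; 'x_2 + q]).
Proof.
clear k1 N2 al1 => zq hq; apply: supp_zc2 => //; first by apply: supp_sub (supp_x0 R) _; slia.
by apply: suppD; [apply: supp_sub (supp_x2 R) _|apply: supp_sub hq _]; slia.
Qed.

Lemma supp_RHS (q : A) : zc q -> supp (not_below al mu 1) q ->
  supp (fun b c => b = 0 \/ not_below al mu 1 b c)%N
    (fsubst Q [tuple fsubst T.1 [tuple 'x_0; 'x_2 + q]; fB; gB]).
Proof.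
move=> zq hq; rewrite Q_split; last by rewrite /fB /gB; zc_tac.
apply: suppD; first by apply: supp_sub supp_gB _; slia.
apply: supp_subst3 => b i c /Q_chi [hi hU].
have h2 := suppM (supp_geX b (supp_Fq zq hq)) (supp_chiX i (@supp_chi (fconj T.1)))
  (S'' := fun b' c' => b <= b' + c')%N.
apply: suppM (h2 _) (supp_tauX c supp_gB) _; slia.
Qed.

Lemma supp_LHS (q : A) : zc q -> supp (not_below al mu 1) q ->
  supp (fun b c => b = 0 \/ not_below al mu 1 b c)%N (fsubst T.2 [tuple 'x_0; 'x_2 + q]).
Proof.
move=> zq hq; apply: supp_subst2 => b c hbc; have c1 := coef_G_tau hbc.
have hp := supp_Qpow c N2 al1 hq.
rewrite (_ : _ * _ = 'x_0 ^+ b * (('x_2 + q) ^+ c - 'x_2 ^+ c) + 'x_0 ^+ b * 'x_2 ^+ c); last by ring.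
apply: suppD; first by apply: suppM (supp_x0X R b) hp _; slia.
have [b0|b0] := posnP b.
  by apply: suppM (supp_x0X R b) (supp_x2X R c) _; slia.
have := coef_GA b0 hbc => hG.
by apply: suppM (supp_x0X R b) (supp_x2X R c) _; slia.
Qed.

Section NewQ.
Variable Q' : A.
Let r := T.2 [tuple 0%N; 1%N].
Hypotheses (nQ' : normal_Q Q') (tr : trans T Q Q') (r0 : r <> 0).

Let zQ' := normalQ_zc nQ'.

Lemma munit2E (j : nat) : (j < 2)%N -> munit (inord j) = [tuple (j == 0)%:R; (j == 1)%:R]%N :> mindex 2.
Proof.
move=> hj; apply: eq_from_tnth; apply: forall_ord2; rewrite tnth_munit tnthE;
by case: j hj => [|[|]] // _; rewrite ?eqxx ?inord_neq.
Qed.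

(** Truncate [Q' - tau] and raise the truncation order one by one: the transition
    equation gives the next homogeneous part, up to the factor [r]. *)
Lemma supp_trans : supp (not_below al mu 1) (Q' - 'x_2).
Proof.
suff h n : forall b i c, (b + i + c < n)%N -> (Q' - 'x_2) [tuple b; i; c] <> 0 -> not_below al mu 1 b c.
  by move=> b i c; apply: (h (b + i + c).+1).
elim: n => // n IH b i c; rewrite ltnS leq_eqVlt => /orP[/eqP hn|]; last exact: IH.
pose q : A := fun m => if (mdeg m < n)%N then (Q' - 'x_2) m else 0.
have md (x y z : nat) : mdeg ([tuple x; y; z] : mindex 3) = (x + y + z)%N.
  by rewrite /mdeg !big_ord_recl big_ord0 addn0 addnA.
have hq : supp (not_below al mu 1) q.
  by move=> b' i' c'; rewrite /q md; case: ltnP => // /IH h /h.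
have zq' : zc (Q' - 'x_2) by zc_tac.
have zq : zc q by rewrite /zc /fcoef0 /q; case: ifP => // _; exact: zq'.
have oq : ford n (Q' - ('x_2 + q)).
  move=> m hm; rewrite (_ : Q' - _ = (Q' - 'x_2) - q); last by ring.
  by rewrite fcfB /q hm subrr.
pose E X := fsubst T.2 [tuple 'x_0; X] - fsubst Q [tuple fsubst T.1 [tuple 'x_0; X]; fB; gB] : A.
have EE X : zc X -> E X = fsubst (trans_eqn T Q) [tuple 'x_0; X; 'x_1; 'x_2].
  by move=> zX; rewrite /E /trans_eqn /fB /gB; fs.
have zX : zc ('x_2 + q) by zc_tac.
have EQ' : E Q' = 0 by rewrite /E tr subrr.
have [V eV hV] := ift_mean (trans_eqn T Q) z0 zQ' zX z1 z2.
rewrite -!EE // EQ' sub0r in eV.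
have V0 : fcoef0 V = r by rewrite hV trans_eqn_lin // munit2E.
have [b0|b0] := posnP b.
  by move=> h; case: h; apply: normalQ_coef => //; left.
move=> h; have {}h : (Q' - ('x_2 + q)) [tuple b; i; c] <> 0.
  rewrite (_ : Q' - _ = (Q' - 'x_2) - q); last by ring.
  by rewrite fcfB /q md hn ltnn subr0.
suff : b = 0%N \/ not_below al mu 1 b c by case=> // e; rewrite e in b0.
have hE : supp (fun b c => b = 0 \/ not_below al mu 1 b c)%N (E ('x_2 + q)).
  by apply: suppB; [apply: supp_LHS|apply: supp_RHS].
apply: (hE b i c) => e0; apply: h.
have e1 : ((Q' - ('x_2 + q)) * V) [tuple b; i; c] = 0 by rewrite -eV fcfN e0 oppr0.
have e2 : ford n.+1 ((Q' - ('x_2 + q)) * (V - fC r)).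
  rewrite -[n.+1]addn1; apply: fordM => //; apply: ford1.
  by rewrite /zc fcoef0D fcoef0N fcoef0C V0 subrr.
have e3 : ((Q' - ('x_2 + q)) * (V - fC r)) [tuple b; i; c] = 0 by apply: e2; rewrite md hn.
move: e3; rewrite mulrBr [(_ * V - _) _]fcfB e1 sub0r => /eqP.
by rewrite oppr_eq0 mulrC fcf_CM mulf_eq0 => /orP[/eqP //|/eqP //].
Qed.

End NewQ.
End Base.
End Inv.
Arguments supp_geX [R f] e _ [b i c].
Arguments supp_tauX [R f] e _ [b i c].
Arguments supp_chiX [R f] e _ [b i c].
Arguments supp_Qpow [R al mu q] j _ _ _ [b i c].

(** * The leading coefficient at an invariant pair *)
Section Lead.
Variables (R : realType).
Local Notation C := R[i].
Local Notation A := (fps R 3).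

Definition leadpart (Q : A) al mu : A :=
  'x_0 ^+ al * 'x_2 ^+ mu * fsubst (coefchi Q al mu) [tuple 'x_1].

Lemma coefchiE (Q : A) al mu i : coefchi Q al mu [tuple i] = Q [tuple al; i; mu].
Proof. by []. Qed.

Lemma supp_qc (qc : fps R 1) : supp (fun b c => b = 0 /\ c = 0)%N (fsubst qc [tuple 'x_1] : A).
Proof. by apply: supp_subst1 => b _; apply: supp_x1X. Qed.

Lemma supp_lead (Q : A) al mu : supp (fun b c => b = al /\ c = mu)%N (leadpart Q al mu).
Proof.
have h := suppM (supp_x0X R al) (supp_x2X R mu) (S'' := fun b c => b = al /\ c = mu)%N.
by apply: suppM (h _) (@supp_qc _) _; slia.
Qed.

Lemma coef_lead (Q : A) al mu i : leadpart Q al mu [tuple al; i; mu] = Q [tuple al; i; mu].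
Proof.
rewrite /leadpart; have := @coef_shift R (fsubst (coefchi Q al mu) [tuple 'x_1]) 0 i 0 al mu.
by rewrite !addn0 coef_x1 /= => ->.
Qed.

Lemma coef_x2 b i c : (1 <= b)%N -> ('x_2 : A) [tuple b; i; c] = 0.
Proof. by move=> b1; apply: contrapT => /(supp_x2 R); lia. Qed.

Lemma supp_rest (Q : A) al mu : (1 <= al)%N -> supp (not_below al mu 1) (Q - 'x_2) ->
  supp (fun b c => (1 <= b)%N /\ not_le al mu b c) (Q - 'x_2 - leadpart Q al mu).
Proof.
move=> al1 hQ b i c h.
have hU : not_below al mu 1 b c.
  apply: (suppB hQ (S := not_below al mu 1) _ h); apply: supp_sub (@supp_lead Q al mu) _; slia.
suff : ~ (b = al /\ c = mu) by move: hU; slia.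
move=> [eb ec]; apply: h; rewrite eb ec 2!fcfB coef_lead coef_x2 //.
by rewrite subr0 subrr.
Qed.

Lemma subst_lead (Q : A) al mu (x y t : A) : zc x -> zc y -> zc t ->
  fsubst (Q - 'x_2) [tuple x; y; t] = x ^+ al * t ^+ mu * fsubst (coefchi Q al mu) [tuple y] +
   fsubst (Q - 'x_2 - leadpart Q al mu) [tuple x; y; t].
Proof.
move=> zx zy zt; have -> : x ^+ al * t ^+ mu * fsubst (coefchi Q al mu) [tuple y] =
  fsubst (leadpart Q al mu) [tuple x; y; t] by rewrite /leadpart; fs.
by rewrite -fsubstD; congr (fsubst _ _); ring.
Qed.

Lemma supp_qcB (qc : fps R 1) (y y0 : A) k : supp (fun b c => b = 0)%N y -> supp (fun b c => b = 0)%N y0 ->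
  supp (fun b c => b = 0 /\ k <= c)%N (y - y0) ->
  supp (fun b c => b = 0 /\ k <= c)%N (fsubst qc [tuple y] - fsubst qc [tuple y0]).
Proof.
move=> hy hy0 h; apply: supp_subst1B => e _; rewrite subrXX.
apply: (@suppM _ _ (fun b c => b = 0%N) _ _ _ h); last by slia.
apply: supp_sum => i; apply: suppM (supp_chiX _ hy) (supp_chiX _ hy0) _; slia.
Qed.

Lemma supp_qc0 (qc : fps R 1) (y : A) : supp (fun b c => b = 0)%N y ->
  supp (fun b c => b = 0)%N (fsubst qc [tuple y]).
Proof. by move=> hy; apply: supp_subst1 => b _; apply: supp_chiX. Qed.

Section InvLead.
Variables (T : fps R 2 * fps R 2) (Q Q' : A) (al mu : nat).
Hypotheses (t1 : zc T.1) (t2 : zc T.2) (nQ : normal_Q Q) (nQ' : normal_Q Q') (bQ : base T Q).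
Hypothesis (tr : trans T Q Q').
Hypotheses (al1 : (1 <= al)%N) (N2 : (2 <= al + mu)%N).
Hypothesis hQ : supp (not_below al mu 1) (Q - 'x_2).
Let r := T.2 [tuple 0%N; 1%N].
Let ga := T.1 [tuple 1%N; 0%N].
Hypothesis r0 : r <> 0.
Let f0 : fps R 1 := fsubst (fconj T.1) [tuple 'x_0; 0].
Let q := Q' - 'x_2.
Let F := fsubst T.1 [tuple 'x_0; Q'] : A.
Let fB := fsubst (fconj T.1) [tuple 'x_1; 'x_2] : A.
Let gB := fsubst (fconj T.2) [tuple 'x_1; 'x_2] : A.

Let hF0 c : (c < 1)%N -> T.1 [tuple 0%N; c] = 0.
Proof. by case: c => // _; rewrite -munit00 -[T.1 _]/(fcoef0 T.1) t1. Qed.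

Let hq : supp (not_below al mu 1) q.
Proof. exact: (supp_trans t1 t2 nQ bQ al1 N2 (leqnn 1) hQ hF0 nQ' tr r0). Qed.

Let zq : zc q.
Proof. by have := normalQ_zc nQ'; rewrite /q => h; zc_tac. Qed.

Let Q'E : 'x_2 + q = Q'.
Proof. by rewrite /q addrC subrK. Qed.

Lemma inv_F : supp (not_le 1 0) (F - fC ga * 'x_0).
Proof.
have z0 := @zcvar R 3 (inord 0). have z20 := @zcvar R 2 (inord 0).
have zQ' := normalQ_zc nQ'.
have -> : F - fC ga * 'x_0 = fsubst (T.1 - fC ga * 'x_0) [tuple 'x_0; Q'] by rewrite /F; fs.
apply: supp_subst2 => b c hbc.
have {}hbc : (2 <= b + c \/ 1 <= c)%N.
  case: c hbc => [|c]; last by right.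
  case: b => [|[|b]]; [| |by left].
    by case; rewrite fcfB fcf_CM -munit00 -[T.1 _]/(fcoef0 T.1) t1 -[fvar _ _]/(fcoef0 (fvar _)) z20 mulr0 subrr.
  case; rewrite fcfB fcf_CM /fvar munit2E // eqxx mulr1 subrr //.
rewrite -Q'E (_ : _ * _ = 'x_0 ^+ b * (('x_2 + q) ^+ c - 'x_2 ^+ c) + 'x_0 ^+ b * 'x_2 ^+ c); last by ring.
have hp := supp_Qpow c N2 al1 hq.
by apply: suppD; [apply: suppM (supp_x0X R b) hp _|apply: suppM (supp_x0X R b) (supp_x2X R c) _]; slia.
Qed.

Lemma inv_FX e : supp (not_le e 0) (F ^+ e - fC (ga ^+ e) * 'x_0 ^+ e).
Proof.
have hF := inv_F; have hFq : supp (fun b c => 1 <= b + c)%N F.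
  by rewrite /F -Q'E; apply: (supp_Fq t1 zq hq).
elim: e => [|e IH]; first by rewrite !expr0 fC1 mulr1 subrr.
rewrite (_ : _ - _ = F * (F ^+ e - fC (ga ^+ e) * 'x_0 ^+ e) + fC (ga ^+ e) * ((F - fC ga * 'x_0) * 'x_0 ^+ e)); last first.
  by rewrite !exprS fCM; ring.
apply: suppD; first by apply: suppM hFq IH _; slia.
by apply: suppC; apply: suppM hF (supp_x0X R e) _; slia.
Qed.

Lemma inv_gB : supp (fun b c => b = 0 /\ 2 <= c)%N (gB - fC r * 'x_2).
Proof.
have z2 := @zcvar R 3 (inord 2). have z21 := @zcvar R 2 (inord 1).
rewrite (_ : _ - _ = (fsubst T.2 [tuple 0; 'x_2] - fC r * 'x_2) - (fsubst T.2 [tuple 0; 'x_2] - gB)); last by ring.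
apply: suppB; last exact: (supp_GB t1 t2 nQ bQ al1 N2 (leqnn 1) hQ hF0).
have -> : fsubst T.2 [tuple 0; 'x_2] - fC r * 'x_2 = fsubst (T.2 - fC r * 'x_1) [tuple 0; 'x_2] :> A by fs.
apply: supp_at0 => -[|[|//]] _; rewrite fcfB fcf_CM.
  by rewrite -munit00 -[T.2 _]/(fcoef0 T.2) t2 -[fvar _ _]/(fcoef0 (fvar _)) z21 mulr0 subrr.
by rewrite /fvar munit2E // eqxx mulr1 subrr.
Qed.

Lemma inv_gBX e : supp (fun b c => b = 0 /\ e + 1 <= c)%N (gB ^+ e - fC (r ^+ e) * 'x_2 ^+ e).
Proof.
have hg : supp (fun b c => b = 0 /\ 1 <= c)%N gB by apply: (supp_gB t1 t2 nQ bQ al1 N2 (leqnn 1) hQ hF0).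
elim: e => [|e IH]; first by rewrite !expr0 fC1 mulr1 subrr.
rewrite (_ : _ - _ = gB * (gB ^+ e - fC (r ^+ e) * 'x_2 ^+ e) + fC (r ^+ e) * ((gB - fC r * 'x_2) * 'x_2 ^+ e)); last first.
  by rewrite !exprS fCM; ring.
apply: suppD; first by apply: suppM hg IH _; slia.
by apply: suppC; apply: suppM inv_gB (supp_x2X R e) _; slia.
Qed.

Lemma inv_LHS : supp (fun b c => b = 0%N \/ not_le al mu b c) (fsubst T.2 [tuple 'x_0; Q'] - fC r * Q').
Proof.
have z0 := @zcvar R 3 (inord 0). have z20 := @zcvar R 2 (inord 1). have zQ' := normalQ_zc nQ'.
have -> : fsubst T.2 [tuple 'x_0; Q'] - fC r * Q' = fsubst (T.2 - fC r * 'x_1) [tuple 'x_0; Q'] by fs.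
apply: supp_subst2 => b c hbc.
rewrite -Q'E (_ : _ * _ = 'x_0 ^+ b * (('x_2 + q) ^+ c - 'x_2 ^+ c) + 'x_0 ^+ b * 'x_2 ^+ c); last by ring.
have hp := supp_Qpow c N2 al1 hq.
have [b0|b0] := posnP b.
  have c2 : (2 <= c)%N.
    move: hbc; rewrite b0; case: c {hp} => [|[|//]] h; case: h; rewrite fcfB fcf_CM.
      by rewrite -munit00 -[T.2 _]/(fcoef0 T.2) t2 -[fvar _ _]/(fcoef0 (fvar _)) z20 mulr0 subrr.
    by rewrite /fvar munit2E // eqxx mulr1 subrr.
  by apply: suppD; [apply: suppM (supp_x0X R b) hp _|apply: suppM (supp_x0X R b) (supp_x2X R c) _]; slia.
have hG : not_below_w al mu 1 b c.
  apply: (coef_GA t1 t2 nQ bQ al1 N2 (leqnn 1) hQ hF0 b0) => e; apply: hbc.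
  rewrite fcfB fcf_CM e /fvar munit2E //; case: eqP => [|_]; last by rewrite mulr0 subrr.
  by case=> e'; rewrite e' in b0.
by apply: suppD; [apply: suppM (supp_x0X R b) hp _|apply: suppM (supp_x0X R b) (supp_x2X R c) _]; slia.
Qed.

(** Modulo monomials with [b = 0] or not below or equal to [(al, mu)], the left
    side of the transition equation is [r Q'], only the leading part of [Q]
    counts on the right, and there [F], [conj F] and [conj G] may be replaced by
    [ga z], [f0 (chi)] and [r tau]. *)
Lemma lead_coef_trans : fC r * coefchi Q' al mu = fC (ga ^+ al * r ^+ mu) * fsubst (coefchi Q al mu) [tuple f0].
Proof.
have z0 := @zcvar R 3 (inord 0). have z1 := @zcvar R 3 (inord 1). have z2 := @zcvar R 3 (inord 2).
have z20 := @zcvar R 2 (inord 1). have zQ' := normalQ_zc nQ'. have z10 := @zcvar R 1 (inord 0).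
have zF : zc F by rewrite /F; zc_tac.
have zfB : zc fB by rewrite /fB; zc_tac.
have zgB : zc gB by rewrite /gB; zc_tac.
have zf0 : zc f0 by rewrite /f0; zc_tac.
set qc := coefchi Q al mu.
have e := tr; rewrite /trans -/F -/fB -/gB (@Q_split R Q F fB gB) in e; last by zc_tac.
rewrite (subst_lead Q al mu) // -/qc in e.
pose W0 : A := fsubst (fsubst qc [tuple f0]) [tuple 'x_1].
have hfB0 : supp (fun b c => b = 0)%N (fsubst f0 [tuple 'x_1] : A).
  by apply: supp_sub (@supp_qc f0) _; slia.
have W0E : W0 = fsubst qc [tuple fsubst f0 [tuple 'x_1]] by rewrite /W0; fs.
have hfB : supp (fun b c => b = 0)%N fB by apply: supp_chi.
have hfBB : supp (fun b c => b = 0 /\ 1 <= c)%N (fB - fsubst f0 [tuple 'x_1]).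
  have -> : fsubst f0 [tuple 'x_1] = fsubst (fconj T.1) [tuple 'x_1; 0] :> A by rewrite /f0; fs.
  apply: supp_subst2B => b [|c] _; first by rewrite !expr0 subrr.
  rewrite [0 ^+ c.+1]expr0n mulr0 subr0; apply: suppM (supp_x1X R b) (supp_x2X R c.+1) _; slia.
have hW : supp (fun b c => b = 0 /\ 1 <= c)%N (fsubst qc [tuple fB] - W0).
  by rewrite W0E; apply: supp_qcB.
have hW1 : supp (fun b c => b = 0)%N (fsubst qc [tuple fB]) by apply: supp_qc0.
have hgB : supp (fun b c => b = 0 /\ 1 <= c)%N gB by apply: (supp_gB t1 t2 nQ bQ al1 N2 (leqnn 1) hQ hF0).
have hFq : supp (fun b c => 1 <= b + c)%N F.
  by rewrite /F -Q'E; apply: (supp_Fq t1 zq hq).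
have hrest : supp (not_le al mu) (fsubst (Q - 'x_2 - leadpart Q al mu) [tuple F; fB; gB]).
  apply: supp_subst3 => b i c /(supp_rest al1 hQ) [b1 hn].
  have h2 := suppM (supp_geX b hFq) (supp_chiX i hfB) (S'' := fun b' c' => b <= b' + c')%N.
  by apply: suppM (h2 _) (supp_tauX c hgB) _; slia.
have hmain : supp (not_le al mu) (F ^+ al * gB ^+ mu * fsubst qc [tuple fB] -
    fC (ga ^+ al * r ^+ mu) * ('x_0 ^+ al * 'x_2 ^+ mu * W0)).
  rewrite (_ : _ - _ = (F ^+ al - fC (ga ^+ al) * 'x_0 ^+ al) * (gB ^+ mu * fsubst qc [tuple fB]) +
     fC (ga ^+ al) * ('x_0 ^+ al * ((gB ^+ mu - fC (r ^+ mu) * 'x_2 ^+ mu) * fsubst qc [tuple fB])) +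
     fC (ga ^+ al) * (fC (r ^+ mu) * ('x_0 ^+ al * ('x_2 ^+ mu * (fsubst qc [tuple fB] - W0))))); last first.
    by rewrite fCM; move: (fC (ga ^+ al)) (fC (r ^+ mu)) => u v; ring.
  apply: suppD; first apply: suppD.
  - have h := suppM (supp_tauX mu hgB) hW1 (S'' := fun b c => b = 0 /\ mu <= c)%N.
    by apply: suppM (@inv_FX al) (h _) _; slia.
  - apply: suppC; have h := suppM (@inv_gBX mu) hW1 (S'' := fun b c => b = 0 /\ mu + 1 <= c)%N.
    by apply: suppM (supp_x0X R al) (h _) _; slia.
  - do 2! apply: suppC; have h := suppM (supp_x2X R mu) hW (S'' := fun b c => b = 0 /\ mu + 1 <= c)%N.
    by apply: suppM (supp_x0X R al) (h _) _; slia.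
have key : supp (fun b c => b = 0%N \/ not_le al mu b c)
   (fC r * Q' - fC (ga ^+ al * r ^+ mu) * ('x_0 ^+ al * 'x_2 ^+ mu * W0)).
  rewrite (_ : _ - _ = - (fsubst T.2 [tuple 'x_0; Q'] - fC r * Q') + gB + (F ^+ al * gB ^+ mu * fsubst qc [tuple fB] -
    fC (ga ^+ al * r ^+ mu) * ('x_0 ^+ al * 'x_2 ^+ mu * W0)) + fsubst (Q - 'x_2 - leadpart Q al mu) [tuple F; fB; gB]); last first.
    by rewrite e; ring.
  apply: suppD; last by apply: supp_sub hrest _; slia.
  apply: suppD; last by apply: supp_sub hmain _; slia.
  apply: suppD; last by apply: supp_sub hgB _; slia.
  by apply: suppN; apply: inv_LHS.
apply: fpsP => m; have [j ->] := tuple1P m; rewrite !fcf_CM coefchiE.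
apply/eqP; rewrite -subr_eq0; apply/eqP.
have : (fC r * Q' - fC (ga ^+ al * r ^+ mu) * ('x_0 ^+ al * 'x_2 ^+ mu * W0)) [tuple al; j; mu] = 0.
  by apply: contrapT => /key; slia.
rewrite fcfB !fcf_CM; have := @coef_shift R W0 0 j 0 al mu; rewrite !addn0 => ->.
by rewrite /W0 coef_x1.
Qed.

End InvLead.
End Lead.

(** * Transitions close to the identity: moving the curve *)
Section Level.
Variables (R : realType).
Local Notation C := R[i].
Local Notation A := (fps R 3).

(** Below level [k] the map is the identity. The curve [z = 0] is separated from
    the rest: [k' = k] before, and [k' = k.+1] after its coefficient of level [k]
    is known to vanish. The second component is only prescribed along [z = 0],
    the rest being determined by [base]. *)
Record near_id (T : fps R 2 * fps R 2) (k k' : nat) : Prop := NearId {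
  ni_F : forall b c, (c < k)%N -> T.1 [tuple b; c] = ((b == 1%N) && (c == 0%N))%:R;
  ni_F0 : forall c, (c < k')%N -> T.1 [tuple 0%N; c] = 0;
  ni_G0 : forall c, (c <= k)%N -> T.2 [tuple 0%N; c] = (c == 1%N)%:R }.

Lemma coef_var2_0 b c : ('x_0 : fps R 2) [tuple b; c] = ((b == 1%N) && (c == 0%N))%:R.
Proof.
rewrite /fvar munit2E // (_ : ([tuple b; c] == _) = (b == 1%N) && (c == 0%N)) //.
by apply/eqP/andP => [[-> ->]|[/eqP -> /eqP ->]].
Qed.
Lemma coef_var2_1 b c : ('x_1 : fps R 2) [tuple b; c] = ((b == 0%N) && (c == 1%N))%:R.
Proof.
rewrite /fvar munit2E // (_ : ([tuple b; c] == _) = (b == 0%N) && (c == 1%N)) //.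
by apply/eqP/andP => [[-> ->]|[/eqP -> /eqP ->]].
Qed.

Lemma coef_var2_1X b c k : ('x_1 ^+ k : fps R 2) [tuple b; c] = ((b == 0%N) && (c == k))%:R.
Proof.
rewrite -[_ ^+ k]mul1r -(expr0 'x_0) -gmon2 -vars2 gmon_vars /mon.
rewrite (_ : ([tuple b; c] == _) = (b == 0%N) && (c == k)) //.
by apply/eqP/andP => [[-> ->]|[/eqP -> /eqP ->]].
Qed.

Section Common.
(* All lemmas of this section take the same arguments. *)
Set Default Proof Using "All".
Variables (T : fps R 2 * fps R 2) (Q Q' : A) (al mu k k' : nat).
Hypotheses (t1 : zc T.1) (t2 : zc T.2) (nQ : normal_Q Q) (nQ' : normal_Q Q') (bQ : base T Q).
Hypothesis (tr : trans T Q Q').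
Hypotheses (al1 : (1 <= al)%N) (N2 : (2 <= al + mu)%N).
Hypothesis hQ : supp (not_below al mu 1) (Q - 'x_2).
Hypotheses (k1 : (1 <= k)%N) (kk : (k <= k')%N) (kk1 : (k' <= k.+1)%N).
Hypothesis hT : near_id T k k'.
Let k'1 : (1 <= k')%N := leq_trans k1 kk.

Let q := Q' - 'x_2.
Let F := fsubst T.1 [tuple 'x_0; Q'] : A.
Let fB := fsubst (fconj T.1) [tuple 'x_1; 'x_2] : A.
Let gB := fsubst (fconj T.2) [tuple 'x_1; 'x_2] : A.
Let hF0 := ni_F0 hT.

Lemma lev_r : T.2 [tuple 0%N; 1%N] = 1. Proof. by rewrite (ni_G0 hT). Qed.

Let hq : supp (not_below al mu 1) q.
Proof. by apply: (supp_trans t1 t2 nQ bQ al1 N2 k'1 hQ hF0 nQ' tr); rewrite lev_r; apply/eqP; rewrite oner_neq0. Qed.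

Let zq : zc q.
Proof. by have := normalQ_zc nQ'; rewrite /q => h; zc_tac. Qed.
Let Q'E : 'x_2 + q = Q'.
Proof. by rewrite /q addrC subrK. Qed.
Let zQ := normalQ_zc nQ.
Let zQ' := normalQ_zc nQ'.
Let z0 := @zcvar R 3 (inord 0).
Let z1 := @zcvar R 3 (inord 1).
Let z2 := @zcvar R 3 (inord 2).

(** The support of [F - z] for the first component [F] of the transition; the
    terms beyond the first come from the powers of [Q'] in [F (z, Q')]. *)
Definition moved_supp (b c : nat) : Prop := ((k <= c)%N /\ (b = 0%N -> (k' <= c)%N)) \/ not_below al mu k' b c \/
  ((2 <= b)%N /\ not_below al mu k b.-1 c).

Lemma lev_coefF b c : (T.1 - 'x_0) [tuple b; c] <> 0 -> (k <= c)%N /\ (b = 0%N -> (k' <= c)%N).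
Proof.
rewrite fcfB coef_var2_0 => h; split.
  by rewrite leqNgt; apply/negP => hc; apply: h; rewrite (ni_F hT) // subrr.
move=> b0; rewrite leqNgt; apply/negP => hc; apply: h; rewrite b0 (ni_F0 hT) //= subrr //.
Qed.

Lemma supp_monQ (S : nat -> nat -> Prop) b c : S b c ->
  (forall b' c', not_below al mu c b' c' -> S (b + b')%N c') -> supp S ('x_0 ^+ b * Q' ^+ c).
Proof.
move=> h1 h2; rewrite -Q'E (_ : _ * _ = 'x_0 ^+ b * (('x_2 + q) ^+ c - 'x_2 ^+ c) + 'x_0 ^+ b * 'x_2 ^+ c); last by ring.
have hp := supp_Qpow c N2 al1 hq.
apply: suppD; first by apply: suppM (supp_x0X R b) hp _ => ? ? ? ? [-> ->] /h2.
by apply: suppM (supp_x0X R b) (supp_x2X R c) _ => ? ? ? ? [-> ->] [-> ->]; rewrite addn0.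
Qed.

Lemma supp_X : supp moved_supp (F - 'x_0).
Proof.
have -> : F - 'x_0 = fsubst (T.1 - 'x_0) [tuple 'x_0; Q'] by rewrite /F; fs.
apply: supp_subst2 => b c /lev_coefF hbc; apply: supp_monQ; first by left.
by move=> b' c'; rewrite /moved_supp; slia.
Qed.

Lemma supp_F1 : supp (fun b c => 1 <= b + c)%N F.
Proof. by rewrite /F -Q'E; apply: (supp_Fq t1 zq hq). Qed.

Lemma supp_FX e : supp (fun b c => exists b0 c0, moved_supp b0 c0 /\ (b0 + c0 + e <= b + c + 1)%N /\ (c0 <= c)%N)
   (F ^+ e - 'x_0 ^+ e).
Proof.
case: e => [|e]; first by rewrite subrr.
rewrite subrXX; apply: (@suppM _ _ (fun b c => e <= b + c)%N _ _ _ supp_X); last first.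
  by move=> b c b' c' h h'; exists b, c; split=> //; lia.
apply: supp_sum => -[i hi] /=; apply: suppM (supp_geX (e - i) supp_F1) (supp_x0X R i) _; slia.
Qed.

Lemma supp_fB : supp (fun b c => b = 0%N) fB. Proof. exact: supp_chi. Qed.

Lemma supp_Y : supp (fun b c => b = 0 /\ k <= c)%N (fB - 'x_1).
Proof.
have -> : fB - 'x_1 = fsubst (fconj (T.1 - 'x_0)) [tuple 'x_1; 'x_2].
  rewrite /fB fconjD fconjN fconj_var; fs; by [].
apply: supp_subst2 => b c hbc.
have [hc _] : (k <= c)%N /\ (b = 0%N -> (k' <= c)%N).
  by apply: (@lev_coefF b) => e; apply: hbc; rewrite /fconj e conjc0.
apply: suppM (supp_x1X R b) (supp_x2X R c) _; slia.
Qed.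

Lemma supp_yX e : supp (fun b c => b = 0 /\ k <= c)%N (fB ^+ e - 'x_1 ^+ e).
Proof.
rewrite subrXX; apply: (@suppM _ _ (fun b c => b = 0%N) _ _ _ supp_Y); last by slia.
apply: supp_sum => i; apply: suppM (supp_chiX _ supp_fB) (supp_x1X R i) _; slia.
Qed.

Lemma supp_t : supp (fun b c => b = 0 /\ 1 <= c)%N gB.
Proof. exact: (supp_gB t1 t2 nQ bQ al1 N2 k'1 hQ hF0). Qed.

Lemma supp_T0 : supp (fun b c => b = 0 /\ k + 1 <= c)%N (gB - 'x_2).
Proof.
rewrite (_ : _ - _ = (fsubst T.2 [tuple 0; 'x_2] - 'x_2) - (fsubst T.2 [tuple 0; 'x_2] - gB)); last by ring.
apply: suppB; last by apply: supp_sub (supp_GB t1 t2 nQ bQ al1 N2 k'1 hQ hF0) _; slia.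
have -> : fsubst T.2 [tuple 0; 'x_2] - 'x_2 = fsubst (T.2 - 'x_1) [tuple 0; 'x_2] :> A by fs.
apply: supp_at0 => c hc; rewrite fcfB coef_var2_1 /= (ni_G0 hT) ?subrr //; lia.
Qed.

Lemma supp_tX e : supp (fun b c => b = 0 /\ k + e <= c)%N (gB ^+ e - 'x_2 ^+ e).
Proof.
case: e => [|e]; first by rewrite subrr.
rewrite subrXX; apply: (@suppM _ _ (fun b c => b = 0 /\ e <= c)%N _ _ _ supp_T0); last by slia.
apply: supp_sum => -[i hi] /=; apply: suppM (supp_tauX (e - i) supp_t) (supp_x2X R i) _; slia.
Qed.

(** Monomials of [Q - tau] other than the leading ones move too little to be
    seen below the pair reached by the leading ones. *)
Lemma supp_far (S : nat -> nat -> Prop) :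
  (forall b c b0 c0 x y : nat, (1 <= b)%N -> not_below al mu 1 b c -> not_le al mu b c -> moved_supp b0 c0 ->
     (b0 + c0 + b + c <= x + y + 1)%N -> (c0 + c <= y)%N -> S x y) ->
  (forall b c y : nat, (1 <= b)%N -> not_below al mu 1 b c -> not_le al mu b c -> (k + c <= y)%N -> S b y) ->
  supp S (fsubst (Q - 'x_2 - leadpart Q al mu) [tuple F; fB; gB] - (Q - 'x_2 - leadpart Q al mu)).
Proof.
move=> h1 h2; rewrite -[X in _ - X]fsubst_id3; apply: supp_subst3B => b i c hbc.
have hU : not_below al mu 1 b c.
  apply: (suppB hQ (S := not_below al mu 1) _ hbc); apply: supp_sub (@supp_lead _ Q al mu) _; slia.
have [b1 hn] := supp_rest al1 hQ hbc.
rewrite (_ : _ - _ = (F ^+ b - 'x_0 ^+ b) * (fB ^+ i * gB ^+ c) +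
   'x_0 ^+ b * ((fB ^+ i - 'x_1 ^+ i) * gB ^+ c) + 'x_0 ^+ b * ('x_1 ^+ i * (gB ^+ c - 'x_2 ^+ c))); last by ring.
apply: suppD; first apply: suppD.
- have h := suppM (supp_chiX i supp_fB) (supp_tauX c supp_t) (S'' := fun b' c' => b' = 0 /\ c <= c')%N.
  apply: suppM (@supp_FX b) (h _) _; first by slia.
  move=> x y x' y' [b0 [c0 [hX [e1 e2]]]] [-> e3]; apply: (h1 b c b0 c0) => //; lia.
- have h := suppM (@supp_yX i) (supp_tauX c supp_t) (S'' := fun b' c' => b' = 0 /\ k + c <= c')%N.
  apply: suppM (supp_x0X R b) (h _) _; first by slia.
  by move=> x y x' y' [-> ->] [-> e]; rewrite addn0; apply: (h2 b c).
- have h := suppM (supp_x1X R i) (@supp_tX c) (S'' := fun b' c' => b' = 0 /\ k + c <= c')%N.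
  apply: suppM (supp_x0X R b) (h _) _; first by slia.
  by move=> x y x' y' [-> ->] [-> e]; rewrite addn0; apply: (h2 b c).
Qed.

Let qc := coefchi Q al mu.
Let W0 : A := fsubst qc [tuple 'x_1].
Let W : A := fsubst qc [tuple fB].

Lemma supp_W : supp (fun b c => b = 0%N) W. Proof. exact: supp_qc0 supp_fB. Qed.
Lemma supp_WB : supp (fun b c => b = 0 /\ k <= c)%N (W - W0).
Proof.
apply: supp_qcB; [exact: supp_fB| |exact: supp_Y].
by apply: supp_sub (supp_x1 R) _; slia.
Qed.

(** The transition equation with the leading part of [Q] split off on both
    sides, so that every term is a difference. *)
Lemma lev_eq : fsubst T.2 [tuple 'x_0; Q'] - gB - (Q - 'x_2) =
  (F ^+ al * gB ^+ mu * W - 'x_0 ^+ al * 'x_2 ^+ mu * W0) +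
  (fsubst (Q - 'x_2 - leadpart Q al mu) [tuple F; fB; gB] - (Q - 'x_2 - leadpart Q al mu)).
Proof.
have zF : zc F by rewrite /F; zc_tac.
have zfB : zc fB by rewrite /fB; zc_tac.
have zgB : zc gB by rewrite /gB; zc_tac.
have e := tr; rewrite /trans -/F -/fB -/gB (@Q_split R Q F fB gB) in e; last by zc_tac.
rewrite (subst_lead Q al mu) // -/qc -/W in e; rewrite e /leadpart -/qc -/W0; ring.
Qed.

Lemma lev_coefG0 c : (T.2 - 'x_1) [tuple 0%N; c] <> 0 -> (k < c)%N.
Proof.
rewrite fcfB coef_var2_1 /= => h; rewrite ltnNge; apply/negP => hc; apply: h.
by rewrite (ni_G0 hT) // subrr.
Qed.

Lemma lev_coefG b c : (1 <= b)%N -> (T.2 - 'x_1) [tuple b; c] <> 0 -> not_below_w al mu k' b c.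
Proof.
move=> b1 h; apply: (coef_GA t1 t2 nQ bQ al1 N2 k'1 hQ hF0 b1) => e; apply: h.
by rewrite fcfB coef_var2_1 e; case: b b1 {e} => // b _; rewrite subrr.
Qed.

End Common.
Unset Default Proof Using.

Section LevelB.
Variables (T : fps R 2 * fps R 2) (Q Q' : A) (al mu k : nat).
Hypotheses (t1 : zc T.1) (t2 : zc T.2) (nQ : normal_Q Q) (nQ' : normal_Q Q') (bQ : base T Q).
Hypothesis (tr : trans T Q Q').
Hypotheses (al1 : (1 <= al)%N) (N2 : (2 <= al + mu)%N).
Hypothesis hQ : supp (not_below al mu 1) (Q - 'x_2).
Hypotheses (k1 : (1 <= k)%N).
Hypothesis hT : near_id T k k.
Let kk : (k <= k)%N := leqnn k.
Let kk1 : (k <= k.+1)%N := leqnSn k.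
Let F := fsubst T.1 [tuple 'x_0; Q'] : A.
Let fB := fsubst (fconj T.1) [tuple 'x_1; 'x_2] : A.
Let gB := fsubst (fconj T.2) [tuple 'x_1; 'x_2] : A.
Let a := T.1 [tuple 0%N; k].
Let zQ' := normalQ_zc nQ'.
Let z0 := @zcvar R 3 (inord 0).

Let hX := supp_X t1 t2 nQ nQ' bQ tr al1 N2 hQ k1 kk kk1 hT.
Let hmonQ := supp_monQ t1 t2 nQ nQ' bQ tr al1 N2 hQ k1 kk kk1 hT.
Let hF1 := supp_F1 t1 t2 nQ nQ' bQ tr al1 N2 hQ k1 kk kk1 hT.

Lemma levb_X3 : supp (fun b c => k + 1 <= b + c)%N (F - 'x_0 - fC a * 'x_2 ^+ k).
Proof.
have -> : F - 'x_0 - fC a * 'x_2 ^+ k = fsubst (T.1 - 'x_0 - fC a * 'x_1 ^+ k) [tuple 'x_0; Q'] +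
    fC a * (Q' ^+ k - 'x_2 ^+ k) by rewrite /F; fs; ring.
apply: suppD; last first.
  apply: suppC; rewrite (_ : Q' ^+ k = 'x_0 ^+ 0 * Q' ^+ k); last by rewrite mul1r.
  have -> : Q' = 'x_2 + (Q' - 'x_2) by ring.
  rewrite mul1r; have hr : T.2 [tuple 0%N; 1%N] <> 0 by rewrite (lev_r t1 t2 nQ nQ' bQ tr al1 N2 hQ k1 kk kk1 hT); apply/eqP; rewrite oner_neq0.
  have hq := supp_trans t1 t2 nQ bQ al1 N2 k1 hQ (ni_F0 hT) nQ' tr hr.
  by apply: supp_sub (supp_Qpow k N2 al1 hq) _; slia.
apply: supp_subst2 => b c hbc.
have [hc hb] : (k <= c)%N /\ ~ (b = 0 /\ c = k)%N.
  split; last first.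
    move=> [e1 e2]; apply: hbc; rewrite e1 e2 fcfB fcf_CM fcfB coef_var2_0 coef_var2_1X !eqxx /= subr0 -/a mulr1 subrr //.
  rewrite leqNgt; apply/negP => hc; apply: hbc; rewrite fcfB fcf_CM fcfB coef_var2_0 (ni_F hT) // subrr.
  by rewrite coef_var2_1X (ltn_eqF hc) andbF mulr0 subrr.
by apply: hmonQ; slia.
Qed.

Lemma levb_FX e : supp (not_le e.-1 k) (F ^+ e - 'x_0 ^+ e - fC a * ('x_0 ^+ e.-1 * 'x_2 ^+ k) *+ e).
Proof.
elim: e => [|e IH]; first by rewrite !expr0 mulr0n subrr subr0.
rewrite (_ : _ - _ = F * (F ^+ e - 'x_0 ^+ e - fC a * ('x_0 ^+ e.-1 * 'x_2 ^+ k) *+ e) +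
  (F - 'x_0 - fC a * 'x_2 ^+ k) * 'x_0 ^+ e +
  fC a * ((F - 'x_0) * ('x_0 ^+ e.-1 * 'x_2 ^+ k) *+ e)); last first.
  case: e {IH} => [|e] /=; first by rewrite !mulr0n !expr0 !expr1 !mulr0 ; ring.
  by rewrite !exprS; ring.
apply: suppD; first apply: suppD.
- case: e IH => [|e] /= IH; first by rewrite !expr0 mulr0n subrr subr0 mulr0.
  by apply: suppM hF1 IH _; slia.
- by apply: suppM levb_X3 (supp_x0X R e) _; slia.
- apply: suppC; case: e {IH} => [|e] //=; apply: suppMn.
  have h := suppM (supp_x0X R e) (supp_x2X R k) (S'' := fun b c => b = e /\ c = k)%N.
  by apply: suppM hX (h _) _; [slia|rewrite /moved_supp; slia].
Qed.

(** The leading term contributes [(z + a tau^k)^al tau^mu q (chi)], whose first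
    new monomial is at the pair [(al - 1, mu + k)]; no other change is below or
    equal to that pair. *)
Lemma level_curve b i c : (1 <= b)%N -> (b + c <= al.-1 + (mu + k))%N -> (c <= mu + k)%N ->
  Q' [tuple b; i; c] = Q [tuple b; i; c] +
    (if (b == al.-1) && (c == mu + k)%N then a * Q [tuple al; i; mu] *+ al else 0).
Proof.
move=> b1 hb hc.
pose W0 : A := fsubst (coefchi Q al mu) [tuple 'x_1].
pose W : A := fsubst (coefchi Q al mu) [tuple fB].
pose M : A := fC a * ('x_0 ^+ al.-1 * 'x_2 ^+ (mu + k)%N * W0) *+ al.
have hW : supp (fun b c => b = 0%N) W by exact: (supp_W t1 t2 nQ nQ' bQ tr al1 N2 hQ k1 kk kk1 hT).
have hWB : supp (fun b c => b = 0 /\ k <= c)%N (W - W0) := supp_WB t1 t2 nQ nQ' bQ tr al1 N2 hQ k1 kk kk1 hT.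
have ht : supp (fun b c => b = 0 /\ 1 <= c)%N gB := supp_t t1 t2 nQ nQ' bQ tr al1 N2 hQ k1 kk kk1 hT.
have htX : supp (fun b c => b = 0 /\ k + mu <= c)%N (gB ^+ mu - 'x_2 ^+ mu) := (fun mu => supp_tX t1 t2 nQ nQ' bQ tr al1 N2 hQ k1 kk kk1 hT (e := mu)) mu.
have hnear : supp (not_le al.-1 (mu + k)) (F ^+ al * gB ^+ mu * W - 'x_0 ^+ al * 'x_2 ^+ mu * W0 - M).
  rewrite (_ : _ - _ = (F ^+ al - 'x_0 ^+ al - fC a * ('x_0 ^+ al.-1 * 'x_2 ^+ k) *+ al) * (gB ^+ mu * W) +
    'x_0 ^+ al * ((gB ^+ mu - 'x_2 ^+ mu) * W + 'x_2 ^+ mu * (W - W0)) +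
    fC a * ('x_0 ^+ al.-1 * ('x_2 ^+ k * ((gB ^+ mu - 'x_2 ^+ mu) * W + 'x_2 ^+ mu * (W - W0)))) *+ al); last first.
    by rewrite /M exprD; ring.
  have hin : supp (fun b c => b = 0 /\ k + mu <= c)%N ((gB ^+ mu - 'x_2 ^+ mu) * W + 'x_2 ^+ mu * (W - W0)).
    by apply: suppD; [apply: suppM htX hW _|apply: suppM (supp_x2X R mu) hWB _]; slia.
  apply: suppD; first apply: suppD.
  - have h := suppM (supp_tauX mu ht) hW (S'' := fun b c => b = 0 /\ mu <= c)%N.
    by apply: suppM (@levb_FX al) (h _) _; slia.
  - by apply: suppM (supp_x0X R al) hin _; slia.
  - apply: suppMn; apply: suppC.
    have h := suppM (supp_x2X R k) hin (S'' := fun b c => b = 0 /\ k + k + mu <= c)%N.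
    by apply: suppM (supp_x0X R al.-1) (h _) _; slia.
have hfar := supp_far t1 t2 nQ nQ' bQ tr al1 N2 hQ k1 kk kk1 hT (S := not_le al.-1 (mu + k)).
have hL : supp (fun b c => b = 0%N \/ not_le al.-1 (mu + k) b c) (fsubst T.2 [tuple 'x_0; Q'] - Q').
  have -> : fsubst T.2 [tuple 'x_0; Q'] - Q' = fsubst (T.2 - 'x_1) [tuple 'x_0; Q'] by fs.
  apply: supp_subst2 => b' c' hbc.
  have [b0|b0] := posnP b'.
    rewrite b0 in hbc *; have hc' := lev_coefG0 t1 t2 nQ nQ' bQ tr al1 N2 hQ k1 kk kk1 hT hbc.
    by apply: hmonQ; slia.
  have hG := lev_coefG t1 t2 nQ nQ' bQ tr al1 N2 hQ k1 kk kk1 hT b0 hbc.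
  by apply: hmonQ; slia.
have key : supp (fun b c => b = 0%N \/ not_le al.-1 (mu + k) b c) (Q' - (Q - 'x_2) - M).
  have e := lev_eq t1 t2 nQ nQ' bQ tr al1 N2 hQ k1 kk kk1 hT.
  rewrite (_ : _ - M = - (fsubst T.2 [tuple 'x_0; Q'] - Q') + gB + ((F ^+ al * gB ^+ mu * W - 'x_0 ^+ al * 'x_2 ^+ mu * W0 - M) +
     (fsubst (Q - 'x_2 - leadpart Q al mu) [tuple F; fB; gB] - (Q - 'x_2 - leadpart Q al mu)))); last first.
    rewrite -/F -/fB -/gB -/W -/W0 in e.
    rewrite [X in _ = _ + X]addrAC -e; ring.
  apply: suppD; first apply: suppD.
  - exact: suppN.
  - by apply: supp_sub ht _; slia.
  - apply: suppD; first by apply: supp_sub hnear _; slia.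
    apply: supp_sub (hfar _ _) _; last by slia.
      by rewrite /moved_supp; slia.
    by slia.
have : (Q' - (Q - 'x_2) - M) [tuple b; i; c] = 0.
  by apply: contrapT => /key; slia.
rewrite fcfB fcfB fcfB coef_x2 // subr0 => /eqP; rewrite subr_eq0 subr_eq => /eqP ->.
rewrite addrC; congr (_ + _); rewrite /M fcfMn fcf_CM.
case: ifP => [/andP[/eqP -> /eqP ->]|hne].
  by have := @coef_shift R W0 0 i 0 al.-1 (mu + k); rewrite !addn0 /W0 coef_x1 /= => ->.
suff -> : ('x_0 ^+ al.-1 * 'x_2 ^+ (mu + k)%N * W0) [tuple b; i; c] = 0 by rewrite mulr0 mul0rn.
apply: contrapT => h.
have h1 := suppM (supp_x0X R al.-1) (supp_x2X R (mu + k)) (S'' := fun b c => b = al.-1 /\ c = mu + k)%N.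
have h2 : supp (fun b c => b = al.-1 /\ c = mu + k)%N ('x_0 ^+ al.-1 * 'x_2 ^+ (mu + k)%N * W0).
  by apply: suppM (h1 _) (@supp_qc _ _) _; slia.
by case: (h2 _ _ _ h) => e1 e2; rewrite e1 e2 !eqxx in hne.
Qed.

End LevelB.
End Level.

(** * Transitions close to the identity: the curve fixed *)
Section LevelC.
Variables (R : realType).
Local Notation C := R[i].
Local Notation A := (fps R 3).

Lemma coef_var2_01X b c k : ('x_0 * 'x_1 ^+ k : fps R 2) [tuple b; c] = ((b == 1%N) && (c == k))%:R.
Proof.
rewrite -[X in X * _]expr1 -gmon2 -vars2 gmon_vars /mon.
rewrite (_ : ([tuple b; c] == _) = (b == 1%N) && (c == k)) //.
by apply/eqP/andP => [[-> ->]|[/eqP -> /eqP ->]].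
Qed.

(** Every term of the remainder has at least two factors [q]. *)
Lemma supp_Qpow2 al mu (q : A) j : (2 <= al + mu)%N -> (1 <= al)%N -> supp (not_below al mu 1) q ->
  supp (fun b c => (1 <= b)%N /\ ~ ((b + c + 1 <= al + mu + j)%N /\ (c + 1 <= mu + j)%N))
    (('x_2 + q) ^+ j - 'x_2 ^+ j - 'x_2 ^+ j.-1 * q *+ j).
Proof.
move=> N2 al1 hq; elim: j => [|j IH]; first by rewrite !expr0 mulr0n subrr subr0.
rewrite (_ : _ - _ = ('x_2 + q) * (('x_2 + q) ^+ j - 'x_2 ^+ j - 'x_2 ^+ j.-1 * q *+ j) +
  'x_2 ^+ j.-1 * (q * q) *+ j); last first.
  case: j {IH} => [|j] /=; first by rewrite !expr0 !expr1 !mulr0n; ring.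
  by rewrite !exprS; ring.
apply: suppD.
  rewrite mulrDl; apply: suppD.
    by apply: suppM (supp_x2 R) IH _; slia.
  by apply: suppM hq IH _; slia.
case: j {IH} => [|j] //=; apply: suppMn.
have h := suppM hq hq (S'' := fun b c => (1 <= b)%N /\ ~ ((b + c <= al + mu + 1)%N /\ (c <= mu + 1)%N)).
by apply: suppM (supp_x2X R j) (h _) _; slia.
Qed.

Variables (T : fps R 2 * fps R 2) (Q Q' : A) (al mu k : nat).
Hypotheses (t1 : zc T.1) (t2 : zc T.2) (nQ : normal_Q Q) (nQ' : normal_Q Q') (bQ : base T Q).
Hypothesis (tr : trans T Q Q').
Hypotheses (al1 : (1 <= al)%N) (N2 : (2 <= al + mu)%N).
Hypothesis hQ : supp (not_below al mu 1) (Q - 'x_2).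
Hypotheses (k1 : (1 <= k)%N).
Hypothesis hT : near_id T k k.+1.
Let kk : (k <= k.+1)%N := leqnSn k.
Let kk1 : (k.+1 <= k.+1)%N := leqnn k.+1.
Let F := fsubst T.1 [tuple 'x_0; Q'] : A.
Let fB := fsubst (fconj T.1) [tuple 'x_1; 'x_2] : A.
Let gB := fsubst (fconj T.2) [tuple 'x_1; 'x_2] : A.
Let f1 := T.1 [tuple 1%N; k].
Let g := T.2 [tuple 0%N; k.+1].
Let zQ' := normalQ_zc nQ'.
Let z0 := @zcvar R 3 (inord 0).
Let z1 := @zcvar R 3 (inord 1).
Let z2 := @zcvar R 3 (inord 2).

Let hX := supp_X t1 t2 nQ nQ' bQ tr al1 N2 hQ k1 kk kk1 hT.
Let hmonQ := supp_monQ t1 t2 nQ nQ' bQ tr al1 N2 hQ k1 kk kk1 hT.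
Let hF1 := supp_F1 t1 t2 nQ nQ' bQ tr al1 N2 hQ k1 kk kk1 hT.

Let hq : supp (not_below al mu 1) (Q' - 'x_2).
Proof.
have hr : T.2 [tuple 0%N; 1%N] <> 0.
  by rewrite (ni_G0 hT) //; apply/eqP; rewrite oner_neq0.
exact: (supp_trans t1 t2 nQ bQ al1 N2 (ltn0Sn k) hQ (ni_F0 hT) nQ' tr hr).
Qed.
Let Q'E : 'x_2 + (Q' - 'x_2) = Q'.
Proof. by rewrite addrC subrK. Qed.

Lemma levc_X3 : supp (not_le 1 k) (F - 'x_0 - fC f1 * ('x_0 * 'x_2 ^+ k)).
Proof.
have -> : F - 'x_0 - fC f1 * ('x_0 * 'x_2 ^+ k) =
    fsubst (T.1 - 'x_0 - fC f1 * ('x_0 * 'x_1 ^+ k)) [tuple 'x_0; Q'] +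
    fC f1 * ('x_0 * (Q' ^+ k - 'x_2 ^+ k)) by rewrite /F; fs; ring.
apply: suppD; last first.
  apply: suppC; rewrite -{1}Q'E.
  by apply: suppM (supp_x0 R) (supp_Qpow k N2 al1 hq) _; slia.
apply: supp_subst2 => b c; rewrite fcfB fcf_CM fcfB coef_var2_0 coef_var2_01X => hbc.
have hc : (k <= c)%N.
  rewrite leqNgt; apply/negP => hc; apply: hbc; rewrite (ni_F hT) // (ltn_eqF hc) andbF mulr0 subr0.
  by rewrite subrr.
have hb : (c <= k)%N -> (2 <= b)%N.
  move=> hck; have ek : c = k by apply/eqP; rewrite eqn_leq hck.
  case: b hbc => [|[|//]]; rewrite ek /=; case.
    by rewrite (ni_F0 hT) // mulr0 !subr0.
  by rewrite (eqxx k) mulr1 -/f1 eqn0Ngt k1 subr0 subrr.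
by apply: hmonQ; slia.
Qed.

Lemma levc_FX e : supp (not_le e k) (F ^+ e - 'x_0 ^+ e - fC f1 * ('x_0 ^+ e * 'x_2 ^+ k) *+ e).
Proof.
elim: e => [|e IH]; first by rewrite !expr0 mulr0n subrr subr0.
rewrite (_ : _ - _ = F * (F ^+ e - 'x_0 ^+ e - fC f1 * ('x_0 ^+ e * 'x_2 ^+ k) *+ e) +
  (F - 'x_0 - fC f1 * ('x_0 * 'x_2 ^+ k)) * 'x_0 ^+ e +
  fC f1 * ((F - 'x_0) * ('x_0 ^+ e * 'x_2 ^+ k) *+ e)); last by rewrite !exprS; ring.
apply: suppD; first apply: suppD.
- by apply: suppM hF1 IH _; slia.
- by apply: suppM levc_X3 (supp_x0X R e) _; slia.
- apply: suppC; apply: suppMn.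
  have h := suppM (supp_x0X R e) (supp_x2X R k) (S'' := fun b c => b = e /\ c = k)%N.
  by apply: suppM hX (h _) _; [slia|rewrite /moved_supp; slia].
Qed.

Let ht : supp (fun b c => b = 0 /\ 1 <= c)%N gB := supp_t t1 t2 nQ nQ' bQ tr al1 N2 hQ k1 kk kk1 hT.
Let ht0 : supp (fun b c => b = 0 /\ k + 1 <= c)%N (gB - 'x_2) :=
  supp_T0 t1 t2 nQ nQ' bQ tr al1 N2 hQ k1 kk kk1 hT.

Lemma levc_T3 : supp (fun b c => b = 0 /\ k + 2 <= c)%N (gB - 'x_2 - fC g * 'x_2 ^+ k.+1).
Proof.
rewrite (_ : _ - _ = (fsubst T.2 [tuple 0; 'x_2] - 'x_2 - fC g * 'x_2 ^+ k.+1) - (fsubst T.2 [tuple 0; 'x_2] - gB)); last by ring.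
apply: suppB; last by apply: supp_sub (supp_GB t1 t2 nQ bQ al1 N2 (ltn0Sn k) hQ (ni_F0 hT)) _; slia.
have -> : fsubst T.2 [tuple 0; 'x_2] - 'x_2 - fC g * 'x_2 ^+ k.+1 =
  fsubst (T.2 - 'x_1 - fC g * 'x_1 ^+ k.+1) [tuple 0; 'x_2] :> A by fs.
apply: supp_at0 => c hc; rewrite fcfB fcf_CM fcfB coef_var2_1 coef_var2_1X /=.
have [->|ne] := eqVneq c k.+1; first by rewrite -/g mulr1 eqSS eqn0Ngt k1 subr0 subrr.
by rewrite mulr0 subr0 (ni_G0 hT) ?subrr //; lia.
Qed.

Lemma levc_tX e : supp (fun b c => b = 0 /\ k + e + 1 <= c)%N
   (gB ^+ e - 'x_2 ^+ e - fC g * 'x_2 ^+ (k + e) *+ e).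
Proof.
elim: e => [|e IH]; first by rewrite !expr0 mulr0n subrr subr0.
rewrite (_ : _ - _ = gB * (gB ^+ e - 'x_2 ^+ e - fC g * 'x_2 ^+ (k + e) *+ e) +
  (gB - 'x_2 - fC g * 'x_2 ^+ k.+1) * 'x_2 ^+ e +
  fC g * ((gB - 'x_2) * 'x_2 ^+ (k + e)%N *+ e)); last by rewrite addnS !exprS exprD; ring.
apply: suppD; first apply: suppD.
- by apply: suppM ht IH _; slia.
- by apply: suppM levc_T3 (supp_x2X R e) _; slia.
- by apply: suppC; apply: suppMn; apply: suppM ht0 (supp_x2X R (k + e)) _; slia.
Qed.

Let p0 : fps R 1 := fun m => (T.1 [tuple tnth m ord0; k])^*%C.
Let P0 : A := fsubst p0 [tuple 'x_1].
Let hP0 : supp (fun b c => b = 0 /\ c = 0)%N P0 := @supp_qc _ p0.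
Let hfB : supp (fun b c => b = 0%N) fB := @supp_chi _ _.
Let hY : supp (fun b c => b = 0 /\ k <= c)%N (fB - 'x_1) :=
  supp_Y t1 t2 nQ nQ' bQ tr al1 N2 hQ k1 kk kk1 hT.

Lemma levc_Y3 : supp (fun b c => b = 0 /\ k + 1 <= c)%N (fB - 'x_1 - 'x_2 ^+ k * P0).
Proof.
have hp : supp (fun b c => b = 0 /\ c = k)%N ('x_2 ^+ k * P0).
  by apply: suppM (supp_x2X R k) hP0 _; slia.
move=> b i c h.
have [b0 hc] : b = 0%N /\ (k <= c)%N.
  have hs : supp (fun b c => b = 0 /\ k <= c)%N (fB - 'x_1 - 'x_2 ^+ k * P0).
    by apply: suppB hY _; apply: supp_sub hp _; slia.
  exact: hs h.
split=> //; suff : c <> k by lia.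
move=> ec; apply: h; rewrite b0 ec 2!fcfB /fB coef_x1x2 eqxx.
have := @coef_shift R P0 0 i 0 0 k; rewrite !addn0 expr0 mul1r => ->.
rewrite /P0 coef_x1 /= /fconj /p0.
have -> : ('x_1 : A) [tuple 0%N; i; k] = 0.
  by apply: contrapT => /(supp_x1 R) [_ e]; move: (k1); rewrite e.
by rewrite subr0 subrr.
Qed.

Lemma levc_yX e : supp (fun b c => b = 0 /\ k + 1 <= c)%N
   (fB ^+ e - 'x_1 ^+ e - 'x_2 ^+ k * ('x_1 ^+ e.-1 * P0 *+ e)).
Proof.
elim: e => [|e IH]; first by rewrite !expr0 mulr0n mulr0 subrr subr0.
rewrite (_ : _ - _ = fB * (fB ^+ e - 'x_1 ^+ e - 'x_2 ^+ k * ('x_1 ^+ e.-1 * P0 *+ e)) +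
  (fB - 'x_1 - 'x_2 ^+ k * P0) * 'x_1 ^+ e +
  (fB - 'x_1) * ('x_2 ^+ k * ('x_1 ^+ e.-1 * P0)) *+ e); last first.
  case: e {IH} => [|e] /=; first by rewrite !expr0 !expr1 !mulr0n !mulr0; ring.
  by rewrite !exprS; ring.
apply: suppD; first apply: suppD.
- by apply: suppM hfB IH _; slia.
- by apply: suppM levc_Y3 (supp_x1X R e) _; slia.
- apply: suppMn.
  have h := suppM (supp_x1X R e.-1) hP0 (S'' := fun b c => b = 0 /\ c = 0)%N.
  have h' := suppM (supp_x2X R k) (h _) (S'' := fun b c => b = 0 /\ c = k)%N.
  by apply: suppM hY (h' _ _) _; slia.
Qed.

Let qc := coefchi Q al mu.
Let W0 : A := fsubst qc [tuple 'x_1].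
Let W : A := fsubst qc [tuple fB].

(** The derivative of [q_{al,mu}] times [conj f (chi)], where [f] is the
    coefficient of [w^k] in [F]. *)
Definition dlead : A := fsum (fun l : mindex 1 =>
  fC (qc l) * ('x_1 ^+ (tnth l ord0).-1 * P0 *+ tnth l ord0)).

Lemma dlead_summable : summable (fun l : mindex 1 =>
  fC (qc l) * ('x_1 ^+ (tnth l ord0).-1 * P0 *+ tnth l ord0)).
Proof.
move=> l; apply: fordMr; have -> : mdeg l = tnth l ord0 by rewrite /mdeg big_ord1.
have hf : ford (tnth l ord0).-1 ('x_1 ^+ (tnth l ord0).-1 * P0) by apply: fordMl; apply: fordX.
by move=> m hm; rewrite fcfMn hf // mul0rn.
Qed.

Lemma levc_W3 : supp (fun b c => b = 0 /\ k + 1 <= c)%N (W - W0 - 'x_2 ^+ k * dlead).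
Proof.
have zfB : zct [tuple fB] by rewrite /fB; zc_tac.
have zx1 : zct [tuple 'x_1 : A] by zc_tac.
rewrite /W /W0 /dlead fsumM; last exact: dlead_summable.
have [_ ->] := fsubst_fsum qc zfB; have [_ ->] := fsubst_fsum qc zx1.
rewrite !fsumB; apply: supp_fsum => l; have [e ->] := tuple1P l.
rewrite !gmon1 (_ : tnth [tuple e] ord0 = e) //.
rewrite (_ : _ - _ = fC (qc [tuple e]) * (fB ^+ e - 'x_1 ^+ e - 'x_2 ^+ k * ('x_1 ^+ e.-1 * P0 *+ e))); last by ring.
by apply: suppC; apply: levc_yX.
Qed.

Let M : A := 'x_0 ^+ al * 'x_2 ^+ (mu + k) *
  (fC f1 * W0 *+ al + fC g * W0 *+ mu + dlead).

Lemma levc_near : supp (not_le al (mu + k)) (F ^+ al * gB ^+ mu * W - 'x_0 ^+ al * 'x_2 ^+ mu * W0 - M).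
Proof.
have hW : supp (fun b c => b = 0%N) W by apply: supp_qc0.
have hW0 : supp (fun b c => b = 0 /\ c = 0)%N W0 by apply: supp_qc.
have hWB : supp (fun b c => b = 0 /\ k <= c)%N (W - W0) :=
  supp_WB t1 t2 nQ nQ' bQ tr al1 N2 hQ k1 kk kk1 hT.
have htX : supp (fun b c => b = 0 /\ k + mu <= c)%N (gB ^+ mu - 'x_2 ^+ mu) :=
  (fun mu => supp_tX t1 t2 nQ nQ' bQ tr al1 N2 hQ k1 kk kk1 hT (e := mu)) mu.
rewrite (_ : _ - M = (F ^+ al - 'x_0 ^+ al - fC f1 * ('x_0 ^+ al * 'x_2 ^+ k) *+ al) * (gB ^+ mu * W) +
  'x_0 ^+ al * ((gB ^+ mu - 'x_2 ^+ mu - fC g * 'x_2 ^+ (k + mu) *+ mu) * W) +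
  'x_0 ^+ al * ('x_2 ^+ mu * (W - W0 - 'x_2 ^+ k * dlead)) +
  fC f1 * (('x_0 ^+ al * 'x_2 ^+ k) * ((gB ^+ mu - 'x_2 ^+ mu) * W + 'x_2 ^+ mu * (W - W0)) *+ al) +
  fC g * ('x_0 ^+ al * ('x_2 ^+ (k + mu)%N * (W - W0)) *+ mu)); last first.
  by rewrite /M !exprD; ring.
have h02 := suppM (supp_x0X R al) (supp_x2X R k) (S'' := fun b c => b = al /\ c = k)%N.
have hin : supp (fun b c => b = 0 /\ k + mu <= c)%N ((gB ^+ mu - 'x_2 ^+ mu) * W + 'x_2 ^+ mu * (W - W0)).
  by apply: suppD; [apply: suppM htX hW _|apply: suppM (supp_x2X R mu) hWB _]; slia.
apply: suppD; first apply: suppD; first apply: suppD; first apply: suppD.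
- have h := suppM (supp_tauX mu ht) hW (S'' := fun b c => b = 0 /\ mu <= c)%N.
  by apply: suppM (@levc_FX al) (h _) _; slia.
- have h := suppM (@levc_tX mu) hW (S'' := fun b c => b = 0 /\ k + mu + 1 <= c)%N.
  by apply: suppM (supp_x0X R al) (h _) _; slia.
- have h := suppM (supp_x2X R mu) levc_W3 (S'' := fun b c => b = 0 /\ k + mu + 1 <= c)%N.
  by apply: suppM (supp_x0X R al) (h _) _; slia.
- by apply: suppC; apply: suppMn; apply: suppM (h02 _) hin _; slia.
- apply: suppC; apply: suppMn.
  have h := suppM (supp_x2X R (k + mu)) hWB (S'' := fun b c => b = 0 /\ k + k + mu <= c)%N.
  by apply: suppM (supp_x0X R al) (h _) _; slia.
Qed.

Lemma levc_LHS : supp (fun b c => b = 0%N \/ not_le al (mu + k) b c)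
  (fsubst T.2 [tuple 'x_0; Q'] - Q' - fC g * ('x_2 ^+ k * (Q' - 'x_2)) *+ k.+1).
Proof.
rewrite (_ : _ - _ = fsubst (T.2 - 'x_1 - fC g * 'x_1 ^+ k.+1) [tuple 'x_0; Q'] +
  fC g * (('x_2 + (Q' - 'x_2)) ^+ k.+1 - 'x_2 ^+ k.+1 - 'x_2 ^+ k.+1.-1 * (Q' - 'x_2) *+ k.+1) +
  fC g * 'x_2 ^+ k.+1); last by rewrite Q'E; fs; ring.
apply: suppD; first apply: suppD.
- apply: supp_subst2 => b c hbc.
  have [b0|b0] := posnP b.
    have hc : (k + 2 <= c)%N.
      rewrite leqNgt; apply/negP => hc; apply: hbc; rewrite b0 fcfB fcf_CM fcfB coef_var2_1 coef_var2_1X /=.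
      have [->|ne] := eqVneq c k.+1; first by rewrite -/g mulr1 eqSS eqn0Ngt k1 subr0 subrr.
      by rewrite mulr0 subr0 (ni_G0 hT) ?subrr //; lia.
    by apply: hmonQ; slia.
  have hbc' : (T.2 - 'x_1) [tuple b; c] <> 0.
    move=> e; apply: hbc; rewrite fcfB e fcf_CM coef_var2_1X.
    by case: b b0 {e} => // b _; rewrite mulr0 subrr.
  have hG := lev_coefG t1 t2 nQ nQ' bQ tr al1 N2 hQ k1 kk kk1 hT b0 hbc'.
  by apply: hmonQ; slia.
- by apply: suppC; apply: supp_sub (@supp_Qpow2 al mu _ k.+1 N2 al1 hq) _; slia.
- by apply: suppC; apply: supp_sub (supp_x2X R k.+1) _; slia.
Qed.

(** To first order the right side contributes
    [(z + f_1 z tau^k)^al (tau + g tau^(k+1))^mu q (chi + conj f (chi) tau^k)],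
    and the left side the term [(k + 1) g tau^k (Q' - tau)] of [g Q'^(k+1)]. *)
Lemma level_fixed j : Q' [tuple al; j; (mu + k)%N] = Q [tuple al; j; (mu + k)%N] +
  (f1 *+ al + g *+ mu - g *+ k.+1) * Q [tuple al; j; mu] + dlead [tuple 0%N; j; 0%N].
Proof.
have hfar : supp (not_le al (mu + k)) _ := supp_far t1 t2 nQ nQ' bQ tr al1 N2 hQ k1 kk kk1 hT (S := not_le al (mu + k)) _ _.
have key : supp (fun b c => b = 0%N \/ not_le al (mu + k) b c)
   (Q' + fC g * ('x_2 ^+ k * (Q' - 'x_2)) *+ k.+1 - (Q - 'x_2) - M).
  have e := lev_eq t1 t2 nQ nQ' bQ tr al1 N2 hQ k1 kk kk1 hT.
  rewrite (_ : _ - M = - (fsubst T.2 [tuple 'x_0; Q'] - Q' - fC g * ('x_2 ^+ k * (Q' - 'x_2)) *+ k.+1) + gB +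
     ((F ^+ al * gB ^+ mu * W - 'x_0 ^+ al * 'x_2 ^+ mu * W0 - M) +
     (fsubst (Q - 'x_2 - leadpart Q al mu) [tuple F; fB; gB] - (Q - 'x_2 - leadpart Q al mu)))); last first.
    rewrite -/F -/fB -/gB -/W -/W0 in e.
    rewrite [X in _ = _ + X]addrAC -e; ring.
  apply: suppD; first apply: suppD.
  - exact: suppN levc_LHS.
  - by apply: supp_sub ht _; slia.
  - apply: suppD; first by apply: supp_sub levc_near _; slia.
    apply: supp_sub (hfar _ _) _; last by slia.
      by rewrite /moved_supp; slia.
    by slia.
have hb0 : Q' [tuple al; j; mu] = Q [tuple al; j; mu].
  have hT' : near_id T k k.
    by case: hT => h1 h2 h3; split=> // c hc; apply: h2; apply: ltnW.
  rewrite (level_curve t1 t2 nQ nQ' bQ tr al1 N2 hQ k1 hT') //; [|lia|lia].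
  by rewrite (_ : (al == al.-1) = false) /= ?addr0 //; apply/eqP; lia.
have shift (f : A) c : ('x_2 ^+ c * f) [tuple al; j; (c + mu)%N] = f [tuple al; j; mu].
  by have := @coef_shift R f al j mu 0 c; rewrite add0n expr0 mul1r.
have : (Q' + fC g * ('x_2 ^+ k * (Q' - 'x_2)) *+ k.+1 - (Q - 'x_2) - M) [tuple al; j; (mu + k)%N] = 0.
  by apply: contrapT => /key; slia.
rewrite 2!fcfB fcfD fcfMn fcf_CM [in 'x_2 ^+ k * _]addrC.
have e1 : ('x_2 ^+ k * (- 'x_2 + Q')) [tuple al; j; (mu + k)%N] = Q [tuple al; j; mu].
  by rewrite addnC shift fcfD fcfN coef_x2 // oppr0 add0r hb0.
have e2 : M [tuple al; j; (mu + k)%N] = (f1 *+ al + g *+ mu) * Q [tuple al; j; mu] + dlead [tuple 0%N; j; 0%N].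
  have := @coef_shift R (fC f1 * W0 *+ al + fC g * W0 *+ mu + dlead) 0 j 0 al (mu + k).
  rewrite !addn0 -/M => ->; rewrite !fcfD !fcfMn !fcf_CM /W0 coef_x1 /= /qc coefchiE.
  by rewrite mulrDl !mulrnAl.
rewrite e1 e2 fcfB coef_x2 // subr0 => /eqP; rewrite subr_eq0 subr_eq -mulrnAl => /eqP.
move/(canRL (addrK _)) => ->; ring.
Qed.

Lemma coef_dlead j : dlead [tuple 0%N; j; 0%N] = \sum_(l <- mbox 1 j.+2)
   qc l * ((if ((tnth l ord0).-1 <= j)%N then (T.1 [tuple (j - (tnth l ord0).-1)%N; k])^*%C else 0) *+ tnth l ord0).
Proof.
rewrite /dlead (@fsumE _ _ _ _ j.+2) //; last first.
- by rewrite /mdeg !big_ord_recl big_ord0 !addn0 add0n.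
- exact: dlead_summable.
apply: eq_bigr => l _; rewrite fcf_CM fcfMn; congr (_ * (_ *+ _)).
set e := (tnth l ord0).-1.
have -> : 'x_1 ^+ e = mon R [tuple 0%N; e; 0%N] by rewrite -mon3 !expr0 mul1r mulr1.
case: leqP => h.
  have -> : [tuple 0%N; j; 0%N] = madd [tuple 0%N; e; 0%N] [tuple 0%N; (j - e)%N; 0%N].
    by rewrite madd3 subnKC.
  by rewrite fcf_monM /P0 coef_x1.
apply: fcf_monM0 => m /(congr1 (fun t => tnth t (inord 1))).
by rewrite tnth_madd !tnthE; lia.
Qed.

(** When [f (0) = 0] only [f_1] reaches the lowest coefficient. *)
Lemma coef_dlead_low n : T.1 [tuple 0%N; k] = 0 -> (forall i, (i < n)%N -> Q [tuple al; i; mu] = 0) ->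
  dlead [tuple 0%N; n; 0%N] = Q [tuple al; n; mu] * (f1^*%C *+ n).
Proof.
move=> h0 hn; rewrite coef_dlead (@sum_mbox1 _ _ _ _ [tuple n]).
- rewrite /qc coefchiE (_ : tnth [tuple n] ord0 = n) // leq_pred.
  case: n {hn} => [|n]; first by rewrite !mulr0n.
  by rewrite /= subSnn.
- by apply: mbox_deg; rewrite /mdeg big_ord1 /=; have -> : tnth [tuple n] ord0 = n by []; lia.
move=> l; have [e ->] := tuple1P l => ne; rewrite /qc coefchiE (_ : tnth [tuple e] ord0 = e) //.
have [lt|ge] := ltnP e n; first by rewrite hn ?mul0r.
have {}ne : e <> n by move=> e'; rewrite e' eqxx in ne.
case: ifP => h; last by rewrite mul0rn mulr0.
have -> : (n - e.-1 = 0)%N by lia.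
by rewrite h0 conjc0 mul0rn mulr0.
Qed.

Lemma coef_dlead_mono n j : (n <= j.+1)%N -> (forall i, i <> n -> Q [tuple al; i; mu] = 0) ->
  dlead [tuple 0%N; j; 0%N] = Q [tuple al; n; mu] * ((T.1 [tuple (j - n.-1)%N; k])^*%C *+ n).
Proof.
move=> hj hn; rewrite coef_dlead (@sum_mbox1 _ _ _ _ [tuple n]).
- by rewrite /qc coefchiE (_ : tnth [tuple n] ord0 = n) // (_ : (n.-1 <= j)%N) //; lia.
- by apply: mbox_deg; rewrite /mdeg big_ord1 /=; have -> : tnth [tuple n] ord0 = n by []; lia.
move=> l; have [e ->] := tuple1P l => ne; rewrite /qc coefchiE hn ?mul0r //.
by move=> e'; rewrite e' eqxx in ne.
Qed.

End LevelC.

(** * Invariant pairs and their orders *)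
Section OneVar.
Variable R : realType.
Local Notation C := R[i].
Implicit Types f g : fps R 1.

Lemma mdeg1 i : mdeg ([tuple i] : mindex 1) = i.
Proof. by rewrite /mdeg big_ord1. Qed.
Lemma mdeg3 b i c : mdeg ([tuple b; i; c] : mindex 3) = (b + i + c)%N.
Proof. by rewrite /mdeg !big_ord_recl big_ord0 addn0 addnA. Qed.

Lemma madd1 i j : madd [tuple i] [tuple j] = [tuple i + j]%N :> mindex 1.
Proof. by apply: eq_from_tnth; apply: forall_ord1; rewrite tnth_madd !tnthE. Qed.
Lemma munit1E : munit (inord 0) = [tuple 1%N] :> mindex 1.
Proof. by apply: eq_from_tnth; apply: forall_ord1; rewrite tnth_munit tnthE eqxx. Qed.
Lemma mzero1E : mzero 1 = [tuple 0%N].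
Proof. by apply: eq_from_tnth; apply: forall_ord1; rewrite tnth_mzero tnthE. Qed.

Lemma coef1_X e i : ('x_0 ^+ e : fps R 1) [tuple i] = (i == e)%:R.
Proof.
rewrite -gmon1 -vars1 gmon_vars /mon (_ : ([tuple i] == _) = (i == e)) //.
by apply/eqP/eqP => [[]|->].
Qed.

Lemma coef1_XM f e i : ('x_0 ^+ e * f) [tuple e + i]%N = f [tuple i].
Proof. by rewrite -gmon1 -vars1 gmon_vars -madd1 fcf_monM. Qed.

Lemma fnderiv0E n f : fnderiv0 n f = f [tuple n] *+ n`!.
Proof.
have h k : (iter n (fderiv ord0) f) [tuple k] = f [tuple k + n]%N *+ ((k + n) ^_ n).
  elim: n k => [|n IH] k; first by rewrite addn0 ffactn0 mulr1n.
  have e : madd [tuple k] (munit ord0) = [tuple k.+1] :> mindex 1.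
    have -> : ord0 = inord 0 :> 'I_1 by apply: val_inj; rewrite /= inordK.
    by rewrite munit1E madd1 addn1.
  rewrite iterS /fderiv e IH (_ : tnth [tuple k] ord0 = k) // -mulrnA addSnnS ffactnSr.
  by congr (_ *+ (_ * _)%N); lia.
by rewrite /fnderiv0 /fcoef0 mzero1E h add0n ffactnn.
Qed.

Lemma fnderiv0_eq0 n f : fnderiv0 n f = 0 <-> f [tuple n] = 0.
Proof.
rewrite fnderiv0E; split=> [/eqP|->]; last by rewrite mul0rn.
by rewrite mulrn_eq0 eqn0Ngt fact_gt0 /= => /eqP.
Qed.

Lemma coef1_lin f : zc f -> ford 2 (f - fC (f [tuple 1%N]) * 'x_0).
Proof.
move=> zf m; have [i ->] := tuple1P m; rewrite mdeg1 fcfB fcf_CM -['x_0]expr1 coef1_X.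
case: i => [|[|//]] _; last by rewrite mulr1 subrr.
by rewrite mulr0 subr0 -mzero1E; exact: zf.
Qed.

Lemma coef1_pow f e : zc f -> (f ^+ e) [tuple e] = f [tuple 1%N] ^+ e.
Proof.
move=> zf; elim: e => [|e IH]; first by rewrite !expr0 -mzero1E fcf_1 eqxx.
have := coef1_lin zf; set a := f [tuple 1%N] => hf.
rewrite exprS (_ : f * f ^+ e = (f - fC a * 'x_0) * f ^+ e + fC a * ('x_0 ^+ 1 * f ^+ e)); last by ring.
rewrite fcfD fcf_CM -[e.+1 in X in _ + _ * X]add1n coef1_XM IH exprS.
have -> : ((f - fC a * 'x_0) * f ^+ e) [tuple e.+1] = 0; last by rewrite add0r.
by apply: (fordM hf (fordX (e := e) zf)); rewrite mdeg1.
Qed.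

Lemma comp1_low f g n : zc g -> (forall i, (i < n)%N -> f [tuple i] = 0) ->
  (forall j, (j < n)%N -> fsubst f [tuple g] [tuple j] = 0) /\
  fsubst f [tuple g] [tuple n] = f [tuple n] * g [tuple 1%N] ^+ n.
Proof.
move=> zg hf; have hg : zct [tuple g] by zc_tac.
have hE j : fsubst f [tuple g] [tuple j] = \sum_(l <- mbox 1 j) f l * gmon [tuple g] l [tuple j].
  by rewrite (fsubstE _ hg (N := j)) // mdeg1.
split=> [j hj|].
  rewrite hE big1 // => l _; have [i ->] := tuple1P l; rewrite gmon1.
  have [h|h] := ltnP i n; first by rewrite hf ?mul0r.
  by rewrite (fordX (e := i) zg) ?mulr0 // mdeg1; apply: leq_trans h.
rewrite hE (@sum_mbox1 _ _ _ _ [tuple n]) ?mbox_deg ?mdeg1 //.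
  by rewrite gmon1 coef1_pow.
move=> l; have [i ->] := tuple1P l => ne; rewrite gmon1.
have [h|h] := ltnP i n; first by rewrite hf ?mul0r.
rewrite (fordX (e := i) zg) ?mulr0 // mdeg1 ltn_neqAle h andbT.
by apply: contraNneq ne => ->.
Qed.

End OneVar.

Section Structure.
Variable R : realType.
Local Notation C := R[i].
Local Notation A := (fps R 3).
Implicit Types (M : formal_hypersurface R) (H T : fps R 2 * fps R 2) (Q : A).

(** Both passages between [phi] and [Q] solve an equation of this shape, so
    both preserve supports and scale the leading part. *)
Lemma supp_implicit (x y : A) (c d : C) al mu : (1 <= al)%N -> (2 <= al + mu)%N ->
  zc x -> (forall b i c', (b = 0 \/ i = 0)%N -> x [tuple b; i; c'] = 0) ->
  (forall b i c', (b = 0 \/ i = 0)%N -> y [tuple b; i; c'] = 0) ->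
  x = fC c * fsubst y [tuple 'x_0; 'x_1; 'x_2 + fC d * x] -> supp (not_below al mu 1) y ->
  supp (not_below al mu 1) x /\ forall i, x [tuple al; i; mu] = c * y [tuple al; i; mu].
Proof.
move=> al1 N2 zx hx hy e hsy.
have z0 := @zcvar R 3 (inord 0). have z1 := @zcvar R 3 (inord 1). have z2 := @zcvar R 3 (inord 2).
have sstep (q : A) : supp (not_below al mu 1) q -> forall b i c', y [tuple b; i; c'] <> 0 ->
    supp (not_le al mu) ('x_0 ^+ b * 'x_1 ^+ i * (('x_2 + q) ^+ c' - 'x_2 ^+ c')) /\
    supp (not_below al mu 1) ('x_0 ^+ b * 'x_1 ^+ i * ('x_2 + q) ^+ c').
  move=> hq b i c' h; have hU := hsy _ _ _ h.
  have h1 := suppM (supp_x0X R b) (supp_x1X R i) (S'' := fun b' c => b' = b /\ c = 0)%N.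
  have hp := supp_Qpow c' N2 al1 hq; split.
    by apply: suppM (h1 _) hp _; slia.
  rewrite (_ : _ * _ = 'x_0 ^+ b * 'x_1 ^+ i * (('x_2 + q) ^+ c' - 'x_2 ^+ c') + 'x_0 ^+ b * 'x_1 ^+ i * 'x_2 ^+ c'); last by ring.
  by apply: suppD; [apply: suppM (h1 _) hp _|apply: suppM (h1 _) (supp_x2X R c') _]; slia.
have sx : supp (not_below al mu 1) x.
  suff h n : forall b i c', (b + i + c' < n)%N -> x [tuple b; i; c'] <> 0 -> not_below al mu 1 b c'.
    by move=> b i c'; apply: (h (b + i + c').+1).
  elim: n => // n IH b i c'; rewrite ltnS leq_eqVlt => /orP[/eqP hn|]; last exact: IH.
  pose xn : A := fun m => if (mdeg m < n)%N then x m else 0.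
  have hxn : supp (not_below al mu 1) xn.
    by move=> b' i' c''; rewrite /xn mdeg3; case: ltnP => // /IH h /h.
  have zxn : zc xn by rewrite /zc /fcoef0 /xn; case: ifP.
  have oxn : ford n (x - xn) by move=> m hm; rewrite fcfB /xn hm subrr.
  have [|||V eV V0] := @fsubst_mean R 3 3 y [tuple 'x_0; 'x_1; 'x_2 + fC d * x] [tuple 'x_0; 'x_1; 'x_2 + fC d * xn] (inord 2).
  - by zc_tac.
  - by zc_tac.
  - by apply: forall_ord3 => /eqP h; rewrite !tnthE //; case: h.
  rewrite !tnthE (_ : 'x_2 + fC d * x - _ = fC d * (x - xn)) in eV; last by ring.
  have V00 : zc V by rewrite /zc V0 munit3E // hy //; left.
  have o1 : ford n.+1 (fsubst y [tuple 'x_0; 'x_1; 'x_2 + fC d * x] - fsubst y [tuple 'x_0; 'x_1; 'x_2 + fC d * xn]).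
    by rewrite eV -[n.+1]addn1; apply: fordM; [apply: fordMr|apply: ford1].
  have := o1 [tuple b; i; c']; rewrite mdeg3 hn ltnSn => /(_ isT); rewrite fcfB => /eqP; rewrite subr_eq0 => /eqP e1.
  rewrite {1}e fcf_CM e1 => h; apply: (supp_subst3 (f := y) (S := not_below al mu 1) _ (b := b) (i := i) (c := c')); last first.
    by move=> h0; apply: h; rewrite h0 mulr0.
  by move=> b1 i1 c1 h1; apply: (sstep _ (suppC hxn) _ _ _ h1).2.
split=> // i; apply/eqP; rewrite -subr_eq0; apply/eqP.
have hd : supp (not_le al mu) (fsubst y [tuple 'x_0; 'x_1; 'x_2 + fC d * x] - y).
  rewrite -[X in _ - X]fsubst_id3; apply: supp_subst3B => b1 i1 c1 h1.
  by rewrite -mulrBr; apply: (sstep _ (suppC sx) _ _ _ h1).1.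
have h : (fsubst y [tuple 'x_0; 'x_1; 'x_2 + fC d * x] - y) [tuple al; i; mu] = 0.
  by apply: contrapT => /hd; slia.
by rewrite {1}e fcf_CM -mulrBr -fcfB h mulr0.
Qed.

Lemma normal_coords_trans M H H' Q Q' : normal_coords_Q M H Q -> normal_coords_Q M H' Q' ->
  exists T, [/\ formal_coords T, H' = coords_comp H T & trans T Q Q'].
Proof.
move=> hQ hQ'; have [fH _ _] := hQ; have [fH' _ _] := hQ'.
have [S [fS e1 e2]] := coords_inv fH.
have fT := coords_comp_formal fS fH'.
have e : H' = coords_comp H (coords_comp S H') by rewrite -coords_compA // e1 coords_comp_id.
exists (coords_comp S H'); split=> //; apply: (trans_of hQ) => //; by rewrite -e.
Qed.

Definition lin_z T := T.1 [tuple 1%N; 0%N].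
Definition lin_w T := T.2 [tuple 0%N; 1%N].

Lemma lin_zE T : lin_z T = T.1 (munit (inord 0)). Proof. by rewrite munit2E. Qed.
Lemma lin_wE T : lin_w T = T.2 (munit (inord 1)). Proof. by rewrite munit2E. Qed.

Lemma f0_zc T : zc T.1 -> zc (fsubst (fconj T.1) [tuple 'x_0; 0] : fps R 1).
Proof. by move=> h; have z0 := @zcvar R 1 (inord 0); zc_tac. Qed.

Lemma f0_lin T : zc T.1 -> (fsubst (fconj T.1) [tuple 'x_0; 0] : fps R 1) [tuple 1%N] = ((lin_z T)^*)%C.
Proof.
move=> h; have z0 := @zcvar R 1 (inord 0).
rewrite -munit1E coef_comp2 //; rewrite /fvar munit_eq eqxx mulr1 mulr0 addr0.
by rewrite lin_zE.
Qed.

(** The form of [Q] in normal coordinates when [m] is an invariant pair of order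
    [n]. *)
Definition has_pair (m : nat * nat) (n : nat) Q :=
  [/\ supp (not_below m.1 m.2 1) (Q - 'x_2), forall i, (i < n)%N -> Q [tuple m.1; i; m.2] = 0 &
      Q [tuple m.1; n; m.2] <> 0].

Lemma trans_data T Q Q' : formal_coords T -> normal_Q Q -> normal_Q Q' -> trans T Q Q' ->
  [/\ zc T.1, zc T.2, base T Q, lin_z T <> 0 & lin_w T <> 0].
Proof.
move=> fT nQ nQ' ht; have /formal_coordsE[t1 t2 _] := fT.
have hb := trans_base t1 t2 nQ nQ' ht; have [] := base_det fT nQ hb.
by rewrite -lin_zE -lin_wE.
Qed.

Lemma at0_1 (f : fps R 2) : zc f -> forall c, (c < 1)%N -> f [tuple 0%N; c] = 0.
Proof. by move=> h [|//] _; rewrite -munit00; exact: h. Qed.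

(** Compare the coefficients of [chi^n] in [lead_coef_trans]. *)
Lemma has_pair_trans m n T Q Q' : (1 <= m.1)%N -> (2 <= m.1 + m.2)%N ->
  formal_coords T -> normal_Q Q -> normal_Q Q' -> trans T Q Q' -> has_pair m n Q ->
  [/\ has_pair m n Q', ((lin_w T)^*)%C = lin_w T &
      lin_w T * Q' [tuple m.1; n; m.2] =
        lin_z T ^+ m.1 * ((lin_z T)^*)%C ^+ n * lin_w T ^+ m.2 * Q [tuple m.1; n; m.2]].
Proof.
move=> al1 N2 fT nQ nQ' ht [hs h0 hn]; have [t1 t2 hb g0 r0] := trans_data fT nQ nQ' ht.
have hl := lead_coef_trans t1 t2 nQ nQ' hb ht al1 N2 hs r0.
have zf0 := f0_zc t1; have f01 := f0_lin t1.
have [c0 cn] := comp1_low (f := coefchi Q m.1 m.2) zf0 h0.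
have hQ' j : lin_w T * Q' [tuple m.1; j; m.2] = lin_z T ^+ m.1 * lin_w T ^+ m.2 *
    fsubst (coefchi Q m.1 m.2) [tuple fsubst (fconj T.1) [tuple 'x_0; 0]] [tuple j].
  by have := congr1 (fun f : fps R 1 => f [tuple j]) hl; rewrite !fcf_CM coefchiE.
have key : lin_w T * Q' [tuple m.1; n; m.2] =
        lin_z T ^+ m.1 * ((lin_z T)^*)%C ^+ n * lin_w T ^+ m.2 * Q [tuple m.1; n; m.2].
  by rewrite hQ' cn f01 coefchiE; ring.
split=> //; last by have := coef_real t1 t2 nQ hb al1 N2 (leqnn 1) hs (at0_1 t1) (leqnn 1).
split.
- exact: (supp_trans t1 t2 nQ hb al1 N2 (leqnn 1) hs (at0_1 t1) nQ' ht r0).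
- move=> i hi; have := hQ' i; rewrite c0 // mulr0 => /eqP; rewrite mulf_eq0 => /orP[/eqP //|/eqP //].
- move=> e; move: key; rewrite e mulr0 => /esym/eqP; apply/negP.
  by rewrite !mulf_neq0 ?expf_neq0 ?conjc_eq0 //; apply/eqP.
Qed.

Lemma phi_supp (phi : A) (m : nat * nat) : normal_phi phi ->
  (forall p', pair_lt p' m -> coefchi phi p'.1 p'.2 = fzero) -> supp (not_below m.1 m.2 1) phi.
Proof.
move=> hphi h b i c hn.
have b1 : (1 <= b)%N by case: b hn => // hn; case: hn; apply: normal_phi_coef => //; left.
split=> // -[h1 [h2 h3]].
have hlt : pair_lt (b, c) m.
  split; first by rewrite /pair_le /=; lia.
  by move=> e; apply: h3; rewrite -e /=; lia.
by apply: hn; have := congr1 (fun f : fps R 1 => f [tuple i]) (h _ hlt).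
Qed.

Lemma QM_pos M m : QM M m -> (1 <= m.1)%N.
Proof.
move=> [H [phi [[_ hphi _] h _]]]; case: m.1 h => // h; case: h; apply: fpsP => k.
have [i ->] := tuple1P k; rewrite coefchiE normal_phi_coef //; by left.
Qed.

Lemma min_coef (f : fps R 1) : f <> fzero ->
  exists n, f [tuple n] <> 0 /\ forall i, (i < n)%N -> f [tuple i] = 0.
Proof.
move=> h; have ex : exists n, f [tuple n] != 0.
  apply: contrapT => hn; apply: h; apply: fpsP => m; have [i ->] := tuple1P m.
  by apply/eqP; apply: contrapT => /negP e; apply: hn; exists i.
case: (ex_minnP ex) => n /eqP hn hmin; exists n; split=> // i hi.
by apply/eqP; apply: contraTT hi => /hmin; rewrite -leqNgt.
Qed.

Lemma phi_has_pair M H (phi : A) m : normal_coords_phi M H phi -> (1 <= m.1)%N -> (2 <= m.1 + m.2)%N ->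
  exists Q, [/\ normal_coords_Q M H Q,
    (supp (not_below m.1 m.2 1) phi <-> supp (not_below m.1 m.2 1) (Q - 'x_2)) &
    supp (not_below m.1 m.2 1) phi -> forall i, Q [tuple m.1; i; m.2] = 2 * 'i%C * phi [tuple m.1; i; m.2]].
Proof.
move=> hc al1 N2; have [Q [hQ e1 e2]] := normal_phi_Q hc; have [_ hphi _] := hc; have [_ nQ _] := hQ.
have zphi := normal_phi_zc hphi; have zQ := normalQ_zc nQ.
have z2 := @zcvar R 3 (inord 2).
have f1 : supp (not_below m.1 m.2 1) phi -> supp (not_below m.1 m.2 1) (Q - 'x_2) /\
    forall i, (Q - 'x_2) [tuple m.1; i; m.2] = 2 * 'i%C * phi [tuple m.1; i; m.2].
  apply: (supp_implicit al1 N2 _ _ _ e1); first by zc_tac.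
  - by move=> b i c' h; apply: normalQ_coef.
  - by move=> b i c' h; apply: normal_phi_coef.
exists Q; split=> //.
- split=> [/f1 [] //|h].
  have e2' : phi = fC (2 * 'i%C)^-1 * fsubst (Q - 'x_2) [tuple 'x_0; 'x_1; 'x_2 + fC (- 'i%C) * phi].
    by rewrite fCN mulNr.
  apply: (supp_implicit al1 N2 zphi _ _ e2' h).1.
  - by move=> b i c' h'; apply: normal_phi_coef.
  - by move=> b i c' h'; apply: normalQ_coef.
- by move=> /f1 [_ h] i; rewrite -h fcfB coef_x2 // subr0.
Qed.

(** In given coordinates [phi] and [Q] have the same pair and proportional
    leading coefficients, and on the side of [Q] the transition equation shows
    independence of the coordinates. *)
Lemma QM_has_pair M m : QM M m -> (2 <= m.1 + m.2)%N ->
  (exists H Q, normal_coords_Q M H Q) /\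
  forall H Q, normal_coords_Q M H Q -> has_pair m (nM M m) Q.
Proof.
move=> hm N2; have al1 := QM_pos hm; move: hm => [H0 [phi0 [hc0 hne hlt]]].
have hs0 : supp (not_below m.1 m.2 1) phi0 by apply: phi_supp => //; case: hc0.
have [Q0 [hQ0 hequiv hQphi]] := phi_has_pair hc0 al1 N2.
have i0 : (2 * 'i%C : C) != 0 by rewrite mulf_neq0 ?two_neq0 ?im_neq0.
have [n [hn hn0]] := min_coef hne.
have hp0 : has_pair m n Q0.
  split; [exact/hequiv| |].
  - by move=> i hi; rewrite hQphi // -coefchiE hn0 // mulr0.
  - by rewrite hQphi // => /eqP; rewrite mulf_eq0 (negbTE i0) /= => /eqP.
have hall H Q : normal_coords_Q M H Q -> has_pair m n Q.
  move=> hQ; have [T [fT _ ht]] := normal_coords_trans hQ0 hQ.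
  by case: (has_pair_trans al1 N2 fT _ _ ht hp0); case: hQ0; case: hQ.
have -> : nM M m = n; last by split=> //; exists H0, Q0.
rewrite /nM; apply: xget_unique.
  exists H0, phi0; split=> //; first by move/fnderiv0_eq0.
  by move=> j hj; apply/fnderiv0_eq0; apply: hn0.
move=> n' [H [phi [hc h1 h2]]].
have [Q [hQ hequiv' hQphi']] := phi_has_pair hc al1 N2.
have [hs h0 hnn] := hall _ _ hQ; have hsphi := hequiv'.2 hs.
apply/eqP; rewrite eqn_leq; apply/andP; split; rewrite leqNgt; apply/negP => h.
- by apply: hnn; rewrite hQphi' // -coefchiE (fnderiv0_eq0 _ _).1 ?mulr0 //; apply: h2.
- apply: h1; apply/fnderiv0_eq0; have := h0 _ h; rewrite hQphi' // => /eqP.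
  by rewrite mulf_eq0 (negbTE i0) /= => /eqP.
Qed.

(** The pair [(1, 0)] is below all others, so it cannot be one of two invariant
    pairs. *)
Lemma QM_deg2 M p pt : QM M p -> QM M pt -> p <> pt -> (2 <= p.1 + p.2)%N.
Proof.
move=> hp hpt ne; rewrite leqNgt; apply/negP => h.
have a1 := QM_pos hp; have b1 := QM_pos hpt.
have ep : p = (1, 0)%N by move: ne h a1 {hp}; case: p => a b /= _ h a1; congr pair; lia.
have N2 : (2 <= pt.1 + pt.2)%N.
  rewrite leqNgt; apply/negP => h'; apply: ne; rewrite ep.
  by move: h' b1 {hpt}; case: pt => a b /= h' b1; congr pair; lia.
have [_ hall] := QM_has_pair hpt N2; move: hp => [H [phi [hc hne _]]].
have [Q [hQ hequiv _]] := phi_has_pair hc b1 N2.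
have [/hequiv hs _ _] := hall _ _ hQ.
apply: hne; rewrite ep /=; apply: fpsP => k; have [i ->] := tuple1P k; rewrite coefchiE.
apply: contrapT => /hs; move: ne N2; rewrite ep; case: (pt) => a b /= ne N2; rewrite /not_below => hU.
have ne' : ~ (a = 1 /\ b = 0)%N by move=> [e e']; apply: ne; rewrite e e'.
by lia.
Qed.

Lemma pairs_incomparable M p pt : QM M p -> QM M pt -> p <> pt ->
  ~ pair_le p pt /\ p.2 <> pt.2.
Proof.
move=> hp hpt ne; have N2 := QM_deg2 hp hpt ne; have N2t := QM_deg2 hpt hp (fun e => ne (esym e)).
have [[H [Q hQ]] hall] := QM_has_pair hp N2; have [_ hallt] := QM_has_pair hpt N2t.
have [hs _ hn] := hall _ _ hQ; have [hst _ hnt] := hallt _ _ hQ.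
have a1 := QM_pos hp; have b1 := QM_pos hpt.
have U1 : not_below pt.1 pt.2 1 p.1 p.2 by apply: (hst _ (nM M p)); rewrite fcfB coef_x2 // subr0.
have U2 : not_below p.1 p.2 1 pt.1 pt.2 by apply: (hs _ (nM M pt)); rewrite fcfB coef_x2 // subr0.
move: U1 U2 ne; rewrite /pair_le; case: (p) => a b; case: (pt) => a' b' /=; rewrite /not_below => U1 U2 ne.
have : ~ (a = a' /\ b = b') by move=> [e e']; apply: ne; rewrite e e'.
by lia.
Qed.

Lemma nM_pos M m H Q : QM M m -> (2 <= m.1 + m.2)%N -> normal_coords_Q M H Q -> (1 <= nM M m)%N.
Proof.
move=> hm N2 hQ; have [_ /(_ _ _ hQ)[_ _ hn]] := QM_has_pair hm N2.
case: (nM M m) hn => // hn; case: hn; have a1 := QM_pos hm; have [_ nQ _] := hQ.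
by have := normalQ_coef (a := m.1) (b := 0) m.2 nQ (or_intror erefl); rewrite fcfB coef_x2 // subr0.
Qed.

End Structure.

(** * Scaling factors *)
Section Numbers.
Variable R : realType.
Local Notation C := R[i].
Implicit Types (x y g : C).

Lemma conjcX x n : ((x ^+ n)^*)%C = (x^*)%C ^+ n.
Proof. exact: (rmorphXn (@conjc R)). Qed.
Lemma conjcM x y : ((x * y)^*)%C = (x^*)%C * (y^*)%C.
Proof. exact: (rmorphM (@conjc R)). Qed.

Lemma Im_mulnat (x : C) j : complex.Im (x *+ j) = complex.Im x *+ j.
Proof. by elim: j => [|j IH] //; rewrite !mulrS -IH; case: (x) (x *+ j) => ? ? []. Qed.
Lemma Re_mulnat (x : C) j : complex.Re (x *+ j) = complex.Re x *+ j.
Proof. by elim: j => [|j IH] //; rewrite !mulrS -IH; case: (x) (x *+ j) => ? ? []. Qed.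

Lemma conjc_Im x : ((x^*)%C = x) <-> (complex.Im x = 0).
Proof.
case: x => a b; split=> /=; last by move=> ->; rewrite oppr0.
case=> /eqP; rewrite eq_sym -addr_eq0 -mulr2n mulrn_eq0 /= => /eqP //.
Qed.

Lemma conjc_ge0 x : 0 <= x -> (x^*)%C = x.
Proof. by move=> /ger0_Im /conjc_Im. Qed.

Lemma conj_norm1 x : `|x| = 1 -> x * (x^*)%C = 1.
Proof. by move=> h; rewrite -sqr_normc h expr1n. Qed.

Lemma norm_root1 x k : (0 < k)%N -> `|x| = 1 -> `|k.-root x| = 1.
Proof.
by move=> k0 h; apply/eqP; rewrite -(@pexpr_eq1 _ _ k) // -normrX rootCK // h eqxx.
Qed.

(** Choose the modulus by a positive root and the phase by a root of unit
    modulus; the phase is available because [a <> n]. *)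
Lemma gamma_exists (a n : nat) (v : C) : a <> n -> v <> 0 ->
  exists2 g, g <> 0 & g ^+ a * (g^*)%C ^+ n = v.
Proof.
move=> an /eqP v0; set rho := `|v|; have rho0 : 0 < rho by rewrite normr_gt0.
have an0 : (0 < a + n)%N by lia.
pose s := (a + n)%N.-root rho.
have s0 : 0 < s by rewrite rootC_gt0.
have sc : (s^*)%C = s by apply: conjc_ge0; apply: ltW.
have sE : s ^+ (a + n) = rho by rewrite rootCK.
have hv : `|v / rho| = 1 by rewrite normrM normfV normr_id divff // gt_eqF.
have vE : rho * (v / rho) = v by rewrite mulrCA divff ?mulr1 ?gt_eqF.
have [lt|le] := ltnP n a.
  pose u := (a - n)%N.-root (v / rho).
  have u1 : `|u| = 1 by apply: norm_root1; rewrite ?subn_gt0.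
  have uE : u ^+ (a - n) = v / rho by rewrite rootCK ?subn_gt0.
  exists (s * u).
    by apply/eqP; apply: mulf_neq0; [rewrite gt_eqF|rewrite -normr_gt0 u1 ltr01].
  rewrite conjcM sc !exprMn mulrACA -exprD sE -{1}(subnK (ltnW lt)) exprD uE -mulrA -exprMn.
  by rewrite conj_norm1 // expr1n mulr1.
have lt : (a < n)%N by lia.
pose u := (n - a)%N.-root ((v / rho)^*)%C.
have u1 : `|u| = 1 by apply: norm_root1; rewrite ?subn_gt0 // normcJ.
have uE : u ^+ (n - a) = ((v / rho)^*)%C by rewrite rootCK ?subn_gt0.
exists (s * u).
  by apply/eqP; apply: mulf_neq0; [rewrite gt_eqF|rewrite -normr_gt0 u1 ltr01].
rewrite conjcM sc !exprMn mulrACA -exprD sE -{1}(subnK (ltnW lt)) exprD.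
rewrite [u ^+ a * _]mulrCA -exprMn conj_norm1 // expr1n mulr1 -conjcX uE conjcK //.
Qed.

(** The factor by which the coefficient at [z^a chi^n tau^mu] is multiplied when
    [F_z (0) = g] and [G_w (0) = r]. *)
Definition scale_factor g (r : C) (a n mu : nat) : C := g ^+ a * (g^*)%C ^+ n * r ^ (mu%:Z - 1).

Lemma scale_factorE g r a n mu : r <> 0 -> r * scale_factor g r a n mu = g ^+ a * (g^*)%C ^+ n * r ^+ mu.
Proof.
move=> /eqP r0; rewrite /scale_factor mulrCA; congr (_ * _).
by rewrite -{1}[r]expr1z -expfzDr // addrC subrK.
Qed.

(** A one-parameter group of scalings fixing the first coefficient moves the
    second one freely unless the exponents are proportional. *)
Lemma scaling_exists (a n mu a' n' mu' : nat) (v : C) : 0 < v ->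
  mu'%:Z * (a%:Z + n%:Z) - mu%:Z * (a'%:Z + n'%:Z) != (a%:Z + n%:Z) - (a'%:Z + n'%:Z) ->
  exists t r : C, [/\ 0 < t, 0 < r, scale_factor t r a n mu = 1 & scale_factor t r a' n' mu' = v].
Proof.
move=> v0 hne; pose D : int := (a%:Z + n%:Z) * (mu'%:Z - 1) - (mu%:Z - 1) * (a'%:Z + n'%:Z).
have D0 : D != 0.
  by apply: contraNneq hne => h; rewrite -subr_eq0 -h /D; apply/eqP; ring.
have [w w0 wE] : exists2 w : C, 0 < w & w ^ D = v.
  have aD : (0 < `|D|)%N by rewrite absz_gt0.
  have [le|lt] := leP 0 D.
    by exists (`|D|%N.-root v); rewrite ?rootC_gt0 // -[D in _ ^ D]gez0_abs // -exprnP rootCK.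
  exists (`|D|%N.-root v^-1); rewrite ?rootC_gt0 ?invr_gt0 //.
  by rewrite -[D in _ ^ D]opprK -(ltz0_abs lt) -exprnN rootCK // invrK.
have wn : w != 0 by rewrite gt_eqF.
pose t := w ^ (1 - mu%:Z); pose r := w ^ (a%:Z + n%:Z).
have t0 : 0 < t by rewrite exprz_gt0.
have r0 : 0 < r by rewrite exprz_gt0.
have cf (i j l : nat) : scale_factor t r i j l = w ^ ((1 - mu%:Z) * (i%:Z + j%:Z) + (a%:Z + n%:Z) * (l%:Z - 1)).
  rewrite /scale_factor conjc_ge0 ?ltW // -exprD exprnP PoszD /t /r !exprz_exp -expfzDr //.
exists t, r; split=> //; rewrite cf.
  by rewrite (_ : _ + _ = 0) ?expr0z //; ring.
by rewrite -wE; congr (_ ^ _); rewrite /D; ring.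
Qed.

End Numbers.

(** * Normalizing the two leading coefficients *)
Section Start.
Variable R : realType.
Local Notation C := R[i].
Local Notation A := (fps R 3).
Implicit Types (M : formal_hypersurface R) (H T : fps R 2 * fps R 2) (Q : A).

Lemma coef_x1_2 (g : fps R 1) b c : fsubst g [tuple 'x_1] [tuple b; c] =
  (if b == 0%N then g [tuple c] else 0) :> C.
Proof.
have z1 := @zcvar R 2 (inord 1).
pose iota (k : mindex 1) : mindex 2 := [tuple 0%N; tnth k (inord 0)].
have hg l : gmon [tuple 'x_1] l = mon R (iota l).
  have [e ->] := tuple1P l; rewrite gmon1 /iota !tnthE -gmon_vars vars2 gmon2 expr0 mul1r //.
have hi : injective iota.
  move=> k l; have [b1 ->] := tuple1P k; have [b2 ->] := tuple1P l.
  by rewrite /iota !tnthE => -[->].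
have [->|/eqP ne] := eqVneq b 0%N; last first.
  apply: (@coef_emb0 _ _ _ g _ iota) => //; first by zc_tac.
  by move=> l; rewrite /iota => -[e _].
have -> : [tuple 0%N; c] = iota [tuple c] by rewrite /iota !tnthE.
by apply: (@coef_emb _ _ _ g _ iota) => //; zc_tac.
Qed.

Lemma coef_x0_2 (g : fps R 1) b c : fsubst g [tuple 'x_0] [tuple b; c] =
  (if c == 0%N then g [tuple b] else 0) :> C.
Proof.
have z1 := @zcvar R 2 (inord 0).
pose iota (k : mindex 1) : mindex 2 := [tuple tnth k (inord 0); 0%N].
have hg l : gmon [tuple 'x_0] l = mon R (iota l).
  have [e ->] := tuple1P l; rewrite gmon1 /iota !tnthE -gmon_vars vars2 gmon2 expr0 mulr1 //.
have hi : injective iota.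
  move=> k l; have [b1 ->] := tuple1P k; have [b2 ->] := tuple1P l.
  by rewrite /iota !tnthE => -[->].
have [->|/eqP ne] := eqVneq c 0%N; last first.
  apply: (@coef_emb0 _ _ _ g _ iota) => //; first by zc_tac.
  by move=> l; rewrite /iota => -[_ e].
have -> : [tuple b; 0%N] = iota [tuple b] by rewrite /iota !tnthE.
by apply: (@coef_emb _ _ _ g _ iota) => //; zc_tac.
Qed.

(** Changes of coordinates fixing the curve [z = 0], with real second
    component depending on [w] only, always give normal coordinates. *)
Lemma fixed_curve_base (f : fps R 2) (g : fps R 1) Q : normal_Q Q -> zc f -> zc g ->
  fsubst f [tuple 0; 'x_1] = 0 :> fps R 2 -> fconj g = g ->
  base (f, fsubst g [tuple 'x_1]) Q.
Proof.
move=> nQ zf zg hf hg; have z1 := @zcvar R 2 (inord 1).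
have hf' : fsubst (fconj f) [tuple 0; 'x_1] = 0 :> fps R 2 by apply: fconj_inj; fs; rewrite hf.
rewrite /base /= hf' (normalQ1 nQ) //; first by fs; rewrite hg.
by zc_tac.
Qed.

Lemma fixed_curve_formal (f : fps R 2) (g : fps R 1) : zc f -> zc g ->
  f [tuple 1%N; 0%N] <> 0 -> g [tuple 1%N] <> 0 -> formal_coords (f, fsubst g [tuple 'x_1]).
Proof.
move=> zf zg /eqP f1 /eqP g1; have z1 := @zcvar R 2 (inord 1).
apply/formal_coordsE; split=> //=; first by zc_tac.
by rewrite !munit2E // !coef_x1_2 /= mulr0 subr0; apply/eqP; rewrite mulf_neq0.
Qed.

Lemma fixed_curve_coords M H Q (f : fps R 2) (g : fps R 1) (T := (f, fsubst g [tuple 'x_1])) :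
  normal_coords_Q M H Q -> zc f -> zc g ->
  fsubst f [tuple 0; 'x_1] = 0 :> fps R 2 -> fconj g = g ->
  f [tuple 1%N; 0%N] <> 0 -> g [tuple 1%N] <> 0 ->
  formal_coords T /\ exists2 Q', normal_coords_Q M (coords_comp H T) Q' & trans T Q Q'.
Proof.
move=> hQ zf zg hf hg f1 g1; have [_ nQ _] := hQ.
have fT := fixed_curve_formal zf zg f1 g1; split=> //.
by apply: normal_coords_of hQ fT _; apply: fixed_curve_base.
Qed.

Lemma coef_munitM n (f g : fps R n) j :
  (f * g) (munit j) = fcoef0 f * g (munit j) + f (munit j) * fcoef0 g.
Proof.
have zf : zc (f - fC (fcoef0 f)) by rewrite /zc fcoef0D fcoef0N fcoef0C subrr.
have zg : zc (g - fC (fcoef0 g)) by rewrite /zc fcoef0D fcoef0N fcoef0C subrr.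
rewrite (_ : f * g = (f - fC (fcoef0 f)) * (g - fC (fcoef0 g)) + fC (fcoef0 g) * (f - fC (fcoef0 f)) + fC (fcoef0 f) * g); last by ring.
rewrite !fcfD !fcf_CM (fordM (ford1 zf) (ford1 zg)) ?mdeg_munit // fcfB add0r.
have -> : (fC (fcoef0 f) : fps R n) (munit j) = 0.
  by rewrite /fC; case: eqP => // /(congr1 (@mdeg n)); rewrite mdeg_munit mdeg0.
by rewrite subr0 addrC [_ * f _]mulrC.
Qed.

Lemma coef_munitX n (f : fps R n) j e :
  (f ^+ e) (munit j) = (fcoef0 f ^+ e.-1 * f (munit j)) *+ e.
Proof.
elim: e => [|e IH].
  by rewrite expr0 mulr0n fcf_1; case: eqP => // /(congr1 (@mdeg n)); rewrite mdeg_munit mdeg0.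
rewrite exprS coef_munitM IH fcoef0X; case: e {IH} => [|e] /=.
  by rewrite !expr0 mulr0n mulr0 add0r mulr1 mul1r.
by rewrite [in RHS]mulrS -mulrnAr mulrA -exprS addrC mulrnAr [f _ * _]mulrC.
Qed.

(** Reparametrize so that the leading coefficient becomes a monomial: factor
    out the monomial and take an [n]-th root, both inside one application of
    the implicit function theorem. *)
Lemma normalize_series (qc : fps R 1) (al n : nat) : al <> n -> (1 <= n)%N ->
  (forall i, (i < n)%N -> qc [tuple i] = 0) -> qc [tuple n] <> 0 ->
  exists f : fps R 1, [/\ zc f, f [tuple 1%N] <> 0 &
    fC (f [tuple 1%N] ^+ al) * fsubst qc [tuple fconj f] = fC (2 * 'i%C) * 'x_0 ^+ n].
Proof.
move=> an n1 hlow; set ka := qc [tuple n] => /eqP ka0.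
have i0 : (2 * 'i%C : C) != 0 by rewrite mulf_neq0 ?two_neq0 ?im_neq0.
have [|ga /eqP ga0 gaE] := gamma_exists an (v := 2 * 'i%C / ka).
  by apply/eqP; rewrite mulf_neq0 ?invr_neq0.
set gc := (ga^*)%C in gaE.
pose h : fps R 1 := fun m => qc [tuple n + tnth m ord0]%N / ka.
have hE : qc = fC ka * ('x_0 ^+ n * h).
  apply: fpsP => m; have [i ->] := tuple1P m; rewrite fcf_CM.
  have [lt|le] := ltnP i n.
    rewrite hlow // -[_ * h]/(_ * h) -gmon1 -vars1 gmon_vars fcf_monM0 ?mulr0 // => l.
    by have [j ->] := tuple1P l; rewrite madd1 => -[e]; lia.
  rewrite -(subnKC le) coef1_XM /h (_ : tnth [tuple (i - n)%N] ord0 = (i - n)%N) //.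
  by rewrite mulrCA divff // mulr1.
have h0 : fcoef0 h = 1.
  by rewrite /fcoef0 /h mzero1E (_ : tnth [tuple 0%N] ord0 = 0%N) // addn0 divff.
have z41 := @zcvar R 4 (inord 1). have z43 := @zcvar R 4 (inord 3).
pose P : fps R 4 := (1 + 'x_1) ^+ n * fsubst h [tuple fC gc * ('x_3 * (1 + 'x_1))] - 1.
have zin : zc (fC gc * ('x_3 * (1 + 'x_1)) : fps R 4) by apply: zcMr; apply: zcMl.
have zh : zct ([tuple fC gc * ('x_3 * (1 + 'x_1))] : 1.-tuple (fps R 4)) by apply: zct1.
have c1 : fcoef0 (1 + 'x_1 : fps R 4) = 1 by rewrite fcoef0D fcoef01 z41 addr0.
have zP : zc P.
  by rewrite /zc /P fcoef0D fcoef0N fcoef0M fcoef0X c1 expr1n mul1r fcoef0_subst // h0 fcoef01 subrr.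
have one_lin (m : nat) (j : 'I_m) : (1 : fps R m) (munit j) = 0.
  by rewrite fcf_1; case: eqP => // /(congr1 (@mdeg m)); rewrite mdeg_munit mdeg0.
have P1 : P (munit (inord 1)) <> 0.
  rewrite /P fcfB one_lin subr0 coef_munitM coef_munitX fcoef0X c1 !expr1n mul1r.
  rewrite coef_munit_subst // big_ord1 (_ : ord0 = inord 0); last by apply: val_inj; rewrite /= inordK.
  rewrite tnthE fcf_CM coef_munitM z43 mul0r add0r c1 mulr1 {1}/fvar munit_eq inord_neq // !mulr0 add0r.
  rewrite fcoef0_subst // h0 mul1r mulr1 fcfD one_lin add0r /fvar eqxx -[_ *+ n]mulr1n.
  by apply/eqP; rewrite mulr1n pnatr_eq0 -lt0n.
have [Y zY eY] := ift zP P1.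
have z10 := @zcvar R 1 (inord 0).
pose y : fps R 1 := fsubst Y [tuple 0; 0; 'x_0].
have zy : zc y by rewrite /y; zc_tac.
have ey : (1 + y) ^+ n * fsubst h [tuple fC gc * ('x_0 * (1 + y))] = 1.
  have := congr1 (fun f : fps R 3 => fsubst f ([tuple 0; 0; 'x_0] : 3.-tuple (fps R 1))) eY.
  rewrite /P /= fsubstA; [rewrite tcompE|zc_tac|zc_tac]; rewrite -/y.
  have -> : fsubst 'x_0 [tuple 0; 0; 'x_0] = 0 :> fps R 1 by fs.
  have -> : fsubst 'x_1 [tuple 0; 0; 'x_0] = 0 :> fps R 1 by fs.
  have -> : fsubst 'x_2 [tuple 0; 0; 'x_0] = 'x_0 :> fps R 1 by fs.
  rewrite fsubstB fsubst1; last by zc_tac.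
  rewrite fsubstM; last by zc_tac.
  rewrite fsubstA //; last by zc_tac.
  by rewrite tcompE; fs; move/eqP; rewrite subr_eq0 => /eqP.
pose fb : fps R 1 := fC gc * ('x_0 * (1 + y)).
have zfb : zc fb by apply: zcMr; apply: zcMl.
have fb1 : fb [tuple 1%N] = gc.
  rewrite /fb fcf_CM -munit1E coef_munitM z10 mul0r add0r fcoef0D fcoef01 zy addr0 mulr1.
  by rewrite /fvar eqxx mulr1.
exists (fconj fb); have fb1' : (fconj fb) [tuple 1%N] = ga by rewrite /fconj fb1 /gc conjcK.
split; [exact: zc_conj|by rewrite fb1'; apply/eqP|].
have zfb' : zct [tuple fb] by zc_tac.
rewrite fb1' fconjK hE !fsubstM // fsubstC // fsubstX // fsubst_var // tnthE.
have -> : fsubst h [tuple fb] = fsubst h [tuple fC gc * ('x_0 * (1 + y))] by [].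
rewrite (_ : _ * _ = fC (ga ^+ al) * fC ka * fC gc ^+ n * ('x_0 ^+ n *
  ((1 + y) ^+ n * fsubst h [tuple fC gc * ('x_0 * (1 + y))]))); last first.
  by rewrite /fb !exprMn; move: (fC gc) (fC ka) (fC (ga ^+ al)) => u v w; ring.
rewrite ey mulr1 -fCX -!fCM; congr (fC _ * _).
by rewrite mulrAC gaE divfK.
Qed.

Lemma fexp_x0 n (c : C) i : fscale c (fexp ('x_0 : fps R 1) n) [tuple i] = if i == n then c else 0.
Proof. by rewrite fexpE /fscale coef1_X; case: eqP; rewrite ?mulr1 ?mulr0. Qed.

Lemma lead_normalizedE M p Q : lead_normalized M p Q <->
  forall i, Q [tuple p.1; i; p.2] = if i == nM M p then 2 * 'i%C else 0.
Proof.
split=> [h i|h]; first by rewrite -coefchiE h fexp_x0.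
by apply: fpsP => m; have [i ->] := tuple1P m; rewrite coefchiE h fexp_x0.
Qed.

Lemma lead_normalized_exists M p H Q : QM M p -> (2 <= p.1 + p.2)%N -> p.1 <> nM M p -> normal_coords_Q M H Q ->
  exists H' Q', normal_coords_Q M H' Q' /\ lead_normalized M p Q'.
Proof.
move=> hp N2 an hQ; have a1 := QM_pos hp; have n1 := nM_pos hp N2 hQ.
have [_ hall] := QM_has_pair hp N2; have [hs hlow hn] := hall _ _ hQ.
have [f [zf f1 fE]] := normalize_series (qc := coefchi Q p.1 p.2) an n1 hlow hn.
have z0 := @zcvar R 2 (inord 0). have z1 := @zcvar R 2 (inord 1). have z10 := @zcvar R 1 (inord 0).
have zF : zc (fsubst f [tuple 'x_0] : fps R 2) by zc_tac.
have [||||fT [Q' hQ' ht]] := fixed_curve_coords hQ zF z10.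
- fs; apply: fpsP => m; rewrite fsubstE0 big1 // => k _; have [e ->] := tuple1P k.
  rewrite gmon1 expr0n; case: e => [|e]; last by rewrite mulr0.
  by rewrite -mzero1E -[f _]/(fcoef0 f) zf mul0r.
- exact: fconj_var.
- by rewrite coef_x0_2.
- by rewrite -['x_0]expr1 coef1_X; apply/eqP; rewrite oner_neq0.
set T := (_, _) in fT hQ' ht.
have [_ nQ _] := hQ; have [_ nQ' _] := hQ'.
have [t1 t2 hb g0 r0] := trans_data fT nQ nQ' ht.
have hl := lead_coef_trans t1 t2 nQ nQ' hb ht a1 N2 hs r0.
have gE : T.1 [tuple 1%N; 0%N] = f [tuple 1%N] by rewrite /T /= coef_x0_2.
have rE : T.2 [tuple 0%N; 1%N] = 1 by rewrite /T /= coef_x1_2 /= -['x_0]expr1 coef1_X.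
have f0E : fsubst (fconj T.1) [tuple 'x_0; 0] = fconj f by rewrite /T /=; fs; rewrite fsubst_id1.
rewrite rE gE f0E expr1n mulr1 fE fC1 mul1r in hl.
exists (coords_comp H T), Q'; split=> //.
by rewrite /lead_normalized hl fscaleE fexpE.
Qed.

Lemma rescaled_coords M p pt H Q (t r : C) : QM M p -> QM M pt -> p <> pt ->
  normal_coords_Q M H Q -> lead_normalized M p Q -> 0 < t -> 0 < r ->
  scale_factor t r p.1 (nM M p) p.2 = 1 ->
  exists H' Q', [/\ normal_coords_Q M H' Q', lead_normalized M p Q' &
    Q' [tuple pt.1; nM M pt; pt.2] = scale_factor t r pt.1 (nM M pt) pt.2 * Q [tuple pt.1; nM M pt; pt.2]].
Proof.
move=> hp hpt ne hQ hl t0 r0 hc; have N2 := QM_deg2 hp hpt ne; have N2t := QM_deg2 hpt hp (fun e => ne (esym e)).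
have a1 := QM_pos hp; have b1 := QM_pos hpt.
have [_ hall] := QM_has_pair hp N2; have [_ hallt] := QM_has_pair hpt N2t.
have z0 := @zcvar R 2 (inord 0). have z1 := @zcvar R 2 (inord 1). have z10 := @zcvar R 1 (inord 0).
have zF : zc (fC t * 'x_0 : fps R 2) by zc_tac.
have zG : zc (fC r * 'x_0 : fps R 1) by zc_tac.
have [||||fT [Q' hQ' ht]] := fixed_curve_coords hQ zF zG.
- by fs; rewrite mulr0.
- by rewrite fconjM fconjC fconj_var conjc_ge0 // ltW.
- by rewrite fcf_CM coef_var2_0 mulr1; apply/eqP; rewrite gt_eqF.
- by rewrite fcf_CM -['x_0]expr1 coef1_X mulr1; apply/eqP; rewrite gt_eqF.
set T := (_, _) in fT hQ' ht.
have [_ nQ _] := hQ; have [_ nQ' _] := hQ'.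
have gE : lin_z T = t by rewrite /lin_z /T /= fcf_CM coef_var2_0 mulr1.
have rE : lin_w T = r by rewrite /lin_w /T /= coef_x1_2 /= fcf_CM -['x_0]expr1 coef1_X mulr1.
have rn : r <> 0 by apply/eqP; rewrite gt_eqF.
have factor m : (1 <= m.1)%N -> (2 <= m.1 + m.2)%N -> has_pair m (nM M m) Q ->
   Q' [tuple m.1; nM M m; m.2] = scale_factor t r m.1 (nM M m) m.2 * Q [tuple m.1; nM M m; m.2].
  move=> m1 m2 hm; have [_ _ e] := has_pair_trans m1 m2 fT nQ nQ' ht hm.
  rewrite gE rE -scale_factorE // -mulrA in e; apply: (mulfI _ e); exact/eqP.
exists (coords_comp H T), Q'; split=> //; last by apply: factor => //; apply: hallt hQ.
apply/lead_normalizedE => i.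
have [->|/eqP hi] := eqVneq i (nM M p).
  by rewrite factor //; [rewrite hc mul1r (lead_normalizedE M p Q).1 // eqxx|apply: hall hQ].
have [hs hlow hn] := hall _ _ hQ.
have [t1 t2 hb g0 r0'] := trans_data fT nQ nQ' ht.
have hl' := lead_coef_trans t1 t2 nQ nQ' hb ht a1 N2 hs r0'.
have f0E : fsubst (fconj T.1) [tuple 'x_0; 0] = fC ((t^*)%C) * 'x_0 :> fps R 1 by rewrite /T /=; fs.
have zt : zct ([tuple fC ((t^*)%C) * 'x_0] : 1.-tuple (fps R 1)) by zc_tac.
rewrite f0E hl fscaleE fexpE fsubstM // fsubstC // fsubstX // fsubst_var // tnthE exprMn -fCX !mulrA -!fCM in hl'.
have := congr1 (fun f : fps R 1 => f [tuple i]) hl'.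
rewrite !fcf_CM coef1_X; move/eqP: hi => /negbTE -> ; rewrite mulr0 => /eqP.
by rewrite mulf_eq0 => /orP[/eqP /r0' //|/eqP].
Qed.

(** ** The constants [c] and [epsilon] *)

Lemma caseBE M p pt : caseA M p pt = false ->
  pt.2%:Z * (p.1%:Z + (nM M p)%:Z) - p.2%:Z * (pt.1%:Z + (nM M pt)%:Z) !=
  (p.1%:Z + (nM M p)%:Z) - (pt.1%:Z + (nM M pt)%:Z).
Proof. by rewrite /caseA => ->. Qed.

(** In case A the value is attained by definition. In case B the modulus is
    brought to [2] by real scalings. *)
Lemma cM_attained M p pt : QM M p -> QM M pt -> p <> pt -> p.1 <> nM M p ->
  [/\ cM M p pt <> 0, complex.Im (cM M p pt) = 0 & exists H Q,
     [/\ normal_coords_Q M H Q, lead_normalized M p Q &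
         `|Q [tuple pt.1; nM M pt; pt.2]| = cM M p pt]].
Proof.
move=> hp hpt ne an; have N2 := QM_deg2 hp hpt ne; have N2t := QM_deg2 hpt hp (fun e => ne (esym e)).
have [[H0 [Q0 h0]] _] := QM_has_pair hp N2; have [_ hallt] := QM_has_pair hpt N2t.
have [H [Q [hQ hl]]] := lead_normalized_exists hp N2 an h0.
suff [H' [Q' [h1 h2 h3]]] : exists H Q, [/\ normal_coords_Q M H Q, lead_normalized M p Q &
         `|Q [tuple pt.1; nM M pt; pt.2]| = cM M p pt].
  have [_ _ hn] := hallt _ _ h1; split; last by exists H', Q'.
    by rewrite -h3 => /eqP; rewrite normr_eq0 => /eqP.
  by apply: ger0_Im; rewrite -h3 normr_ge0.
rewrite /cM; case hA : (caseA M p pt).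
  set S := (X in xget 0 X).
  have : S (xget 0 S).
    by apply: xgetPex; exists `|coefchi Q pt.1 pt.2 [tuple nM M pt]|; exists H, Q.
  by move=> [H' [Q' [h1 h2 h3]]]; exists H', Q'; split.
have [_ _ /eqP hn] := hallt _ _ hQ.
have [|t [r [t0 r0 e1 e2]]] := @scaling_exists R p.1 (nM M p) p.2 pt.1 (nM M pt) pt.2 (2 / `|Q [tuple pt.1; nM M pt; pt.2]|) _ (caseBE hA).
  by rewrite divr_gt0 ?normr_gt0 // ltr0n.
have [H' [Q' [h1 h2 h3]]] := rescaled_coords hp hpt ne hQ hl t0 r0 e1.
exists H', Q'; split=> //; rewrite h3 e2 normrM normrM normfV normr_id divfK ?normr_eq0 //.
by rewrite ger0_norm // ler0n.
Qed.

Lemma second_normalizedE M p pt e Q : has_pair pt (nM M pt) Q ->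
  (second_normalized M p pt e Q <-> Q [tuple pt.1; nM M pt; pt.2] = 'i%C * cM M p pt * e).
Proof.
move=> [_ hlow _]; split=> [h|h m].
  by rewrite -coefchiE h ?mdeg1 // fexp_x0 eqxx.
have [i ->] := tuple1P m; rewrite mdeg1 ltnS leq_eqVlt => /orP[/eqP ->|hi].
  by rewrite coefchiE h fexp_x0 eqxx.
by rewrite coefchiE hlow // fexp_x0 ltn_eqF.
Qed.

Lemma norm_im : `|'i%C : C| = 1.
Proof.
have := sqr_normc ('i%C : C); have -> : (('i%C : C)^*)%C = - 'i%C.
  by apply/eqP; rewrite eq_complex /= oppr0 !eqxx.
rewrite mulrN -expr2 sqr_i opprK => h; apply/eqP.
by rewrite -(@pexpr_eq1 _ _ 2) // h eqxx.
Qed.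

Lemma pair_coef_trans M m T H Q Q' : QM M m -> (2 <= m.1 + m.2)%N ->
  normal_coords_Q M H Q -> formal_coords T -> normal_coords_Q M (coords_comp H T) Q' ->
  [/\ lin_z T <> 0, lin_w T <> 0, ((lin_w T)^*)%C = lin_w T &
  Q' [tuple m.1; nM M m; m.2] = scale_factor (lin_z T) (lin_w T) m.1 (nM M m) m.2 * Q [tuple m.1; nM M m; m.2]].
Proof.
move=> hm N2 hQ fT hQ'; have ht := trans_of hQ fT hQ'; have m1 := QM_pos hm.
have [_ nQ _] := hQ; have [_ nQ' _] := hQ'; have [_ hall] := QM_has_pair hm N2.
have [t1 t2 hb g0 r0] := trans_data fT nQ nQ' ht.
have [_ hr e] := has_pair_trans m1 N2 fT nQ nQ' ht (hall _ _ hQ).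
split=> //; rewrite -scale_factorE // -mulrA in e; apply: (mulfI _ e); exact/eqP.
Qed.

(** With [g = F_z (0)], normalization at the first pair makes [v = g / conj g] a
    root of unity of order dividing [al - n]; the square of the unimodular factor
    at the second pair is a power of [v]. *)
Lemma candidates_roots M p pt e e' : QM M p -> QM M pt -> p <> pt -> p.1 <> nM M p ->
  epsilon_candidates M p pt e -> epsilon_candidates M p pt e' ->
  e' ^+ (((p.1 - nM M p) + (nM M p - p.1)).*2) = e ^+ (((p.1 - nM M p) + (nM M p - p.1)).*2).
Proof.
move=> hp hpt ne an [ne1 [H [Q [hQ hl hs]]]] [ne1' [H' [Q' [hQ' hl' hs']]]].
have N2 := QM_deg2 hp hpt ne; have N2t := QM_deg2 hpt hp (fun e => ne (esym e)).
have [/eqP c0 _ _] := cM_attained hp hpt ne an.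
have [_ hallt] := QM_has_pair hpt N2t.
have [T [fT eH _]] := normal_coords_trans hQ hQ'; rewrite eH in hQ'.
have [/eqP g0 /eqP r0 hr e1] := pair_coef_trans hp N2 hQ fT hQ'.
have [_ _ _ e2] := pair_coef_trans hpt N2t hQ fT hQ'.
rewrite (lead_normalizedE M p Q).1 // (lead_normalizedE M p Q').1 // eqxx in e1.
rewrite (second_normalizedE p e (hallt _ _ hQ)).1 // (second_normalizedE p e' (hallt _ _ hQ')).1 // in e2.
have i0 : (2 * 'i%C : C) != 0 by rewrite mulf_neq0 ?two_neq0 ?im_neq0.
have {}e1 : scale_factor (lin_z T) (lin_w T) p.1 (nM M p) p.2 = 1.
  by apply: (mulIf i0); rewrite -e1 mul1r.
have {}e2 : e' = scale_factor (lin_z T) (lin_w T) pt.1 (nM M pt) pt.2 * e.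
  have ic0 : 'i%C * cM M p pt != 0 by rewrite mulf_neq0 ?im_neq0.
  by apply: (mulfI ic0); rewrite e2 mulrCA.
have en : e != 0 by rewrite -normr_gt0 ne1 ltr01.
have eN : e * (e^*)%C = 1 by rewrite conj_norm1.
have eN' : e' * (e'^*)%C = 1 by rewrite conj_norm1.
move: g0 r0 hr e1 e2; set g := lin_z T; set r := lin_w T => g0 r0 hr e1 e2.
have gc0 : (g^*)%C != 0 by rewrite conjc_eq0.
have conjcz (z : int) : ((r ^ z)^*)%C = r ^ z.
  case: z => n; first by rewrite -exprnP conjcX hr.
  by rewrite NegzE -exprnN conjc_inv conjcX hr.
have cf a n mu : (scale_factor g r a n mu)^*%C * g ^+ a * (g^*)%C ^+ n = scale_factor g r a n mu * (g^*)%C ^+ a * g ^+ n.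
  by rewrite /scale_factor !conjcM !conjcX conjcK conjcz; ring.
pose v := g / (g^*)%C.
have v0 : v != 0 by rewrite mulf_neq0 ?invr_neq0.
have hv : v ^+ p.1 = v ^+ nM M p.
  have := cf p.1 (nM M p) p.2; rewrite e1 conjc1 !mul1r => h.
  apply: (mulIf (expf_neq0 p.1 gc0)); apply: (mulIf (expf_neq0 (nM M p) gc0)).
  by rewrite /v !expr_div_n divfK ?expf_neq0 // h mulrAC divfK ?expf_neq0 // mulrC.
have vN : v ^+ ((p.1 - nM M p) + (nM M p - p.1)) = 1.
  have [le|le] := leqP p.1 (nM M p).
    rewrite (eqP le) add0n; apply: (mulIf (expf_neq0 p.1 v0)).
    by rewrite -exprD subnK // mul1r hv.
  rewrite (eqP (ltnW le)) addn0; apply: (mulIf (expf_neq0 (nM M p) v0)).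
  by rewrite -exprD subnK ?(ltnW le) // mul1r hv.
have cfx := cf pt.1 (nM M pt) pt.2.
move: e2 cfx; move: (scale_factor g r pt.1 (nM M pt) pt.2) => x e2 cfx.
have xN : x * (x^*)%C = 1.
  by move: eN'; rewrite e2 conjcM mulrACA eN mulr1.
have x2 : x ^+ 2 * v ^+ nM M pt = v ^+ pt.1.
  move: cfx => /(congr1 (fun y => x * y)) /=; rewrite !mulrA xN mul1r => h.
  apply: (mulIf (expf_neq0 pt.1 gc0)); apply: (mulIf (expf_neq0 (nM M pt) gc0)).
  rewrite /v !expr_div_n [in RHS]divfK ?expf_neq0 // h.
  have := expf_neq0 (nM M pt) gc0.
  move: ((g^*)%C ^+ nM M pt) (g ^+ nM M pt) ((g^*)%C ^+ pt.1) => a b c a0.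
  by field.
have xx : x ^+ (((p.1 - nM M p) + (nM M p - p.1)).*2) = 1.
  rewrite -mul2n exprM; apply: (mulIf (expf_neq0 ((p.1 - nM M p) + (nM M p - p.1)) (expf_neq0 (nM M pt) v0))).
  by rewrite -exprMn x2 mul1r -!exprM ![(_ * (_ + _))%N]mulnC !exprM vN !expr1n.
by rewrite e2 exprMn xx mul1r.
Qed.

Lemma seq_min (T : eqType) (P : T -> Prop) (f : T -> R) (s : seq T) :
  (exists2 x, x \in s & P x) ->
  exists x, P x /\ forall y, y \in s -> P y -> f x <= f y.
Proof.
elim: s => [|a s IH] [x]; first by [].
rewrite inE => hx Px.
have [[y ys Py]|hn] := pselect (exists2 y, y \in s & P y); last first.
  have ex : x = a by case/orP: hx => [/eqP //|xs]; case: hn; exists x.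
  exists a; split; first by rewrite -ex.
  move=> y; rewrite inE => /orP[/eqP -> //|ys Py]; by case: hn; exists y.
have [z [Pz hz]] := IH (ex_intro2 _ _ y ys Py).
have [[Pa lt]|hn] := pselect (P a /\ f a < f z).
  exists a; split=> // w; rewrite inE => /orP[/eqP -> //|ws Pw].
  by apply: le_trans (ltW lt) (hz _ ws Pw).
exists z; split=> // w; rewrite inE => /orP[/eqP -> Pa|ws Pw]; last exact: hz.
by rewrite leNgt; apply/negP => lt; apply: hn.
Qed.

(** The candidates are roots of one polynomial, so the smallest argument is
    attained. *)
Lemma epsilonP M p pt : QM M p -> QM M pt -> p <> pt -> p.1 <> nM M p ->
  epsilon_candidates M p pt (epsilonM M p pt).
Proof.
move=> hp hpt ne an; have [c0 _ [H [Q [hQ hl hc]]]] := cM_attained hp hpt ne an.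
have N2t := QM_deg2 hpt hp (fun e => ne (esym e)).
have [_ hallt] := QM_has_pair hpt N2t.
set K := Q _ in hc; pose e0 := K / ('i%C * cM M p pt).
have ic0 : 'i%C * cM M p pt != 0 by rewrite mulf_neq0 ?im_neq0 //; apply/eqP.
have e0P : epsilon_candidates M p pt e0.
  split; last first.
    exists H, Q; split=> //; apply/second_normalizedE; first exact: hallt hQ.
    by rewrite -/K /e0 mulrCA divff // mulr1.
  rewrite /e0 normrM normfV normrM norm_im mul1r hc -hc normr_id divff //.
  by rewrite hc; apply/eqP.
set N := ((p.1 - nM M p) + (nM M p - p.1)).*2.
have N0 : (0 < N)%N by rewrite /N; lia.
pose P : {poly C} := 'X^N - (e0 ^+ N)%:P.
have [rs eP] := closed_field_poly_normal P.
have lc : lead_coef P = 1 by apply/monicP; exact: monicXnsubC.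
have hrs e : epsilon_candidates M p pt e -> e \in rs.
  move=> he; have : root P e.
    by rewrite /root /P !hornerE (candidates_roots hp hpt ne an e0P he) subrr.
  by rewrite eP lc scale1r root_prod_XsubC.
have [e [he hmin]] := seq_min (@uarg R) (ex_intro2 _ _ e0 (hrs _ e0P) e0P).
rewrite /epsilonM; set S := (X in xget 0 X).
have : S (xget 0 S); last by case.
by apply: xgetPex; exists e; split=> // e' he'; apply: hmin => //; apply: hrs.
Qed.

Lemma start_coords M p pt : QM M p -> QM M pt -> p <> pt -> p.1 <> nM M p ->
  exists H Q, [/\ normal_coords_Q M H Q, lead_normalized M p Q &
                  second_normalized M p pt (epsilonM M p pt) Q].
Proof. by move=> hp hpt ne an; have [_] := epsilonP hp hpt ne an. Qed.

End Start.

(** * Elementary moves of one level *)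
Section Moves.
Variable R : realType.
Local Notation C := R[i].
Local Notation A := (fps R 3).
Implicit Types (M : formal_hypersurface R) (H T : fps R 2 * fps R 2) (Q : A).

Definition close (k : nat) (T T' : fps R 2 * fps R 2) :=
  ford k (T.1 - T'.1) /\ ford k (T.2 - T'.2).

(** A real curve on [M] with first component [a w^k]: its second component is
    found by prescribing the real part [w], which the implicit function theorem
    allows; uniqueness makes the solution compatible with conjugation. *)
Lemma curve_exists Q k (a : C) (phi : fps R 1 := fC a * 'x_0 ^+ k) : normal_Q Q -> (1 <= k)%N ->
  exists g : fps R 1, [/\ zc g, g = fsubst Q [tuple phi; fconj phi; fconj g] & ford k.+1 (g - 'x_0)].
Proof.
move=> nQ k1; have zQ := normalQ_zc nQ.
have zphi : zc phi by rewrite /phi; have z := @zcvar R 1 (inord 0); zc_tac.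
have z43 := @zcvar R 4 (inord 3). have z41 := @zcvar R 4 (inord 1). have z10 := @zcvar R 1 (inord 0).
pose phi4 (b : C) : fps R 4 := fC b * 'x_3 ^+ k.
have zphi4 b : zc (phi4 b) by rewrite /phi4; zc_tac.
pose P : fps R 4 := 'x_1 - fsubst Q [tuple phi4 a; phi4 ((a^*)%C); fC 2 * 'x_3 - 'x_1].
have zP : zc P by rewrite /P; have za := zphi4 a; have zb := zphi4 ((a^*)%C); zc_tac.
have P1 : P (munit (inord 1)) <> 0.
  rewrite /P fcfB normalQ_munit //; last by zc_tac.
  rewrite fcfB fcf_CM /fvar munit_eq munit_eq eqxx inord_neq // mulr0 add0r opprK.
  by apply/eqP; rewrite -natrD pnatr_eq0.
have PE (w c : fps R 1) : zc w -> zc c -> fsubst P [tuple 0; w; 0; c] =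
    w - fsubst Q [tuple fC a * c ^+ k; fC (a^*)%C * c ^+ k; fC 2 * c - w].
  move=> zw zc'; rewrite /P /phi4.
  have za := zphi4 a; have zb := zphi4 ((a^*)%C); rewrite /phi4 in za zb.
  by fs.
have [Y zY eY] := ift zP P1.
pose g : fps R 1 := fsubst Y [tuple 0; 0; 'x_0].
have zg : zc g by rewrite /g; zc_tac.
have phic : fconj phi = fC (a^*)%C * 'x_0 ^+ k by rewrite /phi fconjM fconjC fconjX fconj_var.
have eg : g = fsubst Q [tuple phi; fconj phi; fC 2 * 'x_0 - g].
  have := congr1 (fun f : A => fsubst f ([tuple 0; 0; 'x_0] : 3.-tuple (fps R 1))) eY.
  rewrite /= fsubst0 fsubstA; [rewrite tcompE|zc_tac|zc_tac].
  have -> : fsubst 'x_0 [tuple 0; 0; 'x_0] = 0 :> fps R 1 by fs.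
  have -> : fsubst 'x_1 [tuple 0; 0; 'x_0] = 0 :> fps R 1 by fs.
  have -> : fsubst 'x_2 [tuple 0; 0; 'x_0] = 'x_0 :> fps R 1 by fs.
  by rewrite -/g PE // phic => /eqP; rewrite subr_eq0 => /eqP.
have c2 : ((2 : C)^*)%C = 2 := conjc_nat R 2.
have egc : fconj g = fC 2 * 'x_0 - g.
  have zg' : zc (fC 2 * 'x_0 - fconj g) by zc_tac.
  have e' : fC 2 * 'x_0 - fconj g = fsubst Q [tuple phi; fconj phi; fconj g].
    have ec : fconj g = fsubst (fconj Q) [tuple fconj phi; phi; fC 2 * 'x_0 - fconj g].
      by rewrite {1}eg fconj_subst tconjE fconjK fconjD fconjN fconjM fconjC fconj_var c2.
    by rewrite -[LHS](normalQ3 nQ (a := phi) (b := fconj phi)) -?ec //; zc_tac.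
  suff : fC 2 * 'x_0 - fconj g = g by move=> e; rewrite -[in RHS]e; ring.
  apply: (ift_uniq (P := P) (a := 0) (b := 0) (c := 'x_0)) => //.
  rewrite !PE // -phic -/phi (_ : fC 2 * 'x_0 - (fC 2 * 'x_0 - fconj g) = fconj g); last by ring.
  by rewrite -e' -eg !subrr.
exists g; split=> //; first by rewrite egc.
have [|||V eV V0] := @fsubst_mean R 3 1 Q [tuple phi; fconj phi; fconj g] [tuple phi; 0; fconj g] (inord 1).
- by zc_tac.
- by zc_tac.
- by apply: forall_ord3 => /eqP h; rewrite !tnthE //; case: h.
rewrite !tnthE subr0 (normalQ1 nQ) // ?egc -?eg in eV; last by zc_tac.
have o : ford k.+1 (fC 2 * (g - 'x_0)).
  rewrite (_ : fC 2 * _ = g - (fC 2 * 'x_0 - g)); last by rewrite fCnat; ring.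
  rewrite eV -[k.+1]addn1; apply: fordM; last by apply: ford1; rewrite /zc V0 normalQ_lin.
  by rewrite phic; apply: fordMr; apply: fordX.
move=> m hm; have := o m hm; rewrite fcf_CM => /eqP.
by rewrite mulf_eq0 pnatr_eq0 /= => /eqP.
Qed.

Lemma coef_x1k_2 (f : fps R 1) k b c : (fsubst f [tuple 'x_0] * 'x_1 ^+ k : fps R 2) [tuple b; c] =
  if c == k then f [tuple b] else 0.
Proof.
have e : 'x_1 ^+ k = mon R ([tuple 0%N; k] : mindex 2) by rewrite -gmon_vars vars2 gmon2 expr0 mul1r.
have m2 x y x' y' : madd [tuple x; y] [tuple x'; y'] = [tuple x + x'; y + y']%N :> mindex 2.
  by apply: eq_from_tnth; apply: forall_ord2; rewrite tnth_madd !tnthE.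
rewrite mulrC e; have [->|/eqP ne] := eqVneq c k.
  have -> : [tuple b; k] = madd [tuple 0%N; k] [tuple b; 0%N] by rewrite m2 addn0.
  by rewrite fcf_monM coef_x0_2.
have [lt|le] := ltnP c k.
  by apply: fcf_monM0 => l; have [x [y ->]] := tuple2P l; rewrite m2 => -[_ h]; lia.
have -> : [tuple b; c] = madd [tuple 0%N; k] [tuple b; (c - k)%N] by rewrite m2 subnKC.
by rewrite fcf_monM coef_x0_2; case: eqP => // h; lia.
Qed.

(** The second component is the one that [base] attaches to [F = z + a w^k] and
    to the real curve. *)
Lemma curve_move M H Q k (a : C) : normal_coords_Q M H Q -> (1 <= k)%N ->
  exists T Q', [/\ formal_coords T /\ normal_coords_Q M (coords_comp H T) Q', trans T Q Q',
    near_id T k k, T.1 [tuple 0%N; k] = a & close k T (idcoords R)].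
Proof.
move=> hQ k1; have [_ nQ _] := hQ; have zQ := normalQ_zc nQ.
have [g [zg eg og]] := curve_exists a nQ k1.
have z0 := @zcvar R 2 (inord 0). have z1 := @zcvar R 2 (inord 1). have z10 := @zcvar R 1 (inord 0).
pose F : fps R 2 := 'x_0 + fC a * 'x_1 ^+ k.
have zF : zc F by rewrite /F; zc_tac.
pose G : fps R 2 := fsubst Q [tuple F; fC (a^*)%C * 'x_1 ^+ k; fsubst (fconj g) [tuple 'x_1]].
have zG : zc G by rewrite /G; zc_tac.
have F0 : fsubst F [tuple 0; 'x_1] = fC a * 'x_1 ^+ k :> fps R 2 by rewrite /F; fs; rewrite add0r.
have F0c : fsubst (fconj F) [tuple 0; 'x_1] = fC (a^*)%C * 'x_1 ^+ k :> fps R 2.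
  by apply: fconj_inj; rewrite fconj_subst tconjE fconj_var fconj0 fconjK F0 fconjM fconjC fconjX fconj_var conjcK.
have G0 : fsubst G [tuple 0; 'x_1] = fsubst g [tuple 'x_1] :> fps R 2.
  have zphi : zc (fC a * 'x_0 ^+ k : fps R 1) by zc_tac.
  rewrite [in RHS]eg /G fsubstA; [rewrite tcompE F0|zc_tac|zc_tac].
  by rewrite fconjM fconjC fconjX fconj_var; fs.
have G0c : fsubst (fconj G) [tuple 0; 'x_1] = fsubst (fconj g) [tuple 'x_1] :> fps R 2.
  by apply: fconj_inj; rewrite !fconj_subst !tconjE fconj_var fconj0 !fconjK G0.
have hb : base (F, G) Q by rewrite /base /= F0c G0c.
have coefF b c : F [tuple b; c] = ((b == 1%N) && (c == 0%N))%:R + a * ((b == 0%N) && (c == k))%:R.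
  by rewrite /F fcfD fcf_CM coef_var2_0 coef_var2_1X.
have coefG0 c : G [tuple 0%N; c] = g [tuple c].
  have [|||V e _] := @fsubst_mean R 2 2 G [tuple 'x_0; 'x_1] [tuple 0; 'x_1] (inord 0).
  - by zc_tac.
  - by zc_tac.
  - by apply: forall_ord2 => /eqP h; rewrite !tnthE //; case: h.
  rewrite fsubst_id2 !tnthE subr0 G0 in e.
  have := congr1 (fun f : fps R 2 => f [tuple 0%N; c]) e; rewrite fcfB coef_x1_2 /=.
  rewrite fcf_monM0; first by move/eqP; rewrite subr_eq0 => /eqP.
  by move=> l /(congr1 (fun t => tnth t (inord 0))); rewrite tnth_madd tnth_munit eqxx tnthE.
have gE c : (c <= k)%N -> g [tuple c] = (c == 1%N)%:R.
  move=> hc; have : (g - 'x_0) [tuple c] = 0 by apply: og; rewrite mdeg1.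
  by rewrite fcfB -['x_0]expr1 coef1_X => /eqP; rewrite subr_eq0 => /eqP.
have fT : formal_coords (F, G).
  apply/formal_coordsE; split=> //=.
  have e0 : G (munit (inord 0)) = 0 := base_Gz (T := (F, G)) zF zG nQ hb.
  rewrite e0 mulr0 subr0 !munit2E // coefF coefG0 gE //=.
  by rewrite mulr0 addr0 mulr1; apply/eqP; rewrite oner_neq0.
have [Q' hQ' ht] := normal_coords_of hQ fT hb.
exists (F, G), Q'; split=> //=.
- split=> [b c hc|c hc|c hc] /=.
  + by rewrite coefF (ltn_eqF hc) andbF mulr0 addr0.
  + by rewrite coefF (ltn_eqF hc) mulr0 addr0.
  + by rewrite coefG0 gE.
- by rewrite coefF !eqxx mulr1 add0r.
- split=> /=; first by rewrite /F addrAC subrr add0r; apply: fordMr; apply: fordX.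
  rewrite -[X in _ - X](normalQ1 nQ z0 z1); apply: fsubst_cong; apply: forall_ord3; rewrite !tnthE.
  + by rewrite /F addrAC subrr add0r; apply: fordMr; apply: fordX.
  + by rewrite subr0; apply: fordMr; apply: fordX.
  + have -> : fsubst (fconj g) [tuple 'x_1] - 'x_1 = fsubst (fconj (g - 'x_0)) [tuple 'x_1] :> fps R 2.
      by rewrite fconjD fconjN fconj_var; fs.
    apply: ford_subst; first by zc_tac.
    by apply: fordW (ford_conj og).
Qed.

Lemma fixed_move M H Q k (f : fps R 1) (g : C) : normal_coords_Q M H Q -> (1 <= k)%N ->
  zc f -> (g^*)%C = g ->
  exists T Q', [/\ formal_coords T /\ normal_coords_Q M (coords_comp H T) Q', trans T Q Q',
    near_id T k k.+1, (forall b, T.1 [tuple b; k] = f [tuple b]) /\ T.2 [tuple 0%N; k.+1] = g & close k T (idcoords R)].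
Proof.
move=> hQ k1 zf hg.
have z0 := @zcvar R 2 (inord 0). have z1 := @zcvar R 2 (inord 1). have z10 := @zcvar R 1 (inord 0).
pose F : fps R 2 := 'x_0 + fsubst f [tuple 'x_0] * 'x_1 ^+ k.
pose G : fps R 1 := 'x_0 + fC g * 'x_0 ^+ k.+1.
have zF : zc F by rewrite /F; zc_tac.
have zG : zc G by rewrite /G; zc_tac.
have coefF b c : F [tuple b; c] = ((b == 1%N) && (c == 0%N))%:R + (if c == k then f [tuple b] else 0).
  by rewrite /F fcfD coef_var2_0 coef_x1k_2.
have coefG c : G [tuple c] = (c == 1%N)%:R + g * (c == k.+1)%:R.
  by rewrite /G fcfD fcf_CM coef1_X -['x_0]expr1 coef1_X.
have [||||fT [Q' hQ' ht]] := fixed_curve_coords hQ zF zG.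
- rewrite /F; fs; rewrite add0r (_ : fsubst f [tuple 0] = 0) ?mul0r //.
  apply: fpsP => m; rewrite fsubstE0 big1 // => l _; have [e ->] := tuple1P l.
  rewrite gmon1 expr0n; case: e => [|e]; last by rewrite mulr0.
  by rewrite -mzero1E -[f _]/(fcoef0 f) zf mul0r.
- by rewrite /G fconjD fconjM fconjC fconjX fconj_var hg.
- by rewrite coefF /= eq_sym eqn0Ngt k1 addr0; apply/eqP; rewrite oner_neq0.
- by rewrite coefG /= eqSS eq_sym eqn0Ngt k1 mulr0 addr0; apply/eqP; rewrite oner_neq0.
exists (F, fsubst G [tuple 'x_1]), Q'; split=> //=.
- split=> [b c hc|c hc|c hc] /=.
  + by rewrite coefF (ltn_eqF hc) addr0.
  + rewrite coefF add0r; case: eqP => // _.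
    by rewrite -mzero1E; exact: zf.
  + by rewrite coef_x1_2 /= coefG (ltn_eqF (_ : (c < k.+1)%N)) // mulr0 addr0.
- split=> [b|]; last by rewrite coef_x1_2 /= coefG (eqxx k.+1) eqSS eqn0Ngt k1 add0r mulr1.
  by rewrite coefF (eqxx k) eqn0Ngt k1 andbF add0r.
- split=> /=; first by rewrite /F addrAC subrr add0r; apply: fordMr; apply: fordX.
  have -> : fsubst G [tuple 'x_1] - 'x_1 = fC g * 'x_1 ^+ k.+1 :> fps R 2 by rewrite /G; fs; ring.
  by apply: fordMr; apply: fordW (fordX (e := k.+1) z1).
Qed.

End Moves.

(** * The linear system of one level *)
Section LevelSystem.
Variable R : realType.
Local Notation C := R[i].
Implicit Types (f v : C) (g u : R).

(** The factor of the leading coefficient at [chi^n] by which a transition with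
    data [f_1 = f] and [g] moves the coefficient of level [k]. *)
Definition level_form f g (al n mu k : nat) : C := f *+ al + (f^*)%C *+ n + (g * (mu%:R - k.+1%:R))%:C%C.

Lemma level_form_Re f g al n mu k :
  complex.Re (level_form f g al n mu k) = (al + n)%:R * complex.Re f + (mu%:R - k.+1%:R) * g.
Proof.
rewrite /level_form; case: f => x y /=.
by rewrite !raddfD /= !Re_mulnat /= mulrDl !mulr_natl [g * _]mulrC.
Qed.

Lemma level_form_Im f g al n mu k :
  complex.Im (level_form f g al n mu k) = (al%:R - n%:R) * complex.Im f.
Proof.
rewrite /level_form; case: f => x y /=.
by rewrite !raddfD /= !Im_mulnat /= addr0 mulrBl !mulr_natl mulNrn.
Qed.

Lemma complex_eq f v : complex.Re f = complex.Re v -> complex.Im f = complex.Im v -> f = v.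
Proof. by case: f v => a b [c d] /= -> ->. Qed.

Lemma natr_sub_neq0 (a n : nat) : a <> n -> (a%:R - n%:R : R) != 0.
Proof. by move=> h; rewrite subr_eq0 eqr_nat; apply/eqP. Qed.

Variables (al n mu al' n' mu' k : nat).
Hypotheses (an : al <> n) (al1 : (1 <= al)%N).

(** This is [(k + 1) D_k]. *)
Definition level_det : R := (al + n)%:R * (mu'%:R - k.+1%:R) - (mu%:R - k.+1%:R) * (al' + n')%:R.

Let an0 : ((al + n)%:R : R) != 0.
Proof. by rewrite pnatr_eq0 -lt0n; lia. Qed.

Lemma level_solve1 v : exists f, level_form f 0 al n mu k = v.
Proof.
have d0 := natr_sub_neq0 an.
exists (Complex (complex.Re v / (al + n)%:R) (complex.Im v / (al%:R - n%:R))).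
by apply: complex_eq; rewrite ?level_form_Re ?level_form_Im /= ?mulr0 ?addr0 mulrCA divff ?mulr1.
Qed.

Lemma level_solve2 v u : level_det != 0 -> exists f g, level_form f g al n mu k = v /\
  complex.Re (level_form f g al' n' mu' k) = u.
Proof.
rewrite /level_det => D0; have d0 := natr_sub_neq0 an.
set a := ((al + n)%:R : R) in D0; set a' := ((al' + n')%:R : R) in D0.
set b := (mu%:R - k.+1%:R : R) in D0; set b' := (mu'%:R - k.+1%:R : R) in D0.
exists (Complex ((complex.Re v * b' - b * u) / (a * b' - b * a')) (complex.Im v / (al%:R - n%:R))).
exists ((a * u - a' * complex.Re v) / (a * b' - b * a')); split.
  apply: complex_eq; rewrite ?level_form_Re ?level_form_Im /= -?/a -?/b.
    by move: (complex.Re v) D0 => w; clearbody a a' b b' => D0; field.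
  by rewrite mulrCA divff ?mulr1.
rewrite level_form_Re /= -/a' -/b'.
by move: (complex.Re v) D0 => w; clearbody a a' b b' => D0; field.
Qed.

Lemma level_uniq1 f : level_form f 0 al n mu k = 0 -> f = 0.
Proof.
move=> h; have := level_form_Re f 0 al n mu k; have := level_form_Im f 0 al n mu k.
rewrite h /= mulr0 addr0 => /esym/eqP; rewrite mulf_eq0 (negbTE (natr_sub_neq0 an)) => /eqP i0.
move/esym/eqP; rewrite mulf_eq0 (negbTE an0) => /eqP r0.
exact: complex_eq.
Qed.

Lemma level_uniq2 f g : level_det != 0 -> level_form f g al n mu k = 0 ->
  complex.Re (level_form f g al' n' mu' k) = 0 -> f = 0 /\ g = 0.
Proof.
move=> D0 h1; rewrite level_form_Re => h2; have h3 := level_form_Re f g al n mu k; have := level_form_Im f g al n mu k.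
rewrite h1 /= in h3 *; move/esym/eqP; rewrite mulf_eq0 (negbTE (natr_sub_neq0 an)) => /eqP i0.
have r0 : complex.Re f = 0.
  apply: (mulfI D0); rewrite mulr0 /level_det.
  rewrite [LHS](_ : _ = (mu'%:R - k.+1%:R) * ((al + n)%:R * complex.Re f + (mu%:R - k.+1%:R) * g) -
   (mu%:R - k.+1%:R) * ((al' + n')%:R * complex.Re f + (mu'%:R - k.+1%:R) * g)); last by ring.
  by rewrite h2 -h3 !mulr0 subrr.
have g0 : g = 0.
  apply: (mulfI D0); rewrite mulr0 /level_det.
  rewrite [LHS](_ : _ = (al + n)%:R * ((al' + n')%:R * complex.Re f + (mu'%:R - k.+1%:R) * g) -
   (al' + n')%:R * ((al + n)%:R * complex.Re f + (mu%:R - k.+1%:R) * g)); last by ring.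
  by rewrite h2 -h3 !mulr0 subrr.
by split=> //; apply: complex_eq.
Qed.

End LevelSystem.

Section KSet.
Variable R : realType.
Implicit Types (M : formal_hypersurface R).

Lemma detDE M p pt k : detD M p pt k =
  level_det R p.1 (nM M p) p.2 pt.1 (nM M pt) pt.2 k / k.+1%:R.
Proof.
rewrite /detD (expand_det_row _ ord0) !big_ord_recl big_ord0 /cofactor !det_mx11 !mxE /= /level_det.
have k0 : (k.+1%:R : R) != 0 by rewrite pnatr_eq0.
by field; rewrite addrC natr1.
Qed.

Lemma KsetE M p pt k : Kset M p pt k <->
  (1 <= k)%N /\ level_det R p.1 (nM M p) p.2 pt.1 (nM M pt) pt.2 k = 0.
Proof.
rewrite /Kset /= detDE; split=> -[h1]; last by move=> ->; rewrite mul0r.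
by move/eqP; rewrite mulf_eq0 invr_eq0 pnatr_eq0 orbF => /eqP.
Qed.

End KSet.

(** * One step of the normalization *)
Section Form.
Variable R : realType.
Local Notation C := R[i].
Local Notation A := (fps R 3).
Variables (M : formal_hypersurface R) (p pt p' : nat * nat).
Hypotheses (hp : QM M p) (hpt : QM M pt) (ne : p <> pt) (an : p.1 <> nM M p).
Hypotheses (hp'c : p' = p \/ p' = pt) (p'1 : (1 < p'.1)%N).

Let n := nM M p.
Let nt := nM M pt.
Let n' := nM M p'.
Let eps := epsilonM M p pt.
Let c := cM M p pt.

Let N2 : (2 <= p.1 + p.2)%N := QM_deg2 hp hpt ne.
Let N2t : (2 <= pt.1 + pt.2)%N := QM_deg2 hpt hp (fun e => ne (esym e)).
Let hp' : QM M p'. Proof. by case: hp'c => ->. Qed.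
Let N2' : (2 <= p'.1 + p'.2)%N. Proof. by case: hp'c => ->. Qed.

(** The conditions of level [k] in the normal form. *)
Definition nf_cond (Q : A) (k : nat) : Prop :=
  [/\ forall j, (n <= j)%N -> Q [tuple p.1; j; (p.2 + k)%N] = 0,
      Q [tuple (p'.1 - 1)%N; n'; (p'.2 + k)%N] = 0 &
      ~ Kset M p pt k -> complex.Im (eps^-1 * Q [tuple pt.1; nt; (pt.2 + k)%N]) = 0].

Definition nf_upto (Q : A) (k : nat) : Prop :=
  [/\ lead_normalized M p Q, second_normalized M p pt eps Q &
      forall j, (1 <= j)%N -> (j < k)%N -> nf_cond Q j].

Lemma normal_formE (Q : A) : normal_form M p pt p' Q <-> forall k, nf_upto Q k.
Proof.
have eI x j : (0 < j)%N -> complex.Im (x *+ j : C) = 0 <-> complex.Im x = 0.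
  move=> j0; rewrite Im_mulnat; split=> [/eqP|->]; last by rewrite mul0rn.
  by rewrite mulrn_eq0 eqn0Ngt j0 /= => /eqP.
split=> [[[h1 h1'] h2 h3 h4] k|h].
  split=> // j j1 _; split.
  - by move=> i hi; rewrite -coefchiE h2 // mdeg1.
  - by rewrite -coefchiE; apply/fnderiv0_eq0; apply: h3.
  - move=> hK; have := h4 j j1 hK; rewrite fnderiv0E coefchiE mulrnAr.
    by move/eI; apply; exact: fact_gt0.
split.
- by have [h1 h2 _] := h 0%N.
- move=> k k1 m; have [i ->] := tuple1P m; rewrite mdeg1 => hi.
  by have [_ _ /(_ k k1 (ltnSn k)) [h2 _ _]] := h k.+1; rewrite coefchiE; apply: h2.
- move=> k k1; have [_ _ /(_ k k1 (ltnSn k)) [_ h3 _]] := h k.+1.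
  by apply/fnderiv0_eq0.
- move=> k k1 hK; have [_ _ /(_ k k1 (ltnSn k)) [_ _ /(_ hK) h4]] := h k.+1.
  by rewrite fnderiv0E coefchiE mulrnAr; apply/eI => //; exact: fact_gt0.
Qed.

Lemma level_curve_pair m T H (Q Q' : A) k b i l : QM M m -> (2 <= m.1 + m.2)%N ->
  normal_coords_Q M H Q -> formal_coords T -> normal_coords_Q M (coords_comp H T) Q' ->
  (1 <= k)%N -> near_id T k k -> (1 <= b)%N -> (b + l <= m.1.-1 + (m.2 + k))%N -> (l <= m.2 + k)%N ->
  Q' [tuple b; i; l] = Q [tuple b; i; l] +
    (if (b == m.1.-1) && (l == m.2 + k)%N then T.1 [tuple 0%N; k] * Q [tuple m.1; i; m.2] *+ m.1 else 0).
Proof.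
move=> hm m2 hQ fT hQ' k1 hT b1 h1 h2; have ht := trans_of hQ fT hQ'; have m1 := QM_pos hm.
have [_ nQ _] := hQ; have [_ nQ' _] := hQ'; have [_ hall] := QM_has_pair hm m2.
have [t1 t2 hb _ _] := trans_data fT nQ nQ' ht; have [hs _ _] := hall _ _ hQ.
exact: (level_curve t1 t2 nQ nQ' hb ht m1 m2 hs k1 hT).
Qed.

Lemma level_fixed_pair m T H (Q Q' : A) k j : QM M m -> (2 <= m.1 + m.2)%N ->
  normal_coords_Q M H Q -> formal_coords T -> normal_coords_Q M (coords_comp H T) Q' ->
  (1 <= k)%N -> near_id T k k.+1 ->
  Q' [tuple m.1; j; (m.2 + k)%N] = Q [tuple m.1; j; (m.2 + k)%N] +
  (T.1 [tuple 1%N; k] *+ m.1 + T.2 [tuple 0%N; k.+1] *+ m.2 - T.2 [tuple 0%N; k.+1] *+ k.+1)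
    * Q [tuple m.1; j; m.2] + dlead T Q m.1 m.2 k [tuple 0%N; j; 0%N].
Proof.
move=> hm m2 hQ fT hQ' k1 hT; have ht := trans_of hQ fT hQ'; have m1 := QM_pos hm.
have [_ nQ _] := hQ; have [_ nQ' _] := hQ'; have [_ hall] := QM_has_pair hm m2.
have [t1 t2 hb _ _] := trans_data fT nQ nQ' ht; have [hs _ _] := hall _ _ hQ.
exact: (level_fixed t1 t2 nQ nQ' hb ht m1 m2 hs k1 hT).
Qed.

(** Moves of level [k] do not disturb the conditions of lower levels. *)
Lemma nf_keep T H (Q Q' : A) k : normal_coords_Q M H Q -> formal_coords T ->
  normal_coords_Q M (coords_comp H T) Q' -> (1 <= k)%N -> near_id T k k ->
  nf_upto Q k -> nf_upto Q' k.
Proof.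
move=> hQ fT hQ' k1 hT [h1 h2 h3].
have m1 := QM_pos hp; have m1t := QM_pos hpt.
have same m i j : QM M m -> (2 <= m.1 + m.2)%N -> (j < k)%N ->
    Q' [tuple m.1; i; (m.2 + j)%N] = Q [tuple m.1; i; (m.2 + j)%N].
  move=> hm m2 hj; have mm := QM_pos hm.
  rewrite (level_curve_pair i hm m2 hQ fT hQ' k1 hT) //; [|lia|lia].
  by rewrite (_ : (m.1 == m.1.-1) = false) /= ?addr0 //; apply/eqP; lia.
have [_ hallt] := QM_has_pair hpt N2t.
split.
- apply/lead_normalizedE => i; have := same p i 0%N hp N2 k1; rewrite !addn0 => ->.
  exact: (lead_normalizedE M p Q).1.
- apply/second_normalizedE; first exact: hallt hQ'.
  have := same pt (nM M pt) 0%N hpt N2t k1; rewrite !addn0 => ->.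
  by apply/(second_normalizedE p eps (hallt _ _ hQ)).
- move=> j j1 jk; have [c2 c3 c4] := h3 j j1 jk; split.
  + by move=> i hi; rewrite same // c2.
  + rewrite (level_curve_pair n' hp' N2' hQ fT hQ' k1 hT) //; [|lia..].
    rewrite c3 add0r (_ : (p'.2 + j == p'.2 + k)%N = false) ?andbF //.
    by apply/eqP; lia.
  + by move=> hK; rewrite same //; apply: c4.
Qed.

Lemma c_real : c = (complex.Re c)%:C%C.
Proof.
have [_ hI _] := cM_attained hp hpt ne an.
by rewrite /c; move: hI; case: (cM M p pt) => a b /= ->.
Qed.

Lemma eps_neq0 : eps <> 0.
Proof.
by have [h _] := epsilonP hp hpt ne an; move=> e; move: h; rewrite -/eps e normr0 => /eqP; rewrite eq_sym oner_eq0.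
Qed.

(** Since [c] is real, dividing by [eps] turns the imaginary part at the second
    pair into a real part of [level_form]. *)
Lemma Im_second (x z : C) :
  complex.Im (eps^-1 * (x + 'i%C * c * eps * z)) = complex.Im (eps^-1 * x) + complex.Re c * complex.Re z.
Proof.
have e0 : eps != 0 by apply/eqP; exact: eps_neq0.
rewrite mulrDr (_ : eps^-1 * ('i%C * c * eps * z) = 'i%C * (c * z)); last by field.
rewrite raddfD /=; congr (_ + _); rewrite c_real; move: (complex.Re c) => r.
by case: z => a b /=; rewrite !mul0r !mul1r ?subr0 ?add0r ?addr0 ?oppr0 ?mulr0 ?subr0.
Qed.

Lemma Re_c_neq0 : complex.Re c != 0.
Proof.
have [h0 _ _] := cM_attained hp hpt ne an; apply/eqP => e; apply: h0.
by rewrite -/c c_real e.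
Qed.

Lemma level_formE (f : C) (g : R) (a m mu k : nat) :
  f *+ a + (g%:C)%C *+ mu - (g%:C)%C *+ k.+1 + (f^*)%C *+ m = level_form f g a m mu k.
Proof.
rewrite /level_form rmorphM rmorphB !rmorph_nat /= mulrBr !mulr_natr; ring.
Qed.

Lemma coords_comp_close k H T : formal_coords H -> formal_coords T -> close k T (idcoords R) ->
  close k (coords_comp H T) H.
Proof.
move=> fH fT [h1 h2]; have e := coords_comp1 H.
by split; rewrite -{2}e /=; apply: fsubst_cong; apply: forall_ord2; rewrite !tnthE.
Qed.

(** First the curve is moved, then, with the curve fixed, the remaining data of
    level [k] are chosen; neither move disturbs the lower levels. *)
Lemma nf_step k H (Q : A) : (1 <= k)%N -> normal_coords_Q M H Q -> nf_upto Q k ->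
  exists H' Q', [/\ normal_coords_Q M H' Q', nf_upto Q' k.+1 & close k H' H].
Proof.
move=> k1 hQ hnf; have m1 := QM_pos hp; have m1t := QM_pos hpt.
have [fH _ _] := hQ.
have [_ hallt] := QM_has_pair hpt N2t; have [_ hall'] := QM_has_pair hp' N2'.
have [_ _ /eqP kn0] := hall' _ _ hQ.
pose a := - Q [tuple (p'.1 - 1)%N; n'; (p'.2 + k)%N] / (Q [tuple p'.1; n'; p'.2] *+ p'.1).
have [T1 [Q1 [[fT1 hQ1] _ hT1 aE cl1]]] := curve_move a hQ k1.
have hnf1 := nf_keep hQ fT1 hQ1 k1 hT1 hnf.
have c3 : Q1 [tuple (p'.1 - 1)%N; n'; (p'.2 + k)%N] = 0.
  rewrite (level_curve_pair n' hp' N2' hQ fT1 hQ1 k1 hT1) //; [|lia..].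
  rewrite subn1 !eqxx /= aE /a -subn1 -mulrnAr divfK ?subrr ?addrN //.
  by rewrite mulrn_eq0 negb_or kn0 andbT; apply/eqP; lia.
set H1 := coords_comp H T1 in hQ1.
pose cc j := Q1 [tuple p.1; j; (p.2 + k)%N].
pose ct := Q1 [tuple pt.1; nt; (pt.2 + k)%N].
have i0 : (2 * 'i%C : C) != 0 by rewrite mulf_neq0 ?two_neq0 ?im_neq0.
have n1 : (1 <= n)%N := nM_pos hp N2 hQ.
(* On the exceptional level [g] is free and taken to be [0]. *)
have [f1 [g [e1 e2]]] : exists f1 g, level_form f1 g p.1 n p.2 k = - cc n / (2 * 'i%C) /\
    (~ Kset M p pt k -> complex.Re (level_form f1 g pt.1 nt pt.2 k) = - complex.Im (eps^-1 * ct) / complex.Re c).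
  have [hK|hK] := pselect (Kset M p pt k).
    by have [f e] := level_solve1 p.2 k an m1 (- cc n / (2 * 'i%C)); exists f, 0.
  have [|f [g [e e']]] := @level_solve2 R p.1 n p.2 pt.1 nt pt.2 k an (- cc n / (2 * 'i%C)) (- complex.Im (eps^-1 * ct) / complex.Re c).
    by apply/eqP => h; apply: hK; apply/KsetE.
  by exists f, g.
(* For [i >= 2] the coefficient of [chi^(n + i - 1)] is cancelled. *)
pose f : fps R 1 := fun m => let i := tnth m ord0 in
  if i == 0%N then 0 else if i == 1%N then f1 else ((- cc (n + i - 1)%N / (2 * 'i%C *+ n))^*)%C.
have fE i : f [tuple i] = if i == 0%N then 0 else if i == 1%N then f1 else ((- cc (n + i - 1)%N / (2 * 'i%C *+ n))^*)%C.
  by [].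
have zf : zc f by rewrite /zc /fcoef0 mzero1E fE.
have [T2 [Q2 [[fT2 hQ2] _ hT2 [fT gT] cl2]]] := fixed_move hQ1 k1 zf (conjc_real g).
have hT2' : near_id T2 k k by case: hT2 => h1 h2 h3; split=> // l hl; apply: h2; apply: ltnW.
have hnf2 := nf_keep hQ1 fT2 hQ2 k1 hT2' hnf1.
have T20 : T2.1 [tuple 0%N; k] = 0 by rewrite fT fE.
have T21 : T2.1 [tuple 1%N; k] = f1 by rewrite fT fE.
have [hl1 hs1 _] := hnf1; have lE := (lead_normalizedE M p Q1).1 hl1.
have sE := (second_normalizedE p eps (hallt _ _ hQ1)).1 hs1.
have cond2 : nf_cond Q2 k.
  split.
  - move=> j hj; rewrite (level_fixed_pair j hp N2 hQ1 fT2 hQ2 k1 hT2) lE T21 gT.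
    have hj1 : (n <= j.+1)%N by apply: leq_trans hj _.
    have off i : i <> n -> Q1 [tuple p.1; i; p.2] = 0 by move=> hi; rewrite lE; case: eqP.
    rewrite (coef_dlead_mono T2 m1 N2 k1 hj1 off) lE (eqxx n) fT fE.
    have [->|/eqP nj] := eqVneq j n.
      rewrite (_ : (n - n.-1 = 1)%N); last by lia.
      rewrite /= -/(cc n) [_ * (2 * 'i%C)]mulrC -addrA -mulrDr level_formE e1.
      by rewrite mulrCA divff // mulr1 subrr.
    rewrite (_ : (j - n.-1 == 0)%N = false); last by apply/eqP; lia.
    rewrite (_ : (j - n.-1 == 1)%N = false); last by apply/eqP; lia.
    rewrite conjcK (_ : (n + (j - n.-1) - 1 = j)%N); last by lia.
    rewrite mulr0 addr0 -/(cc j) [_ * (_ *+ n)]mulrnAr -mulrnAl mulrCA divff ?mulr1 ?subrr //.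
    by rewrite mulrn_eq0 negb_or i0 andbT -lt0n.
  - rewrite (level_curve_pair n' hp' N2' hQ1 fT2 hQ2 k1 hT2') //; [|lia..].
    by rewrite T20 mul0r mul0rn c3 add0r; case: ifP.
  - move=> hK; rewrite (level_fixed_pair nt hpt N2t hQ1 fT2 hQ2 k1 hT2) T21 gT.
    have [_ hlow _] := hallt _ _ hQ1.
    rewrite (coef_dlead_low m1t N2t k1 T20 hlow) T21 -/ct sE -addrA [_ * ('i%C * _ * _)]mulrC -mulrDr level_formE.
    by rewrite Im_second e2 // mulrCA divff ?Re_c_neq0 // mulr1 subrr.
exists (coords_comp H1 T2), Q2; split=> //.
- have [h1 h2 h3] := hnf2; split=> // j j1; rewrite ltnS leq_eqVlt => /orP[/eqP -> //|].
  exact: h3.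
- have [a1 a2] := coords_comp_close fH fT1 cl1.
  have [b1 b2] := coords_comp_close (coords_comp_formal fH fT1) fT2 cl2.
  split.
    by rewrite (_ : _ - _ = ((coords_comp H1 T2).1 - H1.1) + (H1.1 - H.1)); [apply: fordD|rewrite addrA subrK].
  by rewrite (_ : _ - _ = ((coords_comp H1 T2).2 - H1.2) + (H1.2 - H.2)); [apply: fordD|rewrite addrA subrK].
Qed.

End Form.

(** * Existence of the normal form *)
Section Limit.
Variable R : realType.
Local Notation C := R[i].
Local Notation A := (fps R 3).
Implicit Types (M : formal_hypersurface R) (H T : fps R 2 * fps R 2) (Q : A).

Lemma fordC n N (f g : fps R n) : ford N (f - g) -> ford N (g - f).
Proof. by move=> h m hm; rewrite -opprB fcfN h // oppr0. Qed.

Lemma ford_trans n N (f g h : fps R n) : ford N (f - g) -> ford N (g - h) -> ford N (f - h).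
Proof. by move=> h1 h2; rewrite -(subrKA g); apply: fordD. Qed.

Lemma ford_conjB n N (f g : fps R n) : ford N (f - g) -> ford N (fconj f - fconj g).
Proof. by move=> h; rewrite -fconjN -fconjD; apply: ford_conj. Qed.

Lemma ford_sub_eq n N (f g : fps R n) m : ford N (f - g) -> (mdeg m < N)%N -> f m = g m.
Proof. by move=> h hm; apply/eqP; rewrite -subr_eq0 -fcfB h. Qed.

Lemma ford_subst2 q n N (f f' : fps R q) (g g' : q.-tuple (fps R n)) : zct g ->
  ford N (f - f') -> (forall i, ford N (tnth g i - tnth g' i)) ->
  ford N (fsubst f g - fsubst f' g').
Proof.
move=> zg hf hg; apply: ford_trans (fsubst_cong f' hg).
by rewrite -fsubstB; apply: ford_subst.
Qed.

Lemma pullback_root M H Q : normal_coords_Q M H Q -> pullback M H (munit (inord 1)) <> 0.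
Proof.
move=> [_ nQ [u u0 eu]]; have zQ := normalQ_zc nQ; rewrite eu -[fmul _ _]/(u * _).
have z40 := @zcvar R 4 (inord 0). have z41 := @zcvar R 4 (inord 1).
have z42 := @zcvar R 4 (inord 2). have z43 := @zcvar R 4 (inord 3).
have e0 : zc (eqn_Q Q) by rewrite eqn_QE; zc_tac.
rewrite coef_munitM [fcoef0 (eqn_Q Q)]e0 mulr0 addr0 eqn_QE fcfB normalQ_munit // /fvar !munit_eq eqxx inord_neq // subr0 mulr1.
exact: u0.
Qed.

Lemma pullback_zct H : formal_coords H -> zct ([tuple fsubst H.1 [tuple 'x_0; 'x_1]; fsubst H.2 [tuple 'x_0; 'x_1];
           fsubst (fconj H.1) [tuple 'x_2; 'x_3];
           fsubst (fconj H.2) [tuple 'x_2; 'x_3]] : 4.-tuple (fps R 4)).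
Proof.
move=> /formal_coordsE[h1 h2 _].
have z40 := @zcvar R 4 (inord 0). have z41 := @zcvar R 4 (inord 1).
have z42 := @zcvar R 4 (inord 2). have z43 := @zcvar R 4 (inord 3).
zc_tac.
Qed.

Lemma pullback_close M H T k : formal_coords H -> close k H T -> ford k (pullback M H - pullback M T).
Proof.
move=> fH [c1 c2].
have z40 := @zcvar R 4 (inord 0). have z41 := @zcvar R 4 (inord 1).
have z42 := @zcvar R 4 (inord 2). have z43 := @zcvar R 4 (inord 3).
apply: fsubst_cong; apply: forall_ord4; rewrite !tnthE; apply: ford_subst2.
all: try (by zc_tac).
all: try (by move=> i m _; rewrite subrr).
all: by [|apply: ford_conjB].
Qed.

(** A sequence of normal coordinates that stabilizes degree by degree has a
    limit, and the defining series converge along with it: the implicit function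
    theorem is continuous for the order filtration. *)
Lemma coords_limit M (Hs : nat -> fps R 2 * fps R 2) (Qs : nat -> A) :
  (forall k, normal_coords_Q M (Hs k) (Qs k)) -> (forall k, close k.+1 (Hs k.+1) (Hs k)) ->
  exists H Q, normal_coords_Q M H Q /\ forall k, ford k.+1 (Q - Qs k).
Proof.
move=> hn hc.
pose H : fps R 2 * fps R 2 := (fun m => (Hs (mdeg m)).1 m, fun m => (Hs (mdeg m)).2 m).
have hcj j d : close d.+1 (Hs (d + j)%N) (Hs d).
  elim: j => [|j [IH1 IH2]]; first by rewrite addn0; split=> m _; rewrite subrr.
  have [h1 h2] := hc (d + j)%N; have le : (d.+1 <= (d + j).+1)%N by lia.
  by rewrite addnS; split; [apply: ford_trans (fordW le h1) IH1|apply: ford_trans (fordW le h2) IH2].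
have hH k : close k.+1 H (Hs k).
  split=> m hm; have [h1 h2] := hcj (k - mdeg m)%N (mdeg m).
    by rewrite subnKC // in h1; rewrite fcfB /= (ford_sub_eq h1) ?subrr.
  by rewrite subnKC // in h2; rewrite fcfB /= (ford_sub_eq h2) ?subrr.
have fH : formal_coords H.
  apply/formal_coordsE; have [/formal_coordsE[z1 z2 d] _ _] := hn 1%N; have [h1 h2] := hH 1%N.
  have d0 : (@mdeg 2 (mzero 2) < 2)%N by rewrite mdeg0.
  by split; rewrite /zc /fcoef0 ?(ford_sub_eq h1) ?(ford_sub_eq h2) ?mdeg_munit.
pose P := pullback M H.
have hP k : ford k.+1 (P - pullback M (Hs k)) := pullback_close M fH (hH k).
have zP : zc P by rewrite /zc /P fcoef0_subst ?fh_coef0 //; exact: pullback_zct.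
have P1 : P (munit (inord 1)) <> 0.
  by rewrite (ford_sub_eq (hP 1%N)) ?mdeg_munit //; exact: pullback_root (hn 1%N).
have [Q zQ eQ] := ift zP P1; have [u u0 eu] := ift_factor zQ eQ.
have z0 := @zcvar R 3 (inord 0). have z1 := @zcvar R 3 (inord 1). have z2 := @zcvar R 3 (inord 2).
have hQ k : ford k.+1 (Q - Qs k).
  have [_ nQ gQ] := hn k; have zQk := normalQ_zc nQ.
  apply: (ift_cont z0 zQ zQk z1 z2 P1).
  have e := given_by_root zQk gQ; rewrite eQ -e -fsubstB.
  by apply: ford_subst; [zc_tac|apply: fordC].
exists H, Q; split=> //; split=> //; last by exists u; rewrite ?u0 // -/P eu eqn_QE.
have lim2 n (a b c : fps R n) (a' b' c' : nat -> fps R n) (l : fps R n) : zc a -> zc b -> zc c ->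
    (forall k, ford k.+1 (a - a' k)) -> (forall k, ford k.+1 (b - b' k)) -> (forall k, ford k.+1 (c - c' k)) ->
    (forall k, fsubst (Qs k) [tuple a' k; b' k; c' k] = l) -> fsubst Q [tuple a; b; c] = l.
  move=> za zb zc' ha hb hc' e; apply/eqP; rewrite -subr_eq0; apply/eqP; apply: ford_eq0 => N.
  apply: (fordW (leqnSn N)); rewrite -(e N); apply: ford_subst2 => //; first by zc_tac.
  by apply: forall_ord3; rewrite !tnthE.
have f0 n (a : fps R n) k : ford k.+1 (a - a) by move=> m _; rewrite subrr.
split.
- apply: (lim2 _ _ _ _ (fun=> 'x_0) (fun=> 0) (fun=> 'x_2)); try exact: f0; try zc_tac.
  by move=> k; have [_ nQ _] := hn k; apply: normalQ1 => //; zc_tac.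
- apply: (lim2 _ _ _ _ (fun=> 0) (fun=> 'x_1) (fun=> 'x_2)); try exact: f0; try zc_tac.
  by move=> k; have [_ nQ _] := hn k; apply: normalQ2 => //; zc_tac.
- apply: (lim2 _ _ _ _ (fun=> 'x_0) (fun=> 'x_1)
    (fun k => fsubst (fconj (Qs k)) [tuple 'x_1; 'x_0; 'x_2])); try exact: f0; try zc_tac.
  + by move=> k; rewrite -fsubstB; apply: ford_subst; [zc_tac|apply: ford_conjB].
  + by move=> k; have [_ nQ _] := hn k; apply: normalQ3 => //; zc_tac.
Qed.

Section Existence.
Variables (M : formal_hypersurface R) (p pt p' : nat * nat).
Hypotheses (hp : QM M p) (hpt : QM M pt) (ne : p <> pt) (an : p.1 <> nM M p).
Hypotheses (hp'c : p' = p \/ p' = pt) (p'1 : (1 < p'.1)%N).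

Lemma nf_upto1 Q : lead_normalized M p Q -> second_normalized M p pt (epsilonM M p pt) Q ->
  nf_upto M p pt p' Q 1.
Proof. by move=> h1 h2; split=> // j j1; rewrite ltnNge j1. Qed.

Lemma nf_sequence : exists HQ : nat -> (fps R 2 * fps R 2) * A,
  [/\ forall k, normal_coords_Q M (HQ k).1 (HQ k).2,
      forall k, nf_upto M p pt p' (HQ k).2 k.+1 &
      forall k, close k.+1 (HQ k.+1).1 (HQ k).1].
Proof.
pose S k := {x : (fps R 2 * fps R 2) * A | normal_coords_Q M x.1 x.2 /\ nf_upto M p pt p' x.2 k.+1}.
have s0 : {x : S 0%N | True}.
  apply: cid; have [H [Q [h1 h2 h3]]] := start_coords hp hpt ne an.
  have hx : normal_coords_Q M (H, Q).1 (H, Q).2 /\ nf_upto M p pt p' (H, Q).2 1.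
    by split=> //; apply: nf_upto1.
  by exists (exist _ (H, Q) hx).
have ss k (x : S k) : {y : S k.+1 | close k.+1 (sval y).1 (sval x).1}.
  apply: cid; case: x => [[H Q] [/= hQ hnf]].
  have [H' [Q' [h1 h2 h3]]] := nf_step hp hpt ne an hp'c p'1 (ltn0Sn k) hQ hnf.
  have hx : normal_coords_Q M (H', Q').1 (H', Q').2 /\ nf_upto M p pt p' (H', Q').2 k.+2 by [].
  by exists (exist _ (H', Q') hx).
pose st := fix st k : S k := if k is j.+1 then sval (ss j (st j)) else sval s0.
exists (fun k => sval (st k)); split=> k.
- by case: (svalP (st k)).
- by case: (svalP (st k)).
- exact: (svalP (ss k (st k))).
Qed.

Lemma normal_form_exists : exists H, normal_form_coords M p pt p' H.
Proof.
have [HQ [h1 h2 h3]] := nf_sequence.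
have [H [Q [hQ hlim]]] := coords_limit h1 h3.
have same (m : mindex 3) k : (mdeg m <= k)%N -> Q m = (HQ k).2 m.
  by move=> hm; apply: ford_sub_eq (hlim k) _.
have [_ hallt] := QM_has_pair hpt (QM_deg2 hpt hp (fun e => ne (esym e))).
exists H, Q => //; apply/normal_formE => // K; split.
- apply/lead_normalizedE => i; set m := [tuple _; _; _].
  have [h _ _] := h2 (mdeg m); rewrite (same m (mdeg m)) //; exact: (lead_normalizedE M p _).1 h i.
- apply/second_normalizedE; first exact: hallt hQ.
  set m := [tuple _; _; _]; have [_ h _] := h2 (mdeg m); rewrite (same m (mdeg m)) //.
  by apply/(second_normalizedE p (epsilonM M p pt) (hallt _ _ (h1 (mdeg m)))).
- move=> j j1 _.
  have cond (m : mindex 3) : exists k, [/\ (mdeg m <= k)%N & nf_cond M p pt p' (HQ k).2 j].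
    exists (mdeg m + j)%N; split; first exact: leq_addr.
    by have [_ _ h] := h2 (mdeg m + j)%N; apply: h => //; rewrite ltnS leq_addl.
  split.
  + by move=> i hi; have [k [hk [h _ _]]] := cond [tuple p.1; i; (p.2 + j)%N]; rewrite (same _ _ hk) h.
  + by have [k [hk [_ h _]]] := cond [tuple (p'.1 - 1)%N; nM M p'; (p'.2 + j)%N]; rewrite (same _ _ hk) h.
  + by move=> hK; have [k [hk [_ _ h]]] := cond [tuple pt.1; nM M pt; (pt.2 + j)%N]; rewrite (same _ _ hk) h.
Qed.

End Existence.
End Limit.

(** * Uniqueness of the normalizing coordinates *)
Section Restrict.
Variable R : realType.
Local Notation C := R[i].
Implicit Types (f : fps R 2) (g : fps R 1).

Lemma madd2 a b c d : madd [tuple a; b] [tuple c; d] = [tuple a + c; b + d]%N :> mindex 2.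
Proof. by apply: eq_from_tnth; apply: forall_ord2; rewrite tnth_madd !tnthE. Qed.

Lemma coef_restr0 f i : (fsubst f [tuple 'x_0; 0] : fps R 1) [tuple i] = f [tuple i; 0%N].
Proof.
have z1 := @zcvar R 1 (inord 0). have z20 := @zcvar R 2 (inord 0). have z21 := @zcvar R 2 (inord 1).
pose r : fps R 1 := fun k => f [tuple tnth k ord0; 0%N].
pose f' : fps R 2 := fun m => f [tuple tnth m ord0; (tnth m (inord 1)).+1].
have e : f = fsubst r [tuple 'x_0] + 'x_1 * f'.
  apply: fpsP => m; have [b [c ->]] := tuple2P m; rewrite fcfD coef_x0_2 fvarE munit2E //.
  case: c => [|c].
    rewrite fcf_monM0 ?addr0 // => l; have [b' [c' ->]] := tuple2P l.
    by rewrite madd2 => -[].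
  rewrite add0r -[c.+1]add1n -{1}[b]add0n -madd2 fcf_monM /f' tnthE.
  by rewrite madd2 add0n.
by rewrite [X in fsubst X _]e; fs; rewrite mul0r addr0 fsubst_id1.
Qed.

Lemma coef_restr1 f i : (fsubst f [tuple 0; 'x_0] : fps R 1) [tuple i] = f [tuple 0%N; i].
Proof.
have z1 := @zcvar R 1 (inord 0). have z20 := @zcvar R 2 (inord 0). have z21 := @zcvar R 2 (inord 1).
pose r : fps R 1 := fun k => f [tuple 0%N; tnth k ord0].
pose f' : fps R 2 := fun m => f [tuple (tnth m ord0).+1; tnth m (inord 1)].
have e : f = fsubst r [tuple 'x_1] + 'x_0 * f'.
  apply: fpsP => m; have [b [c ->]] := tuple2P m; rewrite fcfD coef_x1_2 fvarE munit2E //.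
  case: b => [|b].
    rewrite fcf_monM0 ?addr0 // => l; have [b' [c' ->]] := tuple2P l.
    by rewrite madd2 => -[].
  rewrite add0r -[b.+1]add1n -{1}[c]add0n -madd2 fcf_monM /f' tnthE.
  by rewrite madd2 add0n.
by rewrite [X in fsubst X _]e; fs; rewrite mul0r addr0 fsubst_id1.
Qed.

(** The binomial expansion up to first order in [d]. *)
Lemma pow_expand n N (d : fps R 1) : (2 <= N)%N -> ford N d ->
  ford (N + n.+1) (('x_0 + d) ^+ n.+1 - 'x_0 ^+ n.+1 - ('x_0 ^+ n * d) *+ n.+1).
Proof.
move=> N2 hd; have z1 := @zcvar R 1 (inord 0).
elim: n => [|n IH].
  rewrite !expr1 expr0 mul1r mulr1n => m _; rewrite (_ : _ - _ = 0) //; ring.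
set E := (X in ford _ X) in IH.
have -> : ('x_0 + d) ^+ n.+2 - 'x_0 ^+ n.+2 - ('x_0 ^+ n.+1 * d) *+ n.+2 =
  ('x_0 ^+ n * (d * d)) *+ n.+1 + ('x_0 + d) * E.
  rewrite /E !mulrSr !exprS; ring.
apply: fordD.
  apply: (@fordW _ _ _ (n + (N + N))%N); first by lia.
  have h2 := fordM (fordX (e := n) z1) (fordM hd hd).
  by elim: n.+1 => [|j IHj] => [m _|]; rewrite ?mulr0n // mulrS; exact: fordD.
apply: (@fordW _ _ _ (1 + (N + n.+1))%N); first by lia.
apply: fordM IH; apply: ford1; apply: zcD => //; apply: (@ford_zc _ _ N.-1).
by rewrite prednK //; lia.
Qed.

(** If [g = x + d] with [d] of order [N >= 2], then [g^n - x^n] has lowest term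
    [n x^(n-1) d], so that [d] has order [N + 1]. *)
Lemma pow_inj n (g : fps R 1) : (1 <= n)%N -> zc g -> g [tuple 1%N] = 1 ->
  g ^+ n = 'x_0 ^+ n -> g = 'x_0.
Proof.
case: n => // n _ zg g1 e; pose d := g - 'x_0.
have eg : 'x_0 + d = g by rewrite /d addrC subrK.
suff h N : ford N.+2 d by rewrite -eg (@ford_eq0 _ _ d) ?addr0 // => N m hm; apply: (h N) => //; lia.
elim: N => [|N IH].
  move=> m; have [i ->] := tuple1P m; rewrite mdeg1 /d fcfB fvarE munit1E /mon.
  case: i => [|[|//]] _; last by rewrite g1 eqxx subrr.
  by rewrite -mzero1E [g _]zg mzero1E (_ : _ == _ = false) ?subrr //; apply/eqP => -[].
have h := pow_expand (n := n) (isT : (2 <= N.+2)%N) IH; rewrite eg e subrr sub0r in h.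
move=> m; have [i ->] := tuple1P m; rewrite mdeg1 ltnS leq_eqVlt => /orP[/eqP ->|hi]; last first.
  by apply: IH; rewrite mdeg1.
have := h [tuple (n + N.+2)%N]; rewrite mdeg1 fcfN fcfMn coef1_XM.
have -> : (n + N.+2 < N.+2 + n.+1)%N by lia.
by move=> /(_ isT)/eqP; rewrite oppr_eq0 mulrn_eq0 /= => /eqP.
Qed.

End Restrict.

Section Rigidity.
Variable R : realType.
Local Notation C := R[i].
Local Notation A := (fps R 3).
Variables (M : formal_hypersurface R) (p pt p' : nat * nat).
Hypotheses (hp : QM M p) (hpt : QM M pt) (ne : p <> pt) (an : p.1 <> nM M p).
Hypotheses (hp'c : p' = p \/ p' = pt) (p'1 : (1 < p'.1)%N).

Let n := nM M p.
Let nt := nM M pt.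
Let n' := nM M p'.
Let eps := epsilonM M p pt.
Let c := cM M p pt.

Let N2 : (2 <= p.1 + p.2)%N := QM_deg2 hp hpt ne.
Let N2t : (2 <= pt.1 + pt.2)%N := QM_deg2 hpt hp (fun e => ne (esym e)).
Let hp' : QM M p'. Proof. by case: hp'c => ->. Qed.
Let N2' : (2 <= p'.1 + p'.2)%N. Proof. by case: hp'c => ->. Qed.
Let m1 : (1 <= p.1)%N := QM_pos hp.
Let m1t : (1 <= pt.1)%N := QM_pos hpt.

Section Transition.
Variables (H T : fps R 2 * fps R 2) (Q Q' : A).
Hypotheses (hQ : normal_coords_Q M H Q) (fT : formal_coords T)
  (hQ' : normal_coords_Q M (coords_comp H T) Q').
Hypotheses (nfQ : normal_form M p pt p' Q) (nfQ' : normal_form M p pt p' Q').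

Let nf k : nf_upto M p pt p' Q k := (normal_formE _ _ _ _ _).1 nfQ k.
Let nf' k : nf_upto M p pt p' Q' k := (normal_formE _ _ _ _ _).1 nfQ' k.
Let ht : trans T Q Q' := trans_of hQ fT hQ'.
Let nQ : normal_Q Q. Proof. by case: hQ. Qed.
Let nQ' : normal_Q Q'. Proof. by case: hQ'. Qed.

Let lE i : Q [tuple p.1; i; p.2] = if i == n then 2 * 'i%C else 0.
Proof. by have [/lead_normalizedE h _ _] := nf 0. Qed.
Let lE' i : Q' [tuple p.1; i; p.2] = if i == n then 2 * 'i%C else 0.
Proof. by have [/lead_normalizedE h _ _] := nf' 0. Qed.
Let i0 : (2 * 'i%C : C) != 0.
Proof. by rewrite mulf_neq0 ?two_neq0 ?im_neq0. Qed.
Let n1 : (1 <= n)%N := nM_pos hp N2 hQ.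
Let sE : Q [tuple pt.1; nt; pt.2] = 'i%C * c * eps.
Proof.
have [_ hall] := QM_has_pair hpt N2t; have [_ h _] := nf 0.
exact: (second_normalizedE p eps (hall _ _ hQ)).1.
Qed.
Let sE' : Q' [tuple pt.1; nt; pt.2] = 'i%C * c * eps.
Proof.
have [_ hall] := QM_has_pair hpt N2t; have [_ h _] := nf' 0.
exact: (second_normalizedE p eps (hall _ _ hQ')).1.
Qed.

(** Both normalized coefficients are fixed by the rescaling. *)
Lemma transition_Cset :
  (Cset p.1 n p.2 `&` Cset pt.1 nt pt.2) (lin_z T, lin_w T).
Proof.
have [g0 r0 rc e] := pair_coef_trans hp N2 hQ fT hQ'.
have [_ _ _ et] := pair_coef_trans hpt N2t hQ fT hQ'.
have rI : complex.Im (lin_w T) = 0 by apply/conjc_Im.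
have c0 : 'i%C * c * eps != 0.
  have [_ hall] := QM_has_pair hpt N2t; have [_ _ /eqP h] := hall _ _ hQ; by rewrite -sE.
split; split=> //=.
- move: e; rewrite lE lE' -/n eqxx => /esym/eqP; rewrite -subr_eq0 -{2}[2 * 'i%C]mul1r -mulrBl mulf_eq0.
  by rewrite (negbTE i0) orbF subr_eq0 => /eqP.
- move: et; rewrite -/nt sE sE' => /esym/eqP; rewrite -subr_eq0 -{2}['i%C * c * eps]mul1r -mulrBl mulf_eq0.
  by rewrite (negbTE c0) orbF subr_eq0 => /eqP.
Qed.

(** The normalized leading term forces the tangential part of the transition to
    be linear. *)
Lemma near_id_start : lin_z T = 1 -> lin_w T = 1 -> near_id T 1 1.
Proof.
move=> g1 r1; have [t1 t2 hb _ r0] := trans_data fT nQ nQ' ht.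
have [_ hall] := QM_has_pair hp N2; have [hs _ _] := hall _ _ hQ.
have hl := lead_coef_trans t1 t2 nQ nQ' hb ht m1 N2 hs r0.
set f0 := fsubst (fconj T.1) _ in hl.
have zf0 : zc f0 := f0_zc t1.
have leadE (P : A) : lead_normalized M p P -> coefchi P p.1 p.2 = fC (2 * 'i%C) * 'x_0 ^+ n.
  by move=> ->; rewrite fscaleE fexpE.
have f0E : f0 = 'x_0.
  apply: (pow_inj n1 zf0); first by rewrite /f0 f0_lin // g1 conjc1.
  have [l1 _ _] := nf 0; have [l2 _ _] := nf' 0.
  move: hl; rewrite !leadE // -/(lin_z T) -/(lin_w T) g1 r1 !expr1n mulr1 fC1 !mul1r.
  rewrite fsubstM ?fsubstC ?fsubstX ?fsubst_var; [|by zc_tac..].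
  rewrite tnthE => h; apply: fpsP => m; have := congr1 (fun f : fps R 1 => f m) h.
  by rewrite !fcf_CM => /(mulfI i0).
split=> [b k|k|k].
- case: k => // _; have := congr1 (fun f : fps R 1 => f [tuple b]) f0E.
  rewrite /f0 coef_restr0 fvarE munit1E /mon => h.
  have -> : T.1 [tuple b; 0%N] = ((fconj T.1 [tuple b; 0%N])^*)%C by rewrite /fconj conjcK.
  rewrite h conjc_nat andbT; congr (_ %:R); congr nat_of_bool.
  by apply/eqP/eqP => [[]|->].
- exact: at0_1.
- by case: k => [|[|//]] _; [rewrite -munit00; exact: t2|rewrite -/(lin_w T) r1].
Qed.

(** The equations of level [k] are the same as in [nf_step], with zero right-hand
    sides. *)
Lemma near_id_step k : (1 <= k)%N -> near_id T k k ->
  (Kset M p pt k -> near_id T k k.+1 -> complex.Re (T.2 [tuple 0%N; k.+1]) = 0) ->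
  near_id T k.+1 k.+1.
Proof.
move=> k1 hT hRe; have [t1 t2 hb _ _] := trans_data fT nQ nQ' ht.
have [_ hall] := QM_has_pair hp N2; have [hs _ _] := hall _ _ hQ.
have [_ hallt] := QM_has_pair hpt N2t; have [_ lowt _] := hallt _ _ hQ.
have [_ hall'] := QM_has_pair hp' N2'; have [_ _ kn0] := hall' _ _ hQ.
have [_ _ /(_ k k1 (ltnSn k)) [q1 q2 q3]] := nf k.+1.
have [_ _ /(_ k k1 (ltnSn k)) [q1' q2' q3']] := nf' k.+1.
have T0 : T.1 [tuple 0%N; k] = 0.
  have := level_curve_pair n' hp' N2' hQ fT hQ' k1 hT (b := (p'.1 - 1)%N) (l := (p'.2 + k)%N).
  rewrite q2 q2' add0r subn1 !eqxx /= => /(_ _ _ _)/esym/eqP.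
  have x1 : (0 < p'.1.-1)%N by lia.
  rewrite mulrn_eq0 mulf_eq0 => /(_ x1 (leqnn _) (leqnn _)) /orP[/eqP|/orP[/eqP //|/eqP //]].
  by lia.
have hT' : near_id T k k.+1.
  case: hT => h1 h2 h3; split=> // l; rewrite ltnS leq_eqVlt => /orP[/eqP -> //|]; exact: h2.
set f1 := T.1 [tuple 1%N; k]; pose g := complex.Re (T.2 [tuple 0%N; k.+1]).
have gE : T.2 [tuple 0%N; k.+1] = (g%:C)%C.
  have /conjc_Im : ((T.2 [tuple 0%N; k.+1])^*)%C = T.2 [tuple 0%N; k.+1].
    by case: hT' => _ h _; exact: (coef_real t1 t2 nQ hb m1 N2 (ltn0Sn k) hs h (leqnn _)).
  by rewrite /g; case: (T.2 _) => a b /= ->.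
have eqp j : (n <= j)%N -> (f1 *+ p.1 + (g%:C)%C *+ p.2 - (g%:C)%C *+ k.+1) * (if j == n then 2 * 'i%C else 0) +
    2 * 'i%C * ((T.1 [tuple (j - n.-1)%N; k])^*%C *+ n) = 0.
  move=> hj; have hj1 : (n <= j.+1)%N by apply: leq_trans hj _.
  have off i : i <> n -> Q [tuple p.1; i; p.2] = 0 by move=> hi; rewrite lE; case: eqP.
  have := level_fixed_pair j hp N2 hQ fT hQ' k1 hT'; rewrite q1 // q1' // add0r gE.
  by rewrite (coef_dlead_mono T m1 N2 k1 hj1 off) !lE (eqxx n) => <-.
have Tb b : (2 <= b)%N -> T.1 [tuple b; k] = 0.
  move=> b2; have hj : (n <= n + b - 1)%N by lia.
  have := eqp _ hj; rewrite (_ : (_ == n) = false); last by apply/eqP; lia.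
  rewrite mulr0 add0r (_ : (n + b - 1 - n.-1 = b)%N); last by lia.
  move/eqP; rewrite mulf_eq0 (negbTE i0) mulrn_eq0 eqn0Ngt n1 /= => /eqP h.
  by rewrite -[LHS]conjcK h conjc0.
have e1 : level_form f1 g p.1 n p.2 k = 0.
  have := eqp n (leqnn n); rewrite eqxx (_ : (n - n.-1 = 1)%N); last by lia.
  rewrite mulrC -mulrDr level_formE => /eqP; rewrite mulf_eq0 (negbTE i0) => /eqP //.
have [f10 g0] : f1 = 0 /\ g = 0.
  have [hK|hK] := pselect (Kset M p pt k).
    have g0 := hRe hK hT'; rewrite -/g in g0; split=> //.
    by rewrite g0 in e1; exact: (level_uniq1 an m1 e1).
  apply: (@level_uniq2 R p.1 n p.2 pt.1 nt pt.2 k an f1 g _ e1); first by apply/eqP => h; apply: hK; apply/KsetE.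
  have := q3' hK; rewrite (level_fixed_pair _ hpt N2t hQ fT hQ' k1 hT') gE.
  rewrite (coef_dlead_low m1t N2t k1 T0 lowt) -/f1 -/nt sE -addrA [_ * ('i%C * _ * _)]mulrC -mulrDr level_formE.
  rewrite (Im_second hp hpt ne an) q3 // add0r => /eqP; rewrite mulf_eq0.
  by rewrite (negbTE (Re_c_neq0 hp hpt ne an)) => /eqP.
case: hT' => h1 h2 h3; split=> [b l|//|l].
  rewrite ltnS leq_eqVlt => /orP[/eqP ->|]; last exact: h1.
  rewrite (_ : (k == 0%N) = false) ?andbF; last by apply/eqP; lia.
  by case: b => [//|[//|b]]; exact: Tb.
rewrite leq_eqVlt => /orP[/eqP ->|]; last exact: h3.
by rewrite gE g0 (_ : (k.+1 == 1%N) = false) //; apply/eqP; lia.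
Qed.

Lemma transition_rigid : lin_z T = 1 -> lin_w T = 1 ->
  (forall k, (1 <= k)%N -> Kset M p pt k -> near_id T k k.+1 -> complex.Re (T.2 [tuple 0%N; k.+1]) = 0) ->
  T = idcoords R.
Proof.
move=> g1 r1 hRe; have [t1 t2 hb _ _] := trans_data fT nQ nQ' ht.
have hall k : near_id T k.+1 k.+1.
  elim: k => [|k IH]; first exact: near_id_start.
  by apply: near_id_step => // hK; apply: hRe.
have T1 : T.1 = 'x_0.
  apply: fpsP => m; have [b [l ->]] := tuple2P m; rewrite coef_var2_0.
  by case: (hall l) => h _ _; apply: h.
have T2 : T.2 = 'x_1.
  have z20 := @zcvar R 2 (inord 0). have z21 := @zcvar R 2 (inord 1). have z1 := @zcvar R 1 (inord 0).
  have := hb; rewrite /base T1 fconj_var.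
  rewrite fsubst_var; last by zc_tac.
  rewrite tnthE normalQ1 //; last by zc_tac.
  have -> : fsubst (fconj T.2) [tuple 0; 'x_1] = fsubst (fsubst (fconj T.2) [tuple 0; 'x_0] : fps R 1) [tuple 'x_1] :> fps R 2.
    by fs.
  move=> e; apply: fpsP => m; have [b [l ->]] := tuple2P m.
  rewrite {1}e coef_x1_2 coef_restr1 coef_var2_1 /fconj; case: eqP => //= _.
  by case: (hall l) => _ _ h; rewrite h ?conjc_nat //; lia.
by case: (T) T1 T2 => a b /= -> ->.
Qed.

End Transition.
End Rigidity.

Section Comparison.
Variable R : realType.
Local Notation C := R[i].
Local Notation A := (fps R 3).
Implicit Types (M : formal_hypersurface R) (H T S : fps R 2 * fps R 2) (f : fps R 2).

Lemma iter_fderiv1E n f : fcoef0 (iter n (fderiv (inord 1)) f) = f [tuple 0%N; n] *+ n`!.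
Proof.
have h k : (iter n (fderiv (inord 1)) f) [tuple 0%N; k] = f [tuple 0%N; k + n]%N *+ ((k + n) ^_ n).
  elim: n k => [|n IH] k; first by rewrite addn0 ffactn0 mulr1n.
  have e : madd [tuple 0%N; k] (munit (inord 1)) = [tuple 0%N; k.+1] :> mindex 2.
    by rewrite munit2E // madd2 /= addn0 addn1.
  rewrite iterS /fderiv e IH tnthE -mulrnA addSnnS ffactnSr.
  by congr (_ *+ (_ * _)%N); lia.
by rewrite /fcoef0 munit00 h add0n ffactnn.
Qed.

Lemma coords_comp_lin T S : formal_coords T -> formal_coords S ->
  T.2 (munit (inord 0)) = 0 -> S.2 (munit (inord 0)) = 0 ->
  lin_z (coords_comp T S) = lin_z T * lin_z S /\ lin_w (coords_comp T S) = lin_w T * lin_w S.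
Proof.
move=> /formal_coordsE[t1 t2 _] /formal_coordsE[s1 s2 _] T0 S0.
by rewrite !lin_zE !lin_wE /coords_comp /= !coef_comp2 // T0 S0 mulr0 addr0 mul0r add0r.
Qed.

(** Along [z = 0] the components of [S] are [O (w^(k+1))] and
    [w + g w^(k+1) + O (w^(k+2))], and [T.2] has no linear term in [z], so that
    only [G_w (0) g] is added at order [k + 1], where [G = T.2]. *)
Lemma coords_comp_level T S k : formal_coords T -> formal_coords S ->
  T.2 (munit (inord 0)) = 0 -> (1 <= k)%N -> near_id S k k.+1 ->
  (coords_comp T S).2 [tuple 0%N; k.+1] = T.2 [tuple 0%N; k.+1] + lin_w T * S.2 [tuple 0%N; k.+1].
Proof.
move=> /formal_coordsE[t1 t2 _] /formal_coordsE[s1 s2 _] T0 k1 [_ hF hG].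
have z1 := @zcvar R 1 (inord 0).
pose X : fps R 1 := fsubst S.1 [tuple 0; 'x_0]; pose Y : fps R 1 := fsubst S.2 [tuple 0; 'x_0].
have zX : zc X by rewrite /X; zc_tac.
have zY : zc Y by rewrite /Y; zc_tac.
have xE i : ('x_0 : fps R 1) [tuple i] = (i == 1%N)%:R by have := coef1_X R 1 i; rewrite expr1.
have hX : ford k.+1 (X - 0).
  by move=> m; have [i ->] := tuple1P m; rewrite mdeg1 subr0 /X coef_restr1; apply: hF.
have hY : ford k.+1 (Y - 'x_0).
  by move=> m; have [i ->] := tuple1P m; rewrite mdeg1 fcfB /Y coef_restr1 xE => hi; rewrite hG // subrr.
rewrite -coef_restr1 /=.
have -> : fsubst (fsubst T.2 [tuple S.1; S.2]) [tuple 0; 'x_0] = fsubst T.2 [tuple X; Y] :> fps R 1.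
  by rewrite /X /Y; fs.
have [|||V1 e1 V10] := @fsubst_mean R 2 1 T.2 [tuple X; Y] [tuple 0; Y] (inord 0); [zc_tac|zc_tac| |].
  by apply: forall_ord2; rewrite ?tnthE ?eqxx.
have [|||V2 e2 V20] := @fsubst_mean R 2 1 T.2 [tuple 0; Y] [tuple 0; 'x_0] (inord 1); [zc_tac|zc_tac| |].
  by apply: forall_ord2; rewrite ?tnthE ?eqxx.
rewrite !tnthE in e1 e2.
have -> : fsubst T.2 [tuple X; Y] = (X - 0) * V1 + (Y - 'x_0) * (V2 - fC (lin_w T)) +
   fC (lin_w T) * (Y - 'x_0) + fsubst T.2 [tuple 0; 'x_0] :> fps R 1.
  rewrite -e1 mulrBr -e2; ring.
have h1 : ford k.+2 ((X - 0) * V1).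
  by rewrite -[k.+2]addn1; apply: fordM => //; apply: ford1; rewrite /zc V10.
have h2 : ford k.+2 ((Y - 'x_0) * (V2 - fC (lin_w T))).
  rewrite -[k.+2]addn1; apply: fordM => //; apply: ford1.
  by rewrite /zc /fcoef0 fcfB -/(fcoef0 V2) V20 lin_wE /fC eqxx subrr.
rewrite !fcfD h1 ?h2 ?mdeg1 // !add0r fcf_CM fcfB xE /Y !coef_restr1 addrC.
rewrite (_ : (k.+1 == 1%N) = false); last by apply/eqP; lia.
by rewrite subr0.
Qed.

Section Main.
Variables (M : formal_hypersurface R) (p pt p' : nat * nat).
Hypotheses (hp : QM M p) (hpt : QM M pt) (ne : p <> pt) (an : p.1 <> nM M p).
Hypotheses (hp'c : p' = p \/ p' = pt) (p'1 : (1 < p'.1)%N).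
Variable H : fps R 2 * fps R 2.
Hypothesis nfH : normal_form_coords M p pt p' H.

Lemma normal_form_data T : formal_coords T -> normal_form_coords M p pt p' (coords_comp H T) ->
  [/\ T.2 (munit (inord 0)) = 0, lin_z T <> 0, lin_w T <> 0 & ((lin_w T)^*)%C = lin_w T].
Proof.
move=> fT [Q' hQ' _]; have [Q hQ _] := nfH.
have N2 := QM_deg2 hp hpt ne; have [g0 r0 rc _] := pair_coef_trans hp N2 hQ fT hQ'.
have [_ nQ _] := hQ; have [_ nQ' _] := hQ'.
have [t1 t2 hb _ _] := trans_data fT nQ nQ' (trans_of hQ fT hQ').
by split=> //; apply: base_Gz hb.
Qed.

(** The transition from [T] to [T'] is normalized; at the exceptional level its
    free parameter is the difference of the prescribed real parts, up to the
    factor [G_w (0)]. *)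
Lemma normal_form_unique T T' : formal_coords T -> formal_coords T' ->
  normal_form_coords M p pt p' (coords_comp H T) ->
  normal_form_coords M p pt p' (coords_comp H T') ->
  lin_z T = lin_z T' -> lin_w T = lin_w T' ->
  (forall k, Kset M p pt k -> complex.Re (T.2 [tuple 0%N; k.+1]) = complex.Re (T'.2 [tuple 0%N; k.+1])) ->
  T = T'.
Proof.
move=> fT fT' nfT nfT' eg er eK.
have fH : formal_coords H by case: nfH => Q [].
have [G0 g0 r0 rc] := normal_form_data fT nfT; have [G0' _ _ _] := normal_form_data fT' nfT'.
have [S [fS TS ST]] := coords_inv fT.
pose U := coords_comp S T'; have fU : formal_coords U := coords_comp_formal fS fT'.
have TU : coords_comp T U = T' by rewrite /U -coords_compA // TS coords_comp_id.
have [Q1 hQ1 nf1] := nfT; have [Q2 hQ2 nf2] := nfT'.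
have hU : coords_comp (coords_comp H T) U = coords_comp H T' by rewrite coords_compA // TU.
rewrite -hU in hQ2.
have [_ nQ1 _] := hQ1; have [_ nQ2 _] := hQ2.
have [u1 u2 hbU _ _] := trans_data fU nQ1 nQ2 (trans_of hQ1 fU hQ2).
have U0 := base_Gz u1 u2 nQ1 hbU.
have [l1 l2] := coords_comp_lin fT fU G0 U0; rewrite TU -eg -er in l1 l2.
have gU : lin_z U = 1.
  by apply: (mulfI (_ : lin_z T != 0)); [exact/eqP|rewrite -l1 mulr1].
have rU : lin_w U = 1.
  by apply: (mulfI (_ : lin_w T != 0)); [exact/eqP|rewrite -l2 mulr1].
suff UE : U = idcoords R by rewrite -TU UE coords_comp1.
apply: (transition_rigid hp hpt ne an hp'c p'1 hQ1 fU hQ2 nf1 nf2 gU rU) => k k1 hK hk.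
clearbody U; have := eK k hK; rewrite -TU coords_comp_level // raddfD /= => /esym/eqP.
rewrite -subr_eq0 addrC addrA addNr add0r => /eqP.
have /conjc_Im rI := rc; move: r0 rI; case: (lin_w T) => a b /= r0 b0; rewrite b0 in r0 *.
move: (U.2 [tuple 0%N; k.+1]) => [x y] /=.
rewrite mul0r subr0 => /eqP; rewrite mulf_eq0 => /orP[/eqP a0|/eqP //].
by rewrite a0 in r0.
Qed.

End Main.

(** * The exceptional level *)
Section ExceptionalLevel.
Variables (M : formal_hypersurface R) (p pt : nat * nat).
Hypotheses (hp : QM M p) (hpt : QM M pt) (ne : p <> pt).

Let a := (p.1 + nM M p)%N.
Let a' := (pt.1 + nM M pt)%N.

Lemma level_detE k : level_det R p.1 (nM M p) p.2 pt.1 (nM M pt) pt.2 k =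
  (a%:R * pt.2%:R - a'%:R * p.2%:R) + (a'%:R - a%:R) * k.+1%:R.
Proof. by rewrite /level_det -/a -/a'; ring. Qed.

Lemma Kset_eq k : a = a' -> ~ Kset M p pt k.
Proof.
move=> e /KsetE [_]; rewrite level_detE -e subrr mul0r addr0 -mulrBr => /eqP.
have m1 := QM_pos hp; rewrite mulf_eq0 pnatr_eq0 subr_eq0 eqr_nat => /orP[/eqP|/eqP h].
  by rewrite /a; lia.
by have [_ h'] := pairs_incomparable hp hpt ne; apply: h'.
Qed.

Lemma Kset_lambda k : a <> a' -> Kset M p pt k <-> (1 <= k)%N /\ k%:R = lambdaM M p pt.
Proof.
move=> /eqP ne'; rewrite -(eqr_nat R) in ne'.
have d0 : (a'%:R - a%:R : R) != 0 by rewrite subr_eq0 eq_sym.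
have lE : level_det R p.1 (nM M p) p.2 pt.1 (nM M pt) pt.2 k = (k%:R - lambdaM M p pt) * (a'%:R - a%:R).
  rewrite level_detE /lambdaM -/a -/a' -natr1; move: d0; move: (k%:R) (a%:R : R) (a'%:R : R) (p.2%:R : R) (pt.2%:R : R).
  by move=> x y y' z z' d0; field.
rewrite KsetE lE; split=> -[k1 e]; split=> //; last by rewrite e subrr mul0r.
by move/eqP: e; rewrite mulf_eq0 (negbTE d0) orbF subr_eq0 => /eqP.
Qed.

Lemma Kset_unique k l : Kset M p pt k -> Kset M p pt l -> k = l.
Proof.
have [/Kset_eq h /h //|ne'] := pselect (a = a').
by move=> /(Kset_lambda _ ne')[_ e] /(Kset_lambda _ ne')[_ e']; apply/eqP; rewrite -(eqr_nat R) e e'.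
Qed.

Lemma Kset_set0 : Kset M p pt = set0 <->
  ((nM M p + p.1 = nM M pt + pt.1)%N \/
   ~~ ((lambdaM M p pt \is a Num.int) && (1 <= lambdaM M p pt))).
Proof.
have aE : (nM M p + p.1 = nM M pt + pt.1)%N <-> a = a' by rewrite /a /a' addnC [in RHS]addnC.
split=> [h0|h].
  have [e|ne'] := pselect (a = a'); [by left; apply/aE|right; apply/negP => /andP[/intrP[m em] l1]].
  case: m em l1 => m em; last by rewrite em -[1]/(1%:~R) ler_int.
  rewrite em -[1]/(1%:~R) ler_int => m1.
  by have : Kset M p pt m by [apply/Kset_lambda]; rewrite h0.
rewrite -subset0 => k hk /=; case: h => [/aE e|/negP]; first exact: (Kset_eq e hk).
have [/Kset_eq h //|ne'] := pselect (a = a'); first by have := h _ hk.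
have [k1 e] := (Kset_lambda k ne').1 hk; apply.
by rewrite -e; apply/andP; split; [exact: Num.Theory.natr_int|rewrite ler1n].
Qed.

End ExceptionalLevel.
End Comparison.

(** * The normal form theorem *)
Theorem theorem14 (R : realType) (M : formal_hypersurface R)
    (p pt p' : nat * nat)
    (p_inv : QM M p) (pt_inv : QM M pt) (p_neq_pt : p <> pt)
    (alpha_neq_n : p.1 <> nM M p)
    (p'_choice : p' = p \/ p' = pt) (alpha'_gt1 : (1 < p'.1)%N) :
  [/\ exists H : fps R 2 * fps R 2, normal_form_coords M p pt p' H,
      forall H : fps R 2 * fps R 2, normal_form_coords M p pt p' H ->
        (forall FG : fps R 2 * fps R 2,
           formal_coords FG ->
           normal_form_coords M p pt p' (coords_comp H FG) ->
           (Cset p.1 (nM M p) p.2 `&` Cset pt.1 (nM M pt) pt.2)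
             (fcoef0 (fderiv (inord 0) FG.1), fcoef0 (fderiv (inord 1) FG.2)))
        /\
        (forall FG FG' : fps R 2 * fps R 2,
           formal_coords FG ->
           normal_form_coords M p pt p' (coords_comp H FG) ->
           formal_coords FG' ->
           normal_form_coords M p pt p' (coords_comp H FG') ->
           fcoef0 (fderiv (inord 0) FG.1) = fcoef0 (fderiv (inord 0) FG'.1) ->
           fcoef0 (fderiv (inord 1) FG.2) = fcoef0 (fderiv (inord 1) FG'.2) ->
           (forall k, Kset M p pt k ->
              complex.Re (fcoef0 (iter k.+1 (fderiv (inord 1)) FG.2)) =
              complex.Re (fcoef0 (iter k.+1 (fderiv (inord 1)) FG'.2))) ->
           FG = FG'),
      (forall k l, Kset M p pt k -> Kset M p pt l -> k = l) &
      (Kset M p pt = set0 <->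
         ((nM M p + p.1 = nM M pt + pt.1)%N \/
          ~~ ((lambdaM M p pt \is a Num.int) && (1 <= lambdaM M p pt))))].
Proof.
have unique := @normal_form_unique R M p pt p' p_inv pt_inv p_neq_pt alpha_neq_n p'_choice alpha'_gt1.
split; last 2 first.
- exact: Kset_unique.
- exact: Kset_set0.
- exact: (normal_form_exists p_inv pt_inv).
move=> H nfH; split=> [FG fFG nfFG|FG FG' fFG nfFG fFG' nfFG' eg er eK].
  have [Q hQ nfQ] := nfH; have [Q' hQ' nfQ'] := nfFG.
  rewrite !fderiv0 -lin_zE -lin_wE.
  exact: (transition_Cset p_inv pt_inv p_neq_pt hQ fFG hQ' nfQ nfQ').
rewrite !fderiv0 -!lin_zE in eg; rewrite !fderiv0 -!lin_wE in er.
apply: (unique H nfH) => // k hK; have := eK k hK; rewrite !iter_fderiv1E.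
by rewrite !Re_mulnat => /eqP; rewrite eqrMn2r eqn0Ngt fact_gt0 => /eqP.
Qed.
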